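(* Let $p\ge2$ be an even integer. Let $P\subset\mathbb{R}^2$ be a polygon with diameter $2A$, and assume that $\chi_P(x_1,x_2)$ is even in both $x_1$ and $x_2$. Let $P_+=P\cap\{x_2>0\}$. If the intersection of $P$ and the line $\{x_2=0\}$ is a segment, and $t\ge t_0=\frac{(p-2)A}{4}$, then $$n_p\,c_p\le|||S_t(\chi_P)|||_{p,p}\le\binom{p}{p/2}^{\frac1p}|||\chi_{P_+}|||_{p,p}.$$
   Context: For a function $m$ on $\mathbb{R}^2$ put $m_+(x)=m(x)\chi_{\{x_2>0\}}$, $m_-(x)=m(x)\chi_{\{x_2<0\}}$, and for $t\ge0$ let $S_tm(x_1,x_2)=m_+(x_1,x_2-t)+m_-(x_1,x_2+t)$. The Fourier transform on $\mathbb{R}^n$ is $\hat f(y)=\int_{\mathbb{R}^n}e^{-2\pi i x\cdot y}f(x)\,dx$. For $m\in L^\infty(\mathbb{R}^n,\mathbb{C})$ let $T_mf(x)=\int_{\mathbb{R}^n}e^{2\pi i x\cdot y}m(y)\hat f(y)\,dy$, initially defined for $f\in C_0^\infty(\mathbb{R}^n)$; if $T_m$ extends to a bounded operator on $L^p(\mathbb{R}^n)$, $m$ is called a $(p,p)$ Fourier multiplier, and $|||m|||_{p,p}$ denotes the operator norm of $T_m$ on the complex-valued space $L^p(\mathbb{R}^n,\mathbb{C})$. It is well known that characteristic functions of polygons are $(p,p)$ multipliers for every $1<p<\infty$. The constant $n_p=|||\sigma|||_{p,p}$ is the norm on $L^p(\mathbb{R},\mathbb{C})$ of the segment multiplier $\sigma=\chi_{[a,b]}$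 on $\mathbb{R}$ (independent of $a<b$), and $c_p=|||s|||_{p,p}$ is the norm on $L^p(\mathbb{R},\mathbb{C})$ of the half-line multiplier $s=\chi_{(0,\infty)}$ on $\mathbb{R}$. *)

(* Defs.v *)
From HB Require Import structures.
From mathcomp Require Import all_boot all_order all_algebra.
From mathcomp Require Import all_classical all_reals all_analysis.
From mathcomp.real_closed Require Import complex.

Set Implicit Arguments.
Unset Strict Implicit.
Unset Printing Implicit Defensive.

Import Order.TTheory GRing.Theory Num.Theory.
Import numFieldNormedType.Exports.

Local Open Scope classical_set_scope.
Local Open Scope ring_scope.
Local Open Scope complex_scope.

(* e^(i t) *)
Definition cis (R : realType) (t : R) : R[i] := cos t +i* sin t.

Definition chi {R : realType} {T : Type} (A : set T) (x : T) : R[i] :=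
  (\1_A x : R)%:C.

(* The library has neither a measurable structure nor an integral on R[i];
   both are taken componentwise. *)
Definition cintegral d (T : measurableType d) (R : realType)
    (mu : {measure set T -> \bar R}) (f : T -> R[i]) : R[i] :=
  Rintegral mu setT (fun x => complex.Re (f x)) +i*
  Rintegral mu setT (fun x => complex.Im (f x)).

Definition cmeasurable d (T : measurableType d) (R : realType)
    (f : T -> R[i]) : Prop :=
  measurable_fun setT (fun x => complex.Re (f x)) /\
  measurable_fun setT (fun x => complex.Im (f x)).

Definition cLnorm d (T : measurableType d) (R : realType)
    (mu : {measure set T -> \bar R}) (p : R) (f : T -> R[i]) : \bar R :=
  Lnorm mu p%:E (fun x => (ComplexField.Normc.normc (f x))%:E).

Definition cLp d (T : measurableType d) (R : realType)
    (mu : {measure set T -> \bar R}) (p : R) : set (T -> R[i]) :=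
  [set f | cmeasurable f /\ (cLnorm mu p f < +oo)%E].

(* In the definitions below, [mu] is Lebesgue measure on T = R^n, [dot] the
   scalar product of R^n, and [test] the set of functions in C_0^oo(R^n). *)

Definition fourier d (T : measurableType d) (R : realType)
    (mu : {measure set T -> \bar R}) (dot : T -> T -> R)
    (f : T -> R[i]) (y : T) : R[i] :=
  cintegral mu (fun x => cis (- (2 * pi * dot x y)) * f x).

Definition multiplier_op d (T : measurableType d) (R : realType)
    (mu : {measure set T -> \bar R}) (dot : T -> T -> R)
    (m f : T -> R[i]) (x : T) : R[i] :=
  cintegral mu (fun y => cis (2 * pi * dot x y) * m y * fourier mu dot f y).

(* Elements of L^p are represented by functions, so linearity (and the
   agreement with another operator) is required almost everywhere. *)
Definition Lp_linear d (T : measurableType d) (R : realType)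
    (mu : {measure set T -> \bar R}) (p : R)
    (L : (T -> R[i]) -> (T -> R[i])) : Prop :=
  forall (c : R[i]) (f g : T -> R[i]), cLp mu p f -> cLp mu p g ->
    {ae mu, forall x, L (fun t => c * f t + g t) x = c * L f x + L g x}.

Definition Lp_opnorm d (T : measurableType d) (R : realType)
    (mu : {measure set T -> \bar R}) (p : R)
    (L : (T -> R[i]) -> (T -> R[i])) : \bar R :=
  ereal_sup [set cLnorm mu p (L f) | f in
    [set f | cLp mu p f /\ (cLnorm mu p f <= 1)%E]].

Definition bounded_extension d (T : measurableType d) (R : realType)
    (mu : {measure set T -> \bar R}) (p : R) (test : set (T -> R[i]))
    (L0 L : (T -> R[i]) -> (T -> R[i])) : Prop :=
  [/\ forall f, cLp mu p f -> cLp mu p (L f),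
      Lp_linear mu p L,
      (Lp_opnorm mu p L < +oo)%E &
      forall f, test f -> {ae mu, forall x, L f x = L0 f x}].

(* The norm of the bounded extension of T_m to L^p. This extension is unique
   up to a.e. equality, test functions being dense in L^p, so the infimum is
   over a single value; it is +oo when m is not a (p,p) multiplier. *)
Definition multiplier_norm d (T : measurableType d) (R : realType)
    (mu : {measure set T -> \bar R}) (dot : T -> T -> R)
    (test : set (T -> R[i])) (p : R) (m : T -> R[i]) : \bar R :=
  ereal_inf [set Lp_opnorm mu p L | L in
    bounded_extension mu p test (multiplier_op mu dot m)].

(* Every iterated directional derivative is (Frechet) differentiable; in finite
   dimension this is C^oo. *)
Definition smooth (R : realType) (V : normedModType R) (f : V -> R) : Prop :=
  forall (s : seq V) (x : V),
    differentiable (foldr (fun v (g : V -> R) => fun y => 'D_v g y) f s) x.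

Definition test_function (R : realType) (V : normedModType R) :
    set (V -> R[i]) :=
  [set f | [/\ smooth (fun x => complex.Re (f x)),
               smooth (fun x => complex.Im (f x)) &
               compact (closure [set x | f x != 0])]].

Definition multiplier_norm1 (R : realType) (p : R) (m : R -> R[i]) : \bar R :=
  multiplier_norm (@lebesgue_measure R) (fun x y : R => x * y)
    (@test_function R R^o) p m.

Definition multiplier_norm2 (R : realType) (p : R) (m : R * R -> R[i]) :
    \bar R :=
  multiplier_norm (@lebesgue_measure R \x @lebesgue_measure R)%E
    (fun x y : R * R => x.1 * y.1 + x.2 * y.2)
    (@test_function R (R^o * R^o)%type) p m.

Definition upper_half {R : realType} : set (R * R) := [set x | 0 < x.2].
Definition lower_half {R : realType} : set (R * R) := [set x | x.2 < 0].

Definition shift_op (R : realType) (t : R) (m : R * R -> R[i]) (x : R * R) :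
    R[i] :=
  let mp := fun z => m z * chi upper_half z in
  let mm := fun z => m z * chi lower_half z in
  mp (x.1, x.2 - t) + mm (x.1, x.2 + t).

(* The norm of the library on R * R is the max norm, hence: *)
Definition eucl_dist (R : realType) (x y : R * R) : R :=
  Num.sqrt ((x.1 - y.1) ^+ 2 + (x.2 - y.2) ^+ 2).

Definition diameter (R : realType) (A : set (R * R)) : \bar R :=
  ereal_sup [set (eucl_dist z.1 z.2)%:E | z in A `*` A].

Definition plane_segment (R : realType) (x y : R * R) : set (R * R) :=
  [set (x.1 + s * (y.1 - x.1), x.2 + s * (y.2 - x.2)) | s in `[0, 1]%classic].

(* [v 0], ..., [v (n - 1)] are the vertices, in cyclic order, of a closed
   polygonal line without self-intersection. *)
Definition edge (R : realType) n (v : 'I_n -> R * R) (i : 'I_n) :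
    set (R * R) :=
  plane_segment (v i) (v (ordS i)).

Definition simple_polygonal_line (R : realType) n (v : 'I_n -> R * R) : Prop :=
  [/\ (3 <= n)%N,
      injective v,
      forall i, edge v i `&` edge v (ordS i) = [set v (ordS i)] &
      forall i j, j != i -> j != ordS i -> i != ordS j ->
        edge v i `&` edge v j = set0].

(* The closed region enclosed by a curve B: B and the bounded connected
   components of its complement. *)
Definition enclosed_region (R : realType) (B : set (R * R)) : set (R * R) :=
  B `|` [set x | (~` B) x /\
                 bounded_set (connected_component (~` B : set (R^o * R^o)) x)].

Definition polygon (R : realType) (P : set (R * R)) : Prop :=
  exists n (v : 'I_n -> R * R), simple_polygonal_line v /\
    P = enclosed_region (\bigcup_i edge v i).

(* Main.v *)
(** The norms are computed on test functions, which are dense in L^p.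

    Upper bound. The multiplier S_t(chi_P) is the sum of a translate of
    chi_(P_+) and of the mirror image of this translate, so that T f = g + h
    with |g|_p and |h|_p at most |||chi_(P_+)||| |f|_p. For p = 2n the function
    |g + h|^p = (g + h)^n conj((g + h)^n) is a sum of products of g, h and their
    conjugates. The frequencies of g in x_2 lie in [t, t + A] and those of h in
    [- t - A, - t]; when t >= t_0, a product containing g and conj(g) with
    different multiplicities has frequencies of a single sign, hence integral 0
    on almost every vertical line. There remains
    sum_j C(n, j)^2 |g|^(2j) |h|^(2(n - j)) <= C(2n, n) (|g|^p + |h|^p) / 2.

    Lower bound. The multipliers S_t(chi_P)(al y_1 + be, t + y_2 / k) have the
    same norm for all k and, if t > 0, converge almost everywhere to
    chi_[a,b](y_1) chi_(0,oo)(y_2), whose norm is at least the product of the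
    one-dimensional norms. If t = 0 then p = 2, the limit is chi_[a,b](y_1), and
    c_2 <= 1 by Plancherel. The convergence uses that P contains the points just
    above almost every point of its axis: otherwise, P being even in x_2, a
    point of an edge would have both sides in unbounded components of the
    complement, where the winding number vanishes, although it jumps across
    the edge. *)

Require Import Defs.
From HB Require Import structures.
From mathcomp Require Import all_boot all_order all_algebra.
From mathcomp Require Import all_classical all_reals all_analysis.
From mathcomp.real_closed Require Import complex.
From mathcomp Require Import measurable_realfun ring lra.

Set Implicit Arguments.
Unset Strict Implicit.
Unset Printing Implicit Defensive.

Import Order.TTheory GRing.Theory Num.Theory.
Import numFieldNormedType.Exports.

Local Open Scope classical_set_scope.
Local Open Scope ring_scope.
Local Open Scope complex_scope.

Local Notation Re := complex.Re.
Local Notation Im := complex.Im.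
Local Notation normc := ComplexField.Normc.normc.

(** * Complex-valued functions and their integrals *)

(** The threshold t_0 comes from a least frequency. If [g] and [conj g] occur [j] and [l] times,
    with [s = j - l >= 1], the frequencies of the product are at least 2ts - (n - s)A, which
    increases with [s]; at [s = 1] its nonnegativity reads 2t >= (n - 1)A, that is, t >= t_0. At t =
    t_0 the frequency 0 is an endpoint of the range, and the integral must be shown to vanish there
    too. The obstacle is that T f restricted to a vertical line comes without an explicit transform,
    and that such functions are multiplied together. Supports of convolutions are avoided:
    [spectrum_ge] keeps an absolutely convergent superposition of characters over an arbitrary
    measure space, and a product is represented over the product space. The factor exp(-e|x|), whose
    transform is the Poisson kernel, makes the exchanges of integrals legitimate; it serves alike
    for the vanishing of integrals, for Plancherel's inequality and for Fourier inversion. *)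

Section complex_numbers.
Variable R : realType.
Implicit Types (x y z : R[i]) (a b : R).

Lemma complexP x y : Re x = Re y -> Im x = Im y -> x = y.
Proof. by case: x => a b; case: y => c d /= -> ->. Qed.

Lemma ReD x y : Re (x + y) = Re x + Re y. Proof. by case: x; case: y. Qed.
Lemma ImD x y : Im (x + y) = Im x + Im y. Proof. by case: x; case: y. Qed.
Lemma ReN x : Re (- x) = - Re x. Proof. by case: x. Qed.
Lemma ImN x : Im (- x) = - Im x. Proof. by case: x. Qed.
Lemma ReB x y : Re (x - y) = Re x - Re y. Proof. by rewrite ReD ReN. Qed.
Lemma ImB x y : Im (x - y) = Im x - Im y. Proof. by rewrite ImD ImN. Qed.
Lemma ReM x y : Re (x * y) = Re x * Re y - Im x * Im y.
Proof. by case: x; case: y. Qed.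
Lemma ImM x y : Im (x * y) = Re x * Im y + Im x * Re y.
Proof. by case: x => ? ?; case: y => ? ? /=. Qed.
Lemma Re_conj x : Re (conjc x) = Re x. Proof. by case: x. Qed.
Lemma Im_conj x : Im (conjc x) = - Im x. Proof. by case: x. Qed.

Definition ReImE := (ReD, ImD, ReN, ImN, ReM, ImM, Re_conj, Im_conj).

Lemma normcE x : normc x = Num.sqrt (Re x ^+ 2 + Im x ^+ 2).
Proof. by case: x. Qed.

Lemma normc_ge0 x : 0 <= normc x.
Proof. by rewrite normcE sqrtr_ge0. Qed.

Lemma sqr_normc x : normc x ^+ 2 = Re x ^+ 2 + Im x ^+ 2.
Proof. by rewrite normcE sqr_sqrtr// addr_ge0// sqr_ge0. Qed.

Lemma normcD x y : normc (x + y) <= normc x + normc y.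
Proof.
by have := ler_normD x y; rewrite !normc_def -!normcE -rmorphD lecR.
Qed.

Lemma normcM x y : normc (x * y) = normc x * normc y.
Proof. exact: ComplexField.Normc.normcM. Qed.

Lemma normc0 : normc (0 : R[i]) = 0.
Proof. exact: ComplexField.Normc.normc0. Qed.

Lemma normc1 : normc (1 : R[i]) = 1.
Proof. exact: ComplexField.Normc.normc1. Qed.

Lemma normcX x n : normc (x ^+ n) = normc x ^+ n.
Proof. by elim: n => [|n IH]; rewrite ?normc1// !exprS normcM IH. Qed.

Lemma normc_real a : normc (a%:C) = `|a|.
Proof. by rewrite normcE /= expr0n addr0 sqrtr_sqr. Qed.

Lemma normcN x : normc (- x) = normc x.
Proof. by rewrite !normcE !ReImE !sqrrN. Qed.

Lemma normc_distC x y : normc (x - y) = normc (y - x).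
Proof. by rewrite -normcN opprB. Qed.

Lemma normc_conj x : normc (conjc x) = normc x.
Proof. by rewrite !normcE !ReImE !sqrrN. Qed.

Lemma mulc_conj x : x * conjc x = (normc x ^+ 2)%:C.
Proof. by apply: complexP; rewrite ?sqr_normc !ReImE /=; ring. Qed.

Lemma normc_Re x : `|Re x| <= normc x.
Proof.
rewrite -(@ler_pXn2r _ 2) ?nnegrE ?normc_ge0// sqr_normc real_normK ?num_real//.
by rewrite lerDl sqr_ge0.
Qed.

Lemma normc_Im x : `|Im x| <= normc x.
Proof.
rewrite -(@ler_pXn2r _ 2) ?nnegrE ?normc_ge0// sqr_normc real_normK ?num_real//.
by rewrite lerDr sqr_ge0.
Qed.

Lemma normc_le x : normc x <= `|Re x| + `|Im x|.
Proof.
rewrite -(@ler_pXn2r _ 2) ?nnegrE ?normc_ge0 ?addr_ge0// sqr_normc.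
rewrite -(@real_normK _ (Re x)) ?num_real// -(@real_normK _ (Im x)) ?num_real//.
have := normr_ge0 (Re x); have := normr_ge0 (Im x).
by move: `|Re x| `|Im x| => u v *; nra.
Qed.

Lemma normc_eq0 x : normc x = 0 -> x = 0.
Proof. exact: ComplexField.Normc.eq0_normc. Qed.

Lemma conjcD x y : conjc (x + y) = conjc x + conjc y.
Proof. by apply: complexP; rewrite !ReImE //; ring. Qed.

Lemma conjcM x y : conjc (x * y) = conjc x * conjc y.
Proof. by apply: complexP; rewrite !ReImE //; ring. Qed.

Lemma conjcX x n : conjc (x ^+ n) = conjc x ^+ n.
Proof.
elim: n => [|n IH]; last by rewrite !exprS conjcM IH.
by apply: complexP; rewrite !ReImE //= oppr0.
Qed.

Lemma conjcK' x : conjc (conjc x) = x.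
Proof. by apply: complexP; rewrite !ReImE ?opprK. Qed.

Lemma conjc0' : conjc (0 : R[i]) = 0.
Proof. by apply: complexP; rewrite !ReImE //= oppr0. Qed.

Lemma cis0 : cis (0 : R) = 1.
Proof. by rewrite /cis cos0 sin0. Qed.

Lemma cisD a b : cis (a + b) = cis a * cis b.
Proof. by apply: complexP; rewrite !ReImE /= ?cosD ?sinD //; ring. Qed.

Lemma conj_cis a : conjc (cis a) = cis (- a).
Proof. by apply: complexP; rewrite !ReImE /= ?cosN ?sinN. Qed.

Lemma normc_cis a : normc (cis a) = 1.
Proof. by rewrite normcE /= cos2Dsin2 sqrtr1. Qed.

Lemma normc_le1_chi (T : Type) (A : set T) t : normc (@chi R T A t) <= 1.
Proof.
rewrite /chi normc_real indicE; case: (t \in A) => /=; first by rewrite normr1.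
by rewrite normr0.
Qed.

Lemma normr_chi (T : Type) (A : set T) t :
  normc (@chi R T A t) = \1_A t.
Proof. by rewrite /chi normc_real ger0_norm. Qed.

Lemma chi_in (T : Type) (A : set T) t : A t -> @chi R T A t = 1.
Proof. by move=> At; rewrite /chi indicE mem_set. Qed.

Lemma chi_notin (T : Type) (A : set T) t : ~ A t -> @chi R T A t = 0.
Proof. by move=> At; rewrite /chi indicE memNset. Qed.

End complex_numbers.

Section cmeasurable.
Context d (T : measurableType d) (R : realType).
Implicit Types (f g : T -> R[i]).

Lemma cmeasurable_cst (c : R[i]) : cmeasurable (fun _ : T => c).
Proof. by split; exact: measurable_cst. Qed.

Lemma cmeasurableD f g : cmeasurable f -> cmeasurable g ->
  cmeasurable (fun x => f x + g x).
Proof.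
move=> [f1 f2] [g1 g2]; split.
- by under eq_fun do rewrite ReD; exact: measurable_funD.
- by under eq_fun do rewrite ImD; exact: measurable_funD.
Qed.

Lemma cmeasurableN f : cmeasurable f -> cmeasurable (fun x => - f x).
Proof.
move=> [f1 f2]; split.
- by under eq_fun do rewrite ReN; exact: measurableT_comp.
- by under eq_fun do rewrite ImN; exact: measurableT_comp.
Qed.

Lemma cmeasurableB f g : cmeasurable f -> cmeasurable g ->
  cmeasurable (fun x => f x - g x).
Proof. by move=> mf mg; exact/cmeasurableD/cmeasurableN. Qed.

Lemma cmeasurableM f g : cmeasurable f -> cmeasurable g ->
  cmeasurable (fun x => f x * g x).
Proof.
move=> [f1 f2] [g1 g2]; split.
- under eq_fun do rewrite ReM.
  by apply: measurable_funB; exact: measurable_funM.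
- under eq_fun do rewrite ImM.
  by apply: measurable_funD; exact: measurable_funM.
Qed.

Lemma cmeasurableX f n : cmeasurable f -> cmeasurable (fun x => f x ^+ n).
Proof.
move=> mf; elim: n => [|n IH]; first exact: cmeasurable_cst.
by under eq_fun do rewrite exprS; exact: cmeasurableM.
Qed.

Lemma cmeasurable_conj f : cmeasurable f -> cmeasurable (fun x => conjc (f x)).
Proof.
move=> [f1 f2]; split.
- by under eq_fun do rewrite Re_conj.
- by under eq_fun do rewrite Im_conj; exact: measurableT_comp.
Qed.

Lemma cmeasurable_real (f : T -> R) : measurable_fun setT f ->
  cmeasurable (fun x => (f x)%:C).
Proof. by move=> mf; split => //=; exact: measurable_cst. Qed.

Lemma cmeasurable_cis (f : T -> R) : measurable_fun setT f ->
  cmeasurable (fun x => cis (f x)).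
Proof.
move=> mf; split => /=; apply: measurableT_comp => //.
- by apply: continuous_measurable_fun; exact: continuous_cos.
- by apply: continuous_measurable_fun; exact: continuous_sin.
Qed.

Lemma cmeasurable_chi (A : set T) : measurable A -> cmeasurable (@chi R T A).
Proof. by move=> mA; apply: cmeasurable_real; exact: measurable_indic. Qed.

Lemma measurable_normc f : cmeasurable f ->
  measurable_fun setT (fun x => normc (f x)).
Proof.
move=> [f1 f2]; under eq_fun do rewrite normcE.
apply: (@measurableT_comp _ _ _ _ _ _ (@Num.sqrt R)).
  by apply: continuous_measurable_fun; exact: sqrt_continuous.
by apply: measurable_funD; exact: measurable_funX.
Qed.

End cmeasurable.

Lemma cmeasurable_comp d1 d2 (T1 : measurableType d1) (T2 : measurableType d2)
    (R : realType) (f : T2 -> R[i]) (h : T1 -> T2) :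
  cmeasurable f -> measurable_fun setT h -> cmeasurable (fun x => f (h x)).
Proof.
move=> [f1 f2] mh; split.
- exact: (measurableT_comp f1 mh).
- exact: (measurableT_comp f2 mh).
Qed.

Section cintegral.
Context d (T : measurableType d) (R : realType).
Variable mu : {measure set T -> \bar R}.
Implicit Types (f g : T -> R[i]).

Definition cintegrable f :=
  mu.-integrable setT (fun x => (Re (f x))%:E) /\
  mu.-integrable setT (fun x => (Im (f x))%:E).

Lemma cintegrable_cmeasurable f : cintegrable f -> cmeasurable f.
Proof.
by move=> [/measurable_int/measurable_EFinP ? /measurable_int/measurable_EFinP].
Qed.

Lemma cintegrable_normc f : cintegrable f ->
  mu.-integrable setT (fun x => (normc (f x))%:E).
Proof.
move=> fi; have mf := cintegrable_cmeasurable fi; case: fi => f1 f2.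
apply: (le_integrable measurableT _ _ (integrableD measurableT
   (integrable_norm f1) (integrable_norm f2))).
  by apply/measurable_EFinP; exact: measurable_normc.
move=> x _ /=; rewrite lee_fin ger0_norm ?normc_ge0// ger0_norm ?addr_ge0//.
exact: normc_le.
Qed.

Lemma le_cintegrable f (g : T -> R) : cmeasurable f ->
  (forall x, normc (f x) <= g x) ->
  mu.-integrable setT (fun x => (g x)%:E) -> cintegrable f.
Proof.
move=> [f1 f2] fg gi; split; apply: (le_integrable measurableT _ _ gi).
- exact/measurable_EFinP.
- move=> x _ /=; rewrite lee_fin (le_trans (normc_Re _))//.
  by rewrite (le_trans (fg x))// ler_norm.
- exact/measurable_EFinP.
- move=> x _ /=; rewrite lee_fin (le_trans (normc_Im _))//.
  by rewrite (le_trans (fg x))// ler_norm.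
Qed.

Lemma cintegrableD f g : cintegrable f -> cintegrable g ->
  cintegrable (fun x => f x + g x).
Proof.
move=> [f1 f2] [g1 g2]; split.
- under eq_fun do rewrite ReD EFinD; exact: integrableD.
- under eq_fun do rewrite ImD EFinD; exact: integrableD.
Qed.

Lemma cintegrableZ (c : R[i]) f : cintegrable f -> cintegrable (fun x => c * f x).
Proof.
move=> fi; apply: (le_cintegrable (g := fun x => normc c * normc (f x))).
- exact/cmeasurableM/cintegrable_cmeasurable/fi/cmeasurable_cst.
- by move=> x; rewrite normcM.
- under eq_fun do rewrite EFinM.
  by apply: integrableZl => //; exact: cintegrable_normc.
Qed.

Lemma cintegrableN f : cintegrable f -> cintegrable (fun x => - f x).
Proof. by move=> /(cintegrableZ (-1)); under eq_fun do rewrite mulN1r. Qed.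

Lemma cintegrable0 : cintegrable (fun=> 0).
Proof. by split => /=; exact: integrable0. Qed.

Lemma cintegrable_bounded f (g : T -> R[i]) (K : R) : cintegrable f ->
  cmeasurable g -> (forall x, normc (g x) <= K) ->
  cintegrable (fun x => g x * f x).
Proof.
move=> fi mg gK; apply: (le_cintegrable (g := fun x => K * normc (f x))).
- exact/cmeasurableM/cintegrable_cmeasurable/fi.
- by move=> x; rewrite normcM ler_wpM2r// normc_ge0.
- under eq_fun do rewrite EFinM.
  by apply: integrableZl => //; exact: cintegrable_normc.
Qed.

Lemma cintegrable_cis f (h : T -> R) : cintegrable f ->
  measurable_fun setT h -> cintegrable (fun x => cis (h x) * f x).
Proof.
move=> fi mh; apply: (cintegrable_bounded (K := 1)) => //.
  exact: cmeasurable_cis.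
by move=> x; rewrite normc_cis.
Qed.

Lemma eq_cintegral f g : f =1 g -> cintegral mu f = cintegral mu g.
Proof. by move=> /funext ->. Qed.

Lemma cintegralD f g : cintegrable f -> cintegrable g ->
  cintegral mu (fun x => f x + g x) = cintegral mu f + cintegral mu g.
Proof.
move=> [f1 f2] [g1 g2]; apply: complexP; rewrite ReImE /=.
- by under eq_Rintegral do rewrite ReD; rewrite RintegralD.
- by under eq_Rintegral do rewrite ImD; rewrite RintegralD.
Qed.

Lemma cintegralZ (c : R[i]) f : cintegrable f ->
  cintegral mu (fun x => c * f x) = c * cintegral mu f.
Proof.
move=> [f1 f2].
have s (a : R) (h : T -> R) : mu.-integrable setT (fun x => (h x)%:E) ->
  mu.-integrable setT (fun x => (a * h x)%:E).
  by move=> hi; under eq_fun do rewrite EFinM; exact: integrableZl.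
apply: complexP; rewrite ReImE /=.
- under eq_Rintegral do rewrite ReM.
  by rewrite RintegralB ?RintegralZl//; exact: s.
- under eq_Rintegral do rewrite ImM.
  by rewrite RintegralD ?RintegralZl//; exact: s.
Qed.

Lemma cintegralN f : cintegrable f ->
  cintegral mu (fun x => - f x) = - cintegral mu f.
Proof.
move=> fi; under eq_cintegral do rewrite -mulN1r.
by rewrite cintegralZ// mulN1r.
Qed.

Lemma cintegral0 : cintegral mu (fun=> 0) = 0.
Proof. by apply: complexP => /=; rewrite Rintegral_cst// mul0r. Qed.

Lemma cintegrable_conj f :
  cintegrable f -> cintegrable (fun x => conjc (f x)).
Proof.
move=> fi; apply: (le_cintegrable (g := fun x => normc (f x))).
- exact/cmeasurable_conj/cintegrable_cmeasurable/fi.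
- by move=> x; rewrite normc_conj.
- exact: cintegrable_normc.
Qed.

Lemma cintegral_conj f :
  cintegrable f -> cintegral mu (fun x => conjc (f x)) = conjc (cintegral mu f).
Proof.
move=> [f1 f2]; apply: complexP => /=.
- by under eq_Rintegral do rewrite Re_conj.
- under eq_Rintegral do rewrite Im_conj -mulN1r.
  by rewrite RintegralZl// mulN1r.
Qed.

Lemma cintegral_real (f : T -> R) :
  cintegral mu (fun x => (f x)%:C) = (Rintegral mu setT f)%:C.
Proof. by apply: complexP => //=; rewrite Rintegral_cst// mul0r. Qed.

Lemma cintegrable_real (f : T -> R) :
  mu.-integrable setT (fun x => (f x)%:E) -> cintegrable (fun x => (f x)%:C).
Proof. by move=> fi; split => //=; exact: integrable0. Qed.

(** Multiplying [f] by the conjugate of its integral [z] makes the integral equal to the real number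
    |z|^2, so that only real parts have to be compared. *)
Lemma normc_cintegral f : cintegrable f ->
  normc (cintegral mu f) <= Rintegral mu setT (fun x => normc (f x)).
Proof.
move=> fi; set z := cintegral mu f.
have [->|z0] := eqVneq (normc z) 0.
  by apply: Rintegral_ge0 => x _; exact: normc_ge0.
have zp : 0 < normc z by rewrite lt_neqAle eq_sym z0 normc_ge0.
rewrite -(ler_pM2l zp) -expr2.
have -> : normc z ^+ 2 = Rintegral mu setT (fun x => Re (conjc z * f x)).
  have : cintegral mu (fun x => conjc z * f x) = (normc z ^+ 2)%:C.
    by rewrite cintegralZ// mulrC mulc_conj.
  by move=> /(congr1 (@Re R)) /= <-.
rewrite -RintegralZl//; last exact: cintegrable_normc.
apply: le_Rintegral => //.
- by have [] := cintegrableZ (conjc z) fi.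
- under [X in integrable _ _ X]eq_fun do rewrite /= EFinM.
  by apply: integrableZl => //; exact: cintegrable_normc.
- move=> x _; rewrite (le_trans (ler_norm _))// (le_trans (normc_Re _))//.
  by rewrite normcM normc_conj.
Qed.

Lemma normc_cintegral_le f (g : T -> R) : cintegrable f ->
  (forall x, normc (f x) <= g x) -> mu.-integrable setT (fun x => (g x)%:E) ->
  normc (cintegral mu f) <= Rintegral mu setT g.
Proof.
move=> fi fg gi; rewrite (le_trans (normc_cintegral fi))//.
by apply: le_Rintegral => //; exact: cintegrable_normc.
Qed.

Lemma ae_eq_cintegral f g : cmeasurable f -> cmeasurable g ->
  {ae mu, forall x, f x = g x} -> cintegral mu f = cintegral mu g.
Proof.
move=> [f1 f2] [g1 g2] fg; apply: complexP => /=; congr fine.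
- apply: ae_eq_integral => //; try exact/measurable_EFinP.
  by apply: filterS fg => x + _ => -> .
- apply: ae_eq_integral => //; try exact/measurable_EFinP.
  by apply: filterS fg => x + _ => -> .
Qed.

End cintegral.

(** * Fubini, dominated convergence and affine changes of variables *)

Section product_integrals.
Context d1 d2 (T1 : measurableType d1) (T2 : measurableType d2) (R : realType).
Variables (m1 : {sigma_finite_measure set T1 -> \bar R}).
Variables (m2 : {sigma_finite_measure set T2 -> \bar R}).

(** The inner integrals may fail to be finite on a null set, where [fine] replaces the value by 0;
    elsewhere they agree with [fubini_F], for which Fubini's theorem is available. *)
Lemma Rintegral_prod1 (F : T1 * T2 -> R) :
  (m1 \x m2)%E.-integrable setT (fun z => (F z)%:E) ->
  m1.-integrable setT (fun x => (Rintegral m2 setT (fun y => F (x, y)))%:E) /\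
  Rintegral (m1 \x m2)%E setT F =
    Rintegral m1 setT (fun x => Rintegral m2 setT (fun y => F (x, y))).
Proof.
move=> Fi.
have ae : {ae m1, forall x, (Rintegral m2 setT (fun y => F (x, y)))%:E =
                            fubini_F m2 (EFin \o F) x}.
  apply: filterS (ae_integrable1 Fi) => x /= xi.
  by rewrite /Rintegral fineK//; exact: integrable_fin_num.
have mF := measurable_fubini_F Fi.
have mG : measurable_fun setT
    (fun x => (Rintegral m2 setT (fun y => F (x, y)))%:E).
  by apply/measurable_EFinP; apply: measurableT_comp => //; exact: fine_measurable.
have ae' : ae_eq m1 setT (fun x => (Rintegral m2 setT (fun y => F (x, y)))%:E)
    (fubini_F m2 (EFin \o F)).
  by apply: filterS ae => x + _.
split.
  apply/integrableP; split => //.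
  have /integrableP[_] := integrable_fubini_F Fi.
  rewrite (@ae_eq_integral _ _ _ m1 setT
    (fun x => `|fubini_F m2 (EFin \o F) x|)%E
    (fun x => `|(Rintegral m2 setT (fun y => F (x, y)))%:E|)%E)//.
  - exact: measurableT_comp.
  - exact: measurableT_comp.
  - by apply: filterS ae => x -> _.
transitivity (fine (\int[m1]_x fubini_F m2 (EFin \o F) x)%E).
  by rewrite integral12_prod_meas1.
by congr fine; apply/esym/ae_eq_integral.
Qed.

Lemma Rintegral_prod2 (F : T1 * T2 -> R) :
  (m1 \x m2)%E.-integrable setT (fun z => (F z)%:E) ->
  m2.-integrable setT (fun y => (Rintegral m1 setT (fun x => F (x, y)))%:E) /\
  Rintegral (m1 \x m2)%E setT F =
    Rintegral m2 setT (fun y => Rintegral m1 setT (fun x => F (x, y))).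
Proof.
move=> Fi.
have ae : {ae m2, forall y, (Rintegral m1 setT (fun x => F (x, y)))%:E =
                            fubini_G m1 (EFin \o F) y}.
  apply: filterS (ae_integrable2 Fi) => x /= xi.
  by rewrite /Rintegral fineK//; exact: integrable_fin_num.
have mF := measurable_fubini_G Fi.
have mG : measurable_fun setT
    (fun y => (Rintegral m1 setT (fun x => F (x, y)))%:E).
  by apply/measurable_EFinP; apply: measurableT_comp => //; exact: fine_measurable.
have ae' : ae_eq m2 setT (fun y => (Rintegral m1 setT (fun x => F (x, y)))%:E)
    (fubini_G m1 (EFin \o F)).
  by apply: filterS ae => x + _.
split.
  apply/integrableP; split => //.
  have mFE := measurable_int _ Fi.
  have /(integrable21ltyP m1 m2 mFE) := Fi; apply: le_lt_trans.
  apply: ae_ge0_le_integral => //.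
  - exact: measurableT_comp.
  - by move=> y _; exact: integral_ge0.
  - apply: (measurable_fun_fubini_tonelli_G (abse \o (EFin \o F))) => //.
    + exact: measurableT_comp.
    + by move=> z; exact: abse_ge0.
  - apply: filterS ae => y -> _; rewrite /fubini_G; apply: le_abse_integral => //.
    exact: (measurable_fun_pair1 y mFE).
transitivity (fine (\int[m2]_x fubini_G m1 (EFin \o F) x)%E).
  by rewrite integral21_prod_meas1.
by congr fine; apply/esym/ae_eq_integral.
Qed.

Lemma cintegral_prod1 (F : T1 * T2 -> R[i]) : cintegrable (m1 \x m2)%E F ->
  cintegrable m1 (fun x => cintegral m2 (fun y => F (x, y))) /\
  cintegral (m1 \x m2)%E F =
    cintegral m1 (fun x => cintegral m2 (fun y => F (x, y))).
Proof.
move=> [/Rintegral_prod1[F1 e1] /Rintegral_prod1[F2 e2]].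
by split => //; apply: complexP.
Qed.

Lemma cintegral_prod2 (F : T1 * T2 -> R[i]) : cintegrable (m1 \x m2)%E F ->
  cintegrable m2 (fun y => cintegral m1 (fun x => F (x, y))) /\
  cintegral (m1 \x m2)%E F =
    cintegral m2 (fun y => cintegral m1 (fun x => F (x, y))).
Proof.
move=> [/Rintegral_prod2[F1 e1] /Rintegral_prod2[F2 e2]].
by split => //; apply: complexP.
Qed.

Lemma cFubini (F : T1 * T2 -> R[i]) : cintegrable (m1 \x m2)%E F ->
  cintegral m1 (fun x => cintegral m2 (fun y => F (x, y))) =
  cintegral m2 (fun y => cintegral m1 (fun x => F (x, y))).
Proof.
by move=> Fi; rewrite -(cintegral_prod1 Fi).2 -(cintegral_prod2 Fi).2.
Qed.

Lemma ae_cintegrable1 (F : T1 * T2 -> R[i]) : cintegrable (m1 \x m2)%E F ->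
  {ae m1, forall x, cintegrable m2 (fun y => F (x, y))}.
Proof.
move=> [/ae_integrable1 h1 /ae_integrable1 h2].
by apply: filterS2 h1 h2 => x /= x1 x2; split.
Qed.

(** No integrability is assumed: divergent inner integrals get a default value through [fine], and
    measurability still follows from Tonelli's theorem applied to the positive and negative
    parts. *)
Lemma measurable_Rintegral_prod (F : T1 * T2 -> R) : measurable_fun setT F ->
  measurable_fun setT (fun x => Rintegral m2 setT (fun y => F (x, y))).
Proof.
move=> mF; apply: measurableT_comp; first exact: fine_measurable.
have mF' : measurable_fun setT (EFin \o F) by exact/measurable_EFinP.
have -> : (fun x => \int[m2]_y (F (x, y))%:E)%E =
  (fun x => (fubini_F m2 (EFin \o F)^\+ x - fubini_F m2 (EFin \o F)^\- x))%E.
  apply/funext => x; rewrite integralE; congr (_ - _)%E.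
  - by apply: eq_integral => y _; rewrite !funeposE.
  - by apply: eq_integral => y _; rewrite !funenegE.
apply: emeasurable_funB; apply: measurable_fun_fubini_tonelli_F => //.
- exact: measurable_funepos.
- exact: measurable_funeneg.
Qed.

Lemma cmeasurable_cintegral_prod (F : T1 * T2 -> R[i]) : cmeasurable F ->
  cmeasurable (fun x => cintegral m2 (fun y => F (x, y))).
Proof. by move=> [F1 F2]; split; [exact: (measurable_Rintegral_prod F1)|exact:
  (measurable_Rintegral_prod F2)]. Qed.

Lemma integrable_tensor (f : T1 -> R) (g : T2 -> R) :
  m1.-integrable setT (fun x => (f x)%:E) ->
  m2.-integrable setT (fun x => (g x)%:E) ->
  (m1 \x m2)%E.-integrable setT (fun z => (f z.1 * g z.2)%:E).
Proof.
move=> fi gi.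
have mf : measurable_fun setT f by exact/measurable_EFinP/(measurable_int m1).
have mg : measurable_fun setT g by exact/measurable_EFinP/(measurable_int m2).
have mfg : measurable_fun setT (fun z : T1 * T2 => (f z.1 * g z.2)%:E).
  apply/measurable_EFinP/measurable_funM.
  - exact: (measurableT_comp mf measurable_fst).
  - exact: (measurableT_comp mg measurable_snd).
apply/integrable12ltyP => //=.
under eq_integral => x _.
  under eq_integral do rewrite normrM EFinM.
  rewrite integralZl//; last exact: integrable_norm.
  over.
have /integrableP[_ fo] := fi; have /integrableP[_ go] := gi.
rewrite ge0_integralZr//=.
- by rewrite lte_mul_pinfty// ?integral_ge0// ge0_fin_numE// integral_ge0.
- by apply/measurable_EFinP; exact: measurableT_comp.
- exact: integral_ge0.
Qed.

Lemma cintegrable_tensor (f : T1 -> R[i]) (g : T2 -> R[i]) :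
  cintegrable m1 f -> cintegrable m2 g ->
  cintegrable (m1 \x m2)%E (fun z => f z.1 * g z.2).
Proof.
move=> fi gi.
apply: (le_cintegrable (g := fun z => normc (f z.1) * normc (g z.2))).
- apply: cmeasurableM.
  + exact: (cmeasurable_comp (cintegrable_cmeasurable fi) measurable_fst).
  + exact: (cmeasurable_comp (cintegrable_cmeasurable gi) measurable_snd).
- by move=> z; rewrite normcM.
- exact: (integrable_tensor (cintegrable_normc fi) (cintegrable_normc gi)).
Qed.

Lemma cintegral_tensor (f : T1 -> R[i]) (g : T2 -> R[i]) :
  cintegrable m1 f -> cintegrable m2 g ->
  cintegral (m1 \x m2)%E (fun z => f z.1 * g z.2) =
  cintegral m1 f * cintegral m2 g.
Proof.
move=> fi gi; rewrite (cintegral_prod1 (cintegrable_tensor fi gi)).2 /=.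
under eq_cintegral do rewrite cintegralZ// mulrC.
by rewrite cintegralZ// mulrC.
Qed.

End product_integrals.

Section product_sigma_finite.
Context d d' (T : measurableType d) (T' : measurableType d') (R : realType).
Variables (m1 : {sigma_finite_measure set T -> \bar R}).
Variables (m2 : {sigma_finite_measure set T' -> \bar R}).

(** A name that carries a sigma-finite structure, so that the plane can itself be a factor in
    Fubini's theorem, as plane multipliers and products of superpositions require. *)
Definition product_sfm : set (T * T') -> \bar R := (m1 \x m2)%E.

HB.instance Definition _ := Measure.on product_sfm.

Lemma product_sfm_sigma_finite : sigma_finite setT product_sfm.
Proof.
have /sigma_finiteP[F [TF ndF Foo]] := sigma_finiteT m1.
have /sigma_finiteP[G [TG ndG Goo]] := sigma_finiteT m2.
exists (fun n => F n `*` G n).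
  rewrite -setXTT TF TG; apply/seteqP; split => -[x y].
    move=> [/= [n _ Fnx] [k _ Gky]]; exists (maxn n k) => //; split.
    - by move: x Fnx; exact/subsetPset/ndF/leq_maxl.
    - by move: y Gky; exact/subsetPset/ndG/leq_maxr.
  by move=> [n _ []/= ? ?]; split; exists n.
move=> k; have [? ?] := Foo k; have [? ?] := Goo k; split.
  exact: measurableX.
by rewrite /product_sfm product_measure1E// lte_mul_pinfty// ge0_fin_numE.
Qed.

HB.instance Definition _ :=
  Measure_isSigmaFinite.Build _ _ _ product_sfm product_sfm_sigma_finite.

Definition product_sigma_finite : {sigma_finite_measure set (T * T')%type -> \bar R} := product_sfm.


End product_sigma_finite.

Definition ccvg (R : realType) (u : nat -> R[i]) (l : R[i]) :=
  (fun n => normc (u n - l)) @ \oo --> (0 : R).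

Section dominated.
Context d (T : measurableType d) (R : realType).
Variable mu : {measure set T -> \bar R}.

Lemma Rintegral_dct (h : nat -> T -> R) (l g : T -> R) :
  (forall n, measurable_fun setT (h n)) -> measurable_fun setT l ->
  {ae mu, forall x, (fun n => h n x) @ \oo --> l x} ->
  mu.-integrable setT (fun x => (g x)%:E) ->
  (forall n x, `|h n x| <= g x) ->
  (fun n => Rintegral mu setT (h n)) @ \oo --> Rintegral mu setT l.
Proof.
move=> mh ml hl gi hg; rewrite /Rintegral.
have hl' : {ae mu, forall x, setT x -> (fun n => (h n x)%:E) @ \oo --> (l x)%:E}.
  by apply: filterS hl => x c _; apply: cvg_EFin => //; exact: nearW.
have gg : {ae mu, forall x n, setT x -> (`|(h n x)%:E| <= (g x)%:E)%E}.
  by apply: nearW => x n _; rewrite /= lee_fin.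
have [li _ c] := @dominated_convergence _ _ _ mu setT measurableT
  (fun n x => (h n x)%:E) (fun x => (l x)%:E) (fun x => (g x)%:E)
  (fun n => (measurable_EFinP _ _).2 (mh n)) ((measurable_EFinP _ _).2 ml)
  hl' gi gg.
apply: fine_cvg; rewrite fineK//.
exact: integrable_fin_num.
Qed.

Lemma cintegral_dct (h : nat -> T -> R[i]) (l : T -> R[i]) (g : T -> R) :
  (forall n, cmeasurable (h n)) -> cmeasurable l ->
  {ae mu, forall x, ccvg (fun n => h n x) (l x)} ->
  mu.-integrable setT (fun x => (g x)%:E) ->
  (forall n x, normc (h n x) <= g x) -> (forall x, normc (l x) <= g x) ->
  ccvg (fun n => cintegral mu (h n)) (cintegral mu l).
Proof.
move=> mh ml hl gi hg lg.
have g2i : mu.-integrable setT (fun x => (g x + g x)%:E).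
  by under eq_fun do rewrite EFinD; exact: integrableD.
have dom n x : normc (h n x - l x) <= g x + g x.
  by rewrite (le_trans (normcD _ _))// normcN lerD.
have c : (fun n => Rintegral mu setT (fun x => normc (h n x - l x))) @ \oo
    --> (0 : R).
  rewrite -[X in _ --> X](_ : Rintegral mu setT (fun=> 0) = 0); last first.
    by rewrite Rintegral_cst// mul0r.
  apply: (Rintegral_dct (g := fun x => g x + g x)) => //.
  - by move=> n; exact/measurable_normc/cmeasurableB.
  - by move=> n x; rewrite ger0_norm ?normc_ge0.
have hi n : cintegrable mu (h n) by exact: (le_cintegrable (mh n) (hg n)).
have li : cintegrable mu l by exact: (le_cintegrable ml lg).
apply: (squeeze_cvgr _ (cvg_cst 0) c).
apply: nearW => n; rewrite normc_ge0 andTb.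
rewrite -cintegralN// -cintegralD//; last exact: cintegrableN.
by apply: normc_cintegral; apply: cintegrableD => //; exact: cintegrableN.
Qed.

End dominated.

Section ccvg_theory.
Variable R : realType.
Implicit Types (u v : nat -> R[i]) (l : R[i]).

Lemma ccvg_unique u l l' : ccvg u l -> ccvg u l' -> l = l'.
Proof.
move=> ul ul'; apply/eqP; rewrite -subr_eq0; apply/eqP/normc_eq0.
have c : (fun n => normc (u n - l) + normc (u n - l')) @ \oo --> (0 + 0 : R).
  exact: cvgD.
have : normc (l - l') <= 0 + 0.
  have cl := cvg_lim (@Rhausdorff R) c; rewrite -cl.
  apply: limr_ge; first by apply/cvg_ex; exists (0 + 0).
  apply: nearW => n; rewrite -(normc_distC l (u n)).
  by rewrite (le_trans _ (normcD _ _))// addrA subrK.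
by rewrite addr0 => le0; apply/eqP; rewrite eq_le le0 normc_ge0.
Qed.

Lemma ccvg_cst l : ccvg (fun=> l) l.
Proof. by rewrite /ccvg subrr normc0; exact: cvg_cst. Qed.

Lemma ccvg_Re u l : ccvg u l -> (fun n => Re (u n)) @ \oo --> Re l.
Proof.
move=> ul; apply/cvgrPdist_lt => e e0.
have /cvgrPdist_lt /(_ _ e0) := ul; apply: filterS => n.
rewrite sub0r normrN ger0_norm ?normc_ge0// normc_distC; apply: le_lt_trans.
by rewrite -ReB normc_Re.
Qed.

Lemma ccvg_Im u l : ccvg u l -> (fun n => Im (u n)) @ \oo --> Im l.
Proof.
move=> ul; apply/cvgrPdist_lt => e e0.
have /cvgrPdist_lt /(_ _ e0) := ul; apply: filterS => n.
rewrite sub0r normrN ger0_norm ?normc_ge0// normc_distC; apply: le_lt_trans.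
by rewrite -ImB normc_Im.
Qed.

Lemma ccvg_normc u l : ccvg u l -> (fun n => normc (u n)) @ \oo --> normc l.
Proof.
move=> ul; apply/cvgrPdist_lt => e e0.
have /cvgrPdist_lt /(_ _ e0) := ul; apply: filterS => n.
rewrite sub0r normrN ger0_norm ?normc_ge0//; apply: le_lt_trans.
rewrite ler_distl; apply/andP; split.
- by rewrite lerBlDr -{1}(subrK l (u n)) addrC normcD.
- by rewrite -{1}(subrK (u n) l) addrC (normc_distC (u n)) normcD.
Qed.

Lemma ccvgM u v l l' : ccvg u l -> ccvg v l' ->
  ccvg (fun n => u n * v n) (l * l').
Proof.
move=> ul vl; rewrite /ccvg.
have c : (fun n => normc (u n - l) * normc (v n - l') + normc l * normc (v n - l')
    + normc (u n - l) * normc l') @ \oo --> (0 * 0 + normc l * 0 + 0 * normc l' : R).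
  by apply: cvgD; [apply: cvgD; [exact: cvgM|exact: cvgZr]|exact: cvgZl].
rewrite !mulr0 mul0r !addr0 in c.
apply: (squeeze_cvgr _ (cvg_cst 0) c); apply: nearW => n.
rewrite normc_ge0 /= -!normcM.
have -> : u n * v n - l * l' = (u n - l) * (v n - l') + l * (v n - l') + (u n - l) * l'.
  by ring.
by rewrite (le_trans (normcD _ _))// lerD2r normcD.
Qed.

Lemma ccvg_ReIm u l : (fun n => Re (u n)) @ \oo --> Re l ->
  (fun n => Im (u n)) @ \oo --> Im l -> ccvg u l.
Proof.
move=> ur ui; apply/cvgrPdist_lt => e e0.
have e20 : 0 < e / 2 by rewrite divr_gt0.
have /cvgrPdist_lt /(_ _ e20) hr := ur; have /cvgrPdist_lt /(_ _ e20) hi := ui.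
apply: filterS2 hr hi => n hr hi.
rewrite sub0r normrN ger0_norm ?normc_ge0//.
rewrite normc_distC (le_lt_trans (normc_le _))// ReB ImB (splitr e).
exact: ltrD.
Qed.

End ccvg_theory.

Section affine_change.
Variable R : realType.
Local Notation mu := (@lebesgue_measure R).

Lemma measurable_affine (a b : R) :
  measurable_fun setT (fun x : measurableTypeR R => a * x + b : measurableTypeR R).
Proof. by apply: measurable_funD => //; exact: measurable_funM. Qed.

(** The pushforward of Lebesgue measure under the affine map, scaled by |a|, has the right value on
    half-open intervals; by uniqueness it is Lebesgue measure. *)
Lemma ge0_integral_affine (a b : R) (f : R -> \bar R) : a != 0 ->
  measurable_fun setT f -> (forall x, 0 <= f x)%E ->
  (\int[mu]_x f (a * x + b)%R = (`|a|^-1)%:E * \int[mu]_x f x)%E.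
Proof.
move=> a0 mf f0.
pose phi (x : measurableTypeR R) : measurableTypeR R := a * x + b.
have mphi : measurable_fun setT phi by exact: measurable_affine.
have na0 : 0 < `|a| by rewrite normr_gt0.
pose k : {nonneg R} := NngNum (ltW na0).
pose nu' : {measure set (measurableTypeR R) -> \bar R} :=
  mscale k (pushforward mu phi).
pose nu := nu' mphi.
have E A : measurable A -> mu A = nu A.
  apply: lebesgue_measure_unique => _ [[x y] _ <-] /=.
  rewrite /nu /nu' /mscale /= /pushforward.
  have [xy|yx] := ltP x y; last first.
    by rewrite set_itv_ge ?bnd_simp -?leNgt// preimage_set0 !measure0 mule0.
  have [ap|an] := ltP 0 a.
    have -> : phi @^-1` `]x, y]%classic = `](x - b) / a, (y - b) / a]%classic.
      apply/seteqP; split => z /=; rewrite !in_itv /= /phi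
        ltr_pdivrMr// ler_pdivlMr// ltrBlDr lerBrDr mulrC//.
    rewrite !lebesgue_measure_itv /= !lte_fin xy ltr_pM2r ?invr_gt0// ltrD2r xy.
    rewrite -!EFinB -EFinM gtr0_norm//; congr EFin.
    by field.
  have {}an : a < 0 by rewrite lt_neqAle a0.
  (* A negative slope moves the closed end of the interval from right to left, which the measure
     does not see. *)
  have -> : phi @^-1` `]x, y]%classic = `[(y - b) / a, (x - b) / a[%classic.
    apply/seteqP; split => z /=; rewrite !in_itv /= /phi
      ltr_ndivlMr// ler_ndivrMr// ltrBlDr lerBrDr mulrC => /andP[-> ->]//.
  rewrite !lebesgue_measure_itv /= !lte_fin xy ltr_nM2r ?invr_lt0// ltrD2r xy.
  rewrite -!EFinB -EFinM ltr0_norm//; congr EFin.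
  by field.
have -> : (\int[mu]_x f x = \int[nu]_x f x)%E.
  by apply: eq_measure_integral => A mA _; exact: E.
rewrite /nu /nu' ge0_integral_mscale// muleA -EFinM /= mulVf ?gt_eqF// mul1e.
rewrite ge0_integral_pushforward//.
Qed.

Lemma ge0_integral_affine2 (a1 b1 a2 b2 : R) (f : R * R -> \bar R) :
  a1 != 0 -> a2 != 0 -> measurable_fun setT f -> (forall x, 0 <= f x)%E ->
  (\int[mu \x mu]_z f (a1 * z.1 + b1, a2 * z.2 + b2)%R =
   (`|a1|^-1 * `|a2|^-1)%:E * \int[mu \x mu]_z f z)%E.
Proof.
move=> a10 a20 mf f0.
have mphi : measurable_fun setT
    (fun z : measurableTypeR R * measurableTypeR R =>
       (a1 * z.1 + b1, a2 * z.2 + b2) : measurableTypeR R * measurableTypeR R).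
  apply: measurable_fun_pair.
  - exact: (measurableT_comp (measurable_affine a1 b1) measurable_fst).
  - exact: (measurableT_comp (measurable_affine a2 b2) measurable_snd).
rewrite (fubini_tonelli1 (m1 := mu) (m2 := mu)
  (fun z => f (a1 * z.1 + b1, a2 * z.2 + b2)))//; last exact: (measurableT_comp mf mphi).
rewrite (fubini_tonelli1 (m1 := mu) (m2 := mu) f)//.
have mF := measurable_fun_fubini_tonelli_F (m2 := mu) f mf f0.
have F0 x : (0 <= fubini_F mu f x)%E by exact: integral_ge0.
rewrite EFinM -muleA muleCA -(ge0_integral_affine b1 a10 mF F0).
rewrite -ge0_integralZl_EFin ?invr_ge0//.
  apply: eq_integral => x _; rewrite /fubini_F /=.
  rewrite (ge0_integral_affine b2 a20 (f := fun y => f (a1 * x + b1, y)))//.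
  exact: (measurable_fun_pair2 _ mf).
exact: (measurableT_comp mF (measurable_affine a1 b1)).
Qed.

End affine_change.

Section scaling_maps.
Context d (T : measurableType d) (R : realType).
Variable mu : {measure set T -> \bar R}.

(** All that is used of a change of variables. Stated for nonnegative functions, it extends to
    integrable ones through positive and negative parts, and it lets the line and the plane share
    their proofs. *)
Definition scales (phi : T -> T) (c : R) :=
  [/\ 0 < c, measurable_fun setT phi &
      forall f : T -> \bar R, measurable_fun setT f -> (forall x, 0 <= f x)%E ->
      (\int[mu]_x f (phi x) = c%:E * \int[mu]_x f x)%E].

Variables (phi : T -> T) (c : R).
Hypothesis phic : scales phi c.

Lemma scales_integrable (f : T -> R) :
  mu.-integrable setT (fun x => (f x)%:E) ->
  mu.-integrable setT (fun x => (f (phi x))%:E).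
Proof.
case: phic => c0 mphi H /integrableP[mf fo]; apply/integrableP; split.
  exact: (measurableT_comp mf mphi).
rewrite (H (fun x => `|(f x)%:E|%E))//; last exact: measurableT_comp.
by rewrite lte_mul_pinfty// lee_fin ltW.
Qed.

Lemma scales_Rintegral (f : T -> R) :
  mu.-integrable setT (fun x => (f x)%:E) ->
  Rintegral mu setT (fun x => f (phi x)) = c * Rintegral mu setT f.
Proof.
move=> fi; case: (phic) => c0 mphi H.
have mf := measurable_int _ fi.
rewrite /Rintegral -[c]/(fine c%:E) -fineM//; last exact: integrable_fin_num.
congr fine; rewrite integralE [in RHS]integralE.
have -> : (fun x => (f (phi x))%:E)^\+%E = (fun x => (fun x => (f x)%:E)^\+%E (phi x)).
  by apply/funext => x; rewrite !funeposE.
have -> : (fun x => (f (phi x))%:E)^\-%E = (fun x => (fun x => (f x)%:E)^\-%E (phi x)).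
  by apply/funext => x; rewrite !funenegE.
rewrite H//; last exact: measurable_funepos.
rewrite H//; last exact: measurable_funeneg.
have := integrable_pos_fin_num measurableT fi.
have := integrable_neg_fin_num measurableT fi.
move: (integral mu setT _) (integral mu setT _) => [b| |] [a| |]// _ _.
by rewrite -EFinM -EFinM -EFinB -EFinB -EFinM mulrBr.
Qed.

Lemma scales_cintegral (f : T -> R[i]) : cintegrable mu f ->
  cintegrable mu (fun x => f (phi x)) /\
  cintegral mu (fun x => f (phi x)) = c%:C * cintegral mu f.
Proof.
move=> [f1 f2]; split.
  by split; [exact: (scales_integrable f1)|exact: (scales_integrable f2)].
apply: complexP; rewrite !ReImE /= mul0r ?subr0 ?addr0.
- exact: (scales_Rintegral f1).
- exact: (scales_Rintegral f2).
Qed.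

End scaling_maps.

Lemma scales_affine (R : realType) (a b : R) : a != 0 ->
  scales (@lebesgue_measure R) (fun x => a * x + b) (`|a|^-1).
Proof.
move=> a0; split.
- by rewrite invr_gt0 normr_gt0.
- exact: measurable_affine.
- by move=> f mf f0; exact: ge0_integral_affine.
Qed.

Lemma scales_affine2 (R : realType) (a1 b1 a2 b2 : R) : a1 != 0 -> a2 != 0 ->
  scales (@lebesgue_measure R \x @lebesgue_measure R)%E
    (fun z => (a1 * z.1 + b1, a2 * z.2 + b2)) (`|a1|^-1 * `|a2|^-1).
Proof.
move=> a10 a20; split.
- by rewrite mulr_gt0// invr_gt0 normr_gt0.
- apply: measurable_fun_pair.
  + exact: (measurableT_comp (measurable_affine a1 b1) measurable_fst).
  + exact: (measurableT_comp (measurable_affine a2 b2) measurable_snd).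
- by move=> f mf f0; exact: ge0_integral_affine2.
Qed.

Lemma integrable_indicator d (T : measurableType d) (R : realType) (m : {measure set T -> \bar R})
  (A : set T) :
  measurable A -> (m A < +oo)%E -> m.-integrable setT (fun x => (\1_A x : R)%:E).
Proof.
move=> mA Afin; apply/integrableP; split.
  by apply/measurable_EFinP; exact: measurable_indic.
rewrite (eq_integral (fun x => (\1_A x)%:E)); last by move=> x _; rewrite /= ger0_norm.
by rewrite integral_indic// setIT.
Qed.

(** * The Poisson kernel *)

Section real_line_integrals.
Variable R : realType.
Local Notation mu := (@lebesgue_measure R).

Lemma ge0_integral_even (f : R -> \bar R) : measurable_fun setT f ->
  (forall x, 0 <= f x)%E -> (forall x, f (- x) = f x) ->
  (\int[mu]_x f x =
   \int[mu]_(x in `[0%R, +oo[) f x + \int[mu]_(x in `[0%R, +oo[) f x)%E.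
Proof.
move=> mf f0 fe.
rewrite -[X in integral _ X](@setUv _ `[0%R, +oo[%classic) ge0_integral_setU//=; last 3 first.
- by apply: measurableC.
- exact: measurable_funTS.
- by apply/disj_setPS => x [].
congr (_ + _)%E; rewrite setCitvr integral_itv_bndo_bndc; last exact: measurable_funTS.
by rewrite ge0_integration_by_substitution0//; apply: eq_integral => x _; rewrite fe.
Qed.

Lemma Rintegral_even (f : R -> R) :
  mu.-integrable setT (fun x => (f x)%:E) -> (forall x, f (- x) = f x) ->
  Rintegral mu setT f = 2 * Rintegral mu `[0, +oo[ f.
Proof.
move=> fi fe; have mf := measurable_int _ fi.
have fip := integrable_pos_fin_num measurableT fi.
have fin_ := integrable_neg_fin_num measurableT fi.
have fiy : mu.-integrable `[0, +oo[ (fun x => (f x)%:E) by exact: integrableS fi.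
have mI : measurable (`[0, +oo[%classic : set (measurableTypeR R)) by exact: measurable_itv.
have := integrable_pos_fin_num mI fiy.
have := integrable_neg_fin_num mI fiy.
have e1 := ge0_integral_even (measurable_funepos mf) (funepos_ge0 _)
  (_ : forall x, (fun x => (f x)%:E)^\+%E (- x) = (fun x => (f x)%:E)^\+%E x).
have e2 := ge0_integral_even (measurable_funeneg mf) (funeneg_ge0 _)
  (_ : forall x, (fun x => (f x)%:E)^\-%E (- x) = (fun x => (f x)%:E)^\-%E x).
rewrite /Rintegral (integralE mu setT) (integralE mu `[0, +oo[) e1 ?e2.
2-3: by move=> x; rewrite ?funeposE ?funenegE fe.
move: (integral mu `[0, +oo[ _) (integral mu `[0, +oo[ _) => [b| |] [a| |]// _ _.
by rewrite !fineB ?fineD//=; ring.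
Qed.

Lemma Rintegral_FTC2 (f F : R -> R) (a b : R) : a < b -> continuous f ->
  (forall x, is_derive x (1 : R) F (f x)) ->
  Rintegral mu `[a, b] f = F b - F a.
Proof.
move=> ab cf dF.
have cF : continuous F.
  by move=> x; apply: differentiable_continuous; apply/derivable1_diffP; have [] := dF x.
rewrite /Rintegral (continuous_FTC2 (F := F) ab)//.
- exact: continuous_subspaceT.
- split.
  + by move=> x _; have [] := dF x.
  + exact/cvg_at_right_filter/cF.
  + exact/cvg_at_left_filter/cF.
- by move=> x _; rewrite derive1E; have [] := dF x.
Qed.

End real_line_integrals.

Section poisson_kernel.
Variable R : realType.
Local Notation mu := (@lebesgue_measure R).
Implicit Types (e x z : R).

Definition damping e x : R := expR (- (e * `|x|)).

(** The Fourier transform of [damping e]: the Poisson kernel, a nonnegative approximate identity of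
    mass 1 as [e] tends to 0. *)
Definition poisson e z : R := 2 * e / (e ^+ 2 + (2 * pi * z) ^+ 2).

Lemma measurable_damping e : measurable_fun setT (damping e).
Proof.
apply: measurableT_comp => //; apply: measurableT_comp => //.
by apply: measurable_funM => //; exact: measurable_cst.
Qed.

Lemma damping_ge0 e x : 0 <= damping e x. Proof. exact: expR_ge0. Qed.

Lemma damping_le1 e x : 0 <= e -> damping e x <= 1.
Proof. by move=> e0; rewrite -expR0 ler_expR oppr_le0 mulr_ge0. Qed.

Lemma poisson_den_gt0 e z : 0 < e -> 0 < e ^+ 2 + (2 * pi * z) ^+ 2.
Proof. by move=> e0; rewrite ltr_pwDl ?exprn_gt0// sqr_ge0. Qed.

Lemma poisson_ge0 e z : 0 < e -> 0 <= poisson e z.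
Proof.
by move=> e0; rewrite divr_ge0 ?mulr_ge0 ?addr_ge0 ?sqr_ge0 ?ltW.
Qed.

(** Away from 0 the kernel is O(e); this is what kills the integrals of functions whose frequencies
    stay above a positive [c]. *)
Lemma poisson_le e c z : 0 < e -> 0 < c -> c <= z ->
  poisson e z <= 2 * e / (2 * pi * c) ^+ 2.
Proof.
move=> e0 c0 cz; have p0 := pi_gt0 R.
have cp : 0 < 2 * pi * c by rewrite !mulr_gt0.
rewrite /poisson; apply: ler_wpM2l; first by rewrite mulr_ge0 ?ltW.
rewrite lef_pV2 ?posrE ?poisson_den_gt0 ?exprn_gt0//.
rewrite (le_trans (y := (2 * pi * z) ^+ 2))// ?lerDr ?sqr_ge0//.
rewrite lerXn2r ?nnegrE ?(ltW cp)//.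
  by rewrite !mulr_ge0// ltW// (lt_le_trans c0).
by rewrite ler_wpM2l// !mulr_ge0 ?ltW.
Qed.

Lemma measurable_poisson e : 0 < e -> measurable_fun setT (poisson e).
Proof.
move=> e0; apply: measurable_funM => //; apply: continuous_measurable_fun => z.
apply: cvgV; first by rewrite gt_eqF// poisson_den_gt0.
apply: cvgD; first exact: cvg_cst.
apply: (@continuous_comp _ _ _ (fun z => 2 * pi * z) (fun z => z ^+ 2)).
  by apply: cvgM; [exact: cvg_cst|exact: cvg_id].
exact: exprn_continuous.
Qed.

(* The total mass is a limit of arctangents. *)
Lemma integral_poisson e : 0 < e -> (\int[mu]_z (poisson e z)%:E = 1)%E.
Proof.
move=> e0; have p0 := pi_gt0 R.
have a0 : 2 * pi / e != 0 by rewrite gt_eqF// divr_gt0// mulr_gt0.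
have E z : poisson e z = (2 * e^-1) * (oneDsqr (2 * pi / e * z + 0))^-1.
  have d0 := poisson_den_gt0 z e0.
  rewrite /poisson /oneDsqr addr0; move: d0; move: pi => a d0; field.
  rewrite gt_eqF//=.
  by rewrite (_ : _ + _ = e ^+ 2 + (2 * a * z) ^+ 2) ?(gt_eqF d0)//; ring.
under eq_integral do rewrite E EFinM.
have mo : measurable_fun setT (fun x : R => ((oneDsqr x)^-1)%:E).
  by apply/measurable_EFinP; apply: continuous_measurable_fun; exact: continuous_oneDsqrV.
have o0 x : (0 <= ((oneDsqr x)^-1)%:E :> \bar R)%E.
  by rewrite lee_fin invr_ge0 ltW// oneDsqr_gt0.
rewrite ge0_integralZl_EFin//; last 2 first.
- exact: (measurableT_comp mo (measurable_affine _ _)).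
- by rewrite mulr_ge0// invr_ge0 ltW.
rewrite (ge0_integral_affine 0 a0 (f := fun x => ((oneDsqr x)^-1)%:E))//.
rewrite ge0_integral_even//; last by move=> x; rewrite /oneDsqr sqrrN.
rewrite integral0y_oneDsqr -!EFinD -!EFinM gtr0_norm ?divr_gt0 ?mulr_gt0//.
congr EFin; move: pi p0 => q q0.
by field; rewrite !gt_eqF.
Qed.

Lemma integrable_poisson e : 0 < e ->
  mu.-integrable setT (fun z => (poisson e z)%:E).
Proof.
move=> e0; apply/integrableP; split.
  by apply/measurable_EFinP; exact: measurable_poisson.
under eq_integral do rewrite /= ger0_norm ?poisson_ge0//.
by rewrite integral_poisson// ltry.
Qed.

Lemma cvgy_expRN e : 0 < e -> expR (- (e * x)) @[x --> +oo] --> (0 : R).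
Proof.
move=> e0.
apply: (@cvg_comp _ _ _ (fun x => e * x) (fun x => expR (- x)) _ (+oo)%R); last exact: cvgr_expR.
by apply: gt0_cvgMry => //; exact: cvg_id.
Qed.

Lemma cvg_expRN e : 0 < e -> (fun n : nat => expR (- (e * n%:R))) @ \oo --> (0 : R).
Proof.
move=> e0.
by apply: (@cvg_comp _ _ _ (fun n : nat => n%:R : R) (fun x => expR (- (e * x))) _ (+oo)%R);
  [exact: cvgr_idn|exact: cvgy_expRN].
Qed.

Lemma integrable_damping e : 0 < e ->
  mu.-integrable setT (fun x => (damping e x)%:E).
Proof.
move=> e0.
have md : measurable_fun setT (fun x => (damping e x)%:E).
  by apply/measurable_EFinP; exact: measurable_damping.
apply/integrableP; split => //.
under eq_integral do rewrite /= ger0_norm ?damping_ge0//.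
rewrite ge0_integral_even//; last 2 first.
- by move=> x; rewrite lee_fin damping_ge0.
- by move=> x; rewrite /damping normrN.
suff -> : (\int[mu]_(x in `[0%R, +oo[) (damping e x)%:E = (e^-1)%:E)%E by rewrite -EFinD ltry.
have df x : is_derive x (1 : R) (fun x => - e^-1 * expR (- (e * x))) (expR (- (e * x))).
  apply: is_derive_eq; rewrite /GRing.scale /= ?mulr0 ?add0r ?mulr1.
  by field; rewrite gt_eqF.
have cF x : {for x, continuous (fun x : R => - e^-1 * expR (- (e * x)))}.
  by apply: differentiable_continuous; apply/derivable1_diffP; have [] := df x.
rewrite -(_ : (\int[mu]_(x in `[0%R, +oo[) (expR (- (e * x)))%:E = (e^-1)%:E)%E).
  apply: eq_integral => x; rewrite inE /= in_itv/= andbT => x0.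
  by rewrite /damping ger0_norm.
rewrite (ge0_continuous_FTC2y (F := fun x => - e^-1 * expR (- (e * x))) (l := 0)) => //.
- by rewrite mulr0 oppr0 expR0 mulr1 -EFinB opprK add0r.
- apply: continuous_subspaceT => x.
  apply: (@continuous_comp _ _ _ (fun x => - (e * x)) expR); last exact: continuous_expR.
  by apply: cvgN; apply: cvgM; [exact: cvg_cst|exact: cvg_id].
- rewrite -[X in _ --> X](mulr0 (- e^-1)); apply: cvgM; first exact: cvg_cst.
  exact: cvgy_expRN.
- exact/cvg_at_right_filter/cF.
- by move=> x _; rewrite derive1E; have [] := df x.
Qed.

Lemma Rintegral_damping_cos e a : 0 < e ->
  Rintegral mu setT (fun x => damping e x * cos (a * x)) =
  2 * e / (e ^+ 2 + a ^+ 2).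
Proof.
move=> e0; have den : 0 < e ^+ 2 + a ^+ 2 by rewrite ltr_pwDl ?exprn_gt0// sqr_ge0.
(* An antiderivative of [f], as found by integrating by parts twice. It equals - e / (e^2 + a^2) at
   0 and tends to 0 at infinity. *)
pose F x := expR (- (e * x)) * (a * sin (a * x) - e * cos (a * x)) / (e ^+ 2 + a ^+ 2).
pose f x := expR (- (e * x)) * cos (a * x).
have dF x : is_derive x (1 : R) F (f x).
  rewrite /F /f; apply: is_derive_eq; rewrite /GRing.scale /= ?mulr0 ?add0r ?mulr1.
  by field; rewrite gt_eqF.
have mcos : measurable_fun setT (fun x : R => cos (a * x)).
  apply: measurableT_comp; first by apply: continuous_measurable_fun; exact: continuous_cos.
  exact: measurable_funM.
have mg : measurable_fun setT (fun x => damping e x * cos (a * x)).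
  by apply: measurable_funM => //; exact: measurable_damping.
have gle x : `|damping e x * cos (a * x)| <= damping e x.
  rewrite normrM ger0_norm ?damping_ge0// ler_piMr ?damping_ge0//.
  by rewrite ler_norml cos_geN1 cos_le1.
have gi : mu.-integrable setT (fun x => (damping e x * cos (a * x))%:E).
  apply: (le_integrable measurableT _ _ (integrable_damping e0)).
    by apply/measurable_EFinP.
  by move=> x _; rewrite /= lee_fin (le_trans (gle x))// ler_norm.
have cf : continuous f.
  move=> x; apply: (@cvgM _ _ _ _ (fun x => expR (- (e * x))) (fun x => cos (a * x))).
  - apply: (@continuous_comp _ _ _ (fun x => - (e * x)) expR); last exact: continuous_expR.
    by apply: cvgN; apply: cvgM; [exact: cvg_cst|exact: cvg_id].
  - apply: (@continuous_comp _ _ _ (fun x => a * x) cos); last exact: continuous_cos.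
    by apply: cvgM; [exact: cvg_cst|exact: cvg_id].
rewrite Rintegral_even//; last by move=> x; rewrite /damping normrN mulrN cosN.
rewrite -mulrA; congr (2 * _).
rewrite Rintegral_mkcond.
(* The half-line is exhausted by the intervals [0, n], on which the fundamental theorem of calculus
   applies. *)
pose h (n : nat) := (fun x => damping e x * cos (a * x)) \_ `[0, n%:R].
have mI (i : interval R) : measurable ([set` i] : set (measurableTypeR R)).
  exact: measurable_itv.
have mres (i : interval R) : measurable_fun setT
    ((fun x => damping e x * cos (a * x) : R) \_ [set` i] : measurableTypeR R -> R).
  by apply/(measurable_restrictT _ (mI i)); exact: (measurable_funS measurableT).
have hcvg : (fun n => Rintegral mu setT (h n)) @ \oo -->
    Rintegral mu setT ((fun x => damping e x * cos (a * x)) \_ `[0, +oo[).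
  apply: (@Rintegral_dct _ (measurableTypeR R) R mu h
    ((fun x => damping e x * cos (a * x)) \_ `[0, +oo[) (damping e)).
  - by move=> n; exact: mres.
  - exact: mres.
  - apply: nearW => x; apply: cvg_near_cst; near=> n.
    rewrite /h !patchE !mem_setE !in_itv /= andbT.
    have [x0|//] := leP 0 x; rewrite ifT//.
    by near: n; exact: nbhs_infty_ger.
  - exact: integrable_damping.
  - move=> n x; rewrite /h patchE; case: ifP => // _.
    by rewrite normr0 damping_ge0.
have hE : \forall n \near \oo, F n%:R - F 0 = Rintegral mu setT (h n).
  near=> n; have n0 : 0 < n%:R :> R by rewrite ltr0n; near: n; exists 1%N.
  rewrite /h -Rintegral_mkcond -(Rintegral_FTC2 n0 cf dF).
  apply: eq_Rintegral => x; rewrite inE /= in_itv /= => /andP[x0 _].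
  by rewrite /f /damping ger0_norm.
have Fcvg : (fun n : nat => F n%:R - F 0) @ \oo --> 0 - F 0.
  apply: cvgB; last exact: cvg_cst.
  have c : (fun n : nat => expR (- (e * n%:R)) * ((`|a| + e) / (e ^+ 2 + a ^+ 2)))
      @ \oo --> 0 * ((`|a| + e) / (e ^+ 2 + a ^+ 2)).
    by apply: cvgM; [exact: cvg_expRN|exact: cvg_cst].
  rewrite mul0r in c; have cN := cvgN c; rewrite oppr0 in cN.
  apply: (squeeze_cvgr _ (cN _) c); apply: nearW => n.
  rewrite -ler_norml /F !normrM (ger0_norm (expR_ge0 _)) -mulrA.
  rewrite ler_wpM2l ?expR_ge0// normfV (gtr0_norm den) ler_wpM2r ?invr_ge0 ?(ltW den)//.
  rewrite (le_trans (ler_normB _ _))// !normrM (gtr0_norm e0) lerD//.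
  - by rewrite ler_piMr// ler_norml sin_geN1 sin_le1.
  - by rewrite ler_piMr ?(ltW e0)// ler_norml cos_geN1 cos_le1.
have Fcvg' := cvg_trans (near_eq_cvg hE) Fcvg.
rewrite (cvg_unique _ hcvg (Fcvg' _))//.
rewrite /F !mulr0 oppr0 expR0 sin0 cos0; field.
by rewrite gt_eqF.
Unshelve. all: by end_near. Qed.

Lemma cintegral_damping e z : 0 < e ->
  cintegral mu (fun x => (damping e x)%:C * cis (2 * pi * (x * z))) =
  (poisson e z)%:C.
Proof.
move=> e0; apply: complexP => /=.
  rewrite /poisson -Rintegral_damping_cos//; apply: eq_Rintegral => x _.
  by rewrite mul0r subr0 mulrA (mulrAC _ x).
pose f x : R := damping e x * sin (2 * pi * (x * z)).
have fi : mu.-integrable setT (fun x => (f x)%:E).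
  apply: (le_integrable measurableT _ _ (integrable_damping e0)).
    apply/measurable_EFinP; apply: measurable_funM; first exact: measurable_damping.
    apply: measurableT_comp; first by apply: continuous_measurable_fun; exact: continuous_sin.
    by apply: measurable_funM => //; exact: measurable_funM.
  move=> x _; rewrite /= lee_fin normrM ler_piMr//.
  by rewrite ler_norml sin_geN1 sin_le1.
transitivity (Rintegral mu setT f).
  by apply: eq_Rintegral => x _; rewrite mul0r addr0.
(* The imaginary part integrates an odd function: the substitution of - x for x shows that the
   integral is its own opposite. *)
have n10 : (-1 : R) != 0 by rewrite oppr_eq0 oner_eq0.
have := scales_Rintegral (scales_affine 0 n10) fi.
under eq_Rintegral => x _.
  rewrite /f addr0 mulN1r /damping normrN mulNr mulrN sinN mulrN -mulN1r; over.
rewrite RintegralZl// normrN normr1 invr1 mul1r mulN1r => h.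
by move: h; rewrite -[X in - X = _]/(Rintegral mu setT f) => h; lra.
Qed.

End poisson_kernel.

(** * Functions with one-sided spectrum *)

Section spectral_representation.
Variable R : realType.
Local Notation mu := (@lebesgue_measure R).

Lemma cis_mulD (a x u v : R) :
  cis (a * (x * (u + v))) = cis (a * (x * u)) * cis (a * (x * v)).
Proof. by rewrite -cisD -!mulrDr. Qed.

Lemma harmonic_gt0' n : 0 < harmonic n :> R.
Proof. by rewrite /harmonic /= invr_gt0. Qed.

Lemma cvg_damping (x : R) : (fun n => damping (harmonic n) x) @ \oo --> (1 : R).
Proof.
rewrite /damping -[X in _ --> X]expR0; apply: continuous_cvg; first exact: continuous_expR.
rewrite -[X in _ --> X]oppr0; apply: cvgN.
by rewrite -[X in _ --> X](mul0r `|x|); apply: cvgM; [exact: cvg_harmonic|exact: cvg_cst].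
Qed.

Lemma ccvg_real (u : nat -> R) (l : R) : u @ \oo --> l ->
  ccvg (fun n => (u n)%:C) (l%:C : R[i]).
Proof. by move=> ul; apply: ccvg_ReIm => //=; exact: cvg_cst. Qed.

(** Removes the damping: [normc (F x)] dominates every damped integrand. *)
Lemma cvg_damping_cintegral (F : R -> R[i]) : cintegrable mu F ->
  ccvg (fun n => cintegral mu (fun x => (damping (harmonic n) x)%:C * F x))
       (cintegral mu F).
Proof.
move=> Fi; have mF := cintegrable_cmeasurable Fi.
apply: (@cintegral_dct _ (measurableTypeR R) R mu
  (fun n x => (damping (harmonic n) x)%:C * F x) F (fun x => normc (F x))) => //.
- by move=> n; apply: cmeasurableM => //; apply: cmeasurable_real; exact: measurable_damping.
- apply: nearW => x; rewrite -[X in ccvg _ X](mul1r (F x)); apply: ccvgM.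
    by apply: ccvg_real; exact: cvg_damping.
  exact: ccvg_cst.
- exact: cintegrable_normc.
- move=> n x; rewrite normcM normc_real ger0_norm ?damping_ge0//.
  by rewrite ler_piMl ?normc_ge0// damping_le1// ltW// harmonic_gt0'.
Qed.

Section pairing.
Context d (T : measurableType d) (nu : {sigma_finite_measure set T -> \bar R}).
Variables (a : T -> R[i]) (xi : T -> R).
Hypotheses (ai : cintegrable nu a) (mxi : measurable_fun setT xi).

Let kernel (e : R) (z : R * T) : R[i] :=
  (damping e z.1)%:C * (cis (2 * pi * (z.1 * xi z.2)) * a z.2).

Let kernel_integrable e : 0 < e -> cintegrable (mu \x nu)%E (kernel e).
Proof.
move=> e0.
have m1 : measurable_fun setT (fst : measurableTypeR R * T -> measurableTypeR R).
  exact: measurable_fst.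
have m2 : measurable_fun setT (fun z : measurableTypeR R * T => xi z.2).
  exact: (measurableT_comp mxi measurable_snd).
apply: (@le_cintegrable _ _ _ (mu \x nu)%E _ (fun z => damping e z.1 * normc (a z.2))).
- apply: cmeasurableM.
    by apply: cmeasurable_real; exact: (measurableT_comp (measurable_damping e) m1).
  apply: cmeasurableM; last first.
    exact: (cmeasurable_comp (cintegrable_cmeasurable ai) measurable_snd).
  apply: cmeasurable_cis; apply: measurable_funM => //.
  exact: measurable_funM.
- move=> z; rewrite !normcM normc_cis mul1r normc_real ger0_norm//.
  exact: damping_ge0.
- exact: (integrable_tensor (integrable_damping e0) (cintegrable_normc ai)).
Qed.

(** The damping makes the double integral over [x] and [w] absolutely convergent; after Fubini the
    integral over [x] is the Poisson kernel at the frequency [xi w]. *)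
Lemma damping_pairing e : 0 < e ->
  cintegral mu (fun x => (damping e x)%:C *
     cintegral nu (fun w => cis (2 * pi * (x * xi w)) * a w)) =
  cintegral nu (fun w => (poisson e (xi w))%:C * a w).
Proof.
move=> e0.
have ci x : cintegrable nu (fun w => cis (2 * pi * (x * xi w)) * a w).
  apply: cintegrable_cis => //; apply: measurable_funM => //.
  exact: measurable_funM.
under eq_cintegral do rewrite -cintegralZ//.
rewrite (cFubini (kernel_integrable e0)); apply: eq_cintegral => w.
transitivity (cintegral mu (fun x =>
    a w * ((damping e x)%:C * cis (2 * pi * (x * xi w))))).
  by apply: eq_cintegral => x; rewrite /kernel /=; ring.
rewrite cintegralZ ?cintegral_damping 1?mulrC//.
apply: (@le_cintegrable _ _ _ mu _ (damping e)); last exact: integrable_damping.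
- apply: cmeasurableM; first by apply: cmeasurable_real; exact: measurable_damping.
  by apply: cmeasurable_cis; apply: measurable_funM => //; exact: measurable_funM.
- by move=> x; rewrite normcM normc_cis mulr1 normc_real ger0_norm// damping_ge0.
Qed.

End pairing.

(* [F] is a superposition of characters whose frequencies are at least [c]. *)
Definition spectrum_ge (c : R) (F : R -> R[i]) : Prop :=
  exists d (T : measurableType d) (nu : {sigma_finite_measure set T -> \bar R})
    (a : T -> R[i]) (xi : T -> R),
  [/\ cintegrable nu a, measurable_fun setT xi,
      forall w, a w != 0 -> c <= xi w &
      forall x, F x = cintegral nu (fun w => cis (2 * pi * (x * xi w)) * a w)].

(** The constant is a unit mass at frequency 0, realized as the unit interval with a constant
    frequency. It is the empty product in [spectrum_geX]. *)
Lemma spectrum_ge1 : spectrum_ge 0 (fun=> 1).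
Proof.
have mI : measurable (`[0, 1]%classic : set (measurableTypeR R)) by exact: measurable_itv.
exists _, (measurableTypeR R), mu, (chi `[0, 1]%classic), (fun=> 0); split => //.
  by apply: cintegrable_real; exact: integrable_indic_itv.
move=> x; under eq_cintegral do rewrite !mulr0 cis0 mul1r.
rewrite cintegral_real /Rintegral integral_indic//= setIT lebesgue_measure_itv /= lte_fin ltr01.
by rewrite -EFinB subr0.
Qed.

(** Characters multiply when frequencies add, so the product space carries the product function.
    This is why the measure space is quantified inside [spectrum_ge]. *)
Lemma spectrum_geM c c' F G : spectrum_ge c F -> spectrum_ge c' G ->
  spectrum_ge (c + c') (fun x => F x * G x).
Proof.
move=> [d [T [nu [a [xi [ai mxi axi FE]]]]]] [d' [T' [nu' [a' [xi' [ai' mxi' axi' GE]]]]]].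
have ci x : cintegrable nu (fun w => cis (2 * pi * (x * xi w)) * a w).
  by apply: cintegrable_cis => //; apply: measurable_funM => //; exact: measurable_funM.
have ci' x : cintegrable nu' (fun w => cis (2 * pi * (x * xi' w)) * a' w).
  by apply: cintegrable_cis => //; apply: measurable_funM => //; exact: measurable_funM.
exists _, _, (product_sigma_finite nu nu'), (fun w => a w.1 * a' w.2),
  (fun w => xi w.1 + xi' w.2); split.
- exact: cintegrable_tensor.
- by apply: measurable_funD; [exact: (measurableT_comp mxi measurable_fst)
    |exact: (measurableT_comp mxi' measurable_snd)].
- move=> w aa; rewrite lerD// ?axi ?axi'//; move: aa; apply: contra => /eqP ->.
    by rewrite mul0r.
  by rewrite mulr0.
- move=> x; rewrite FE GE -cintegral_tensor//; apply: eq_cintegral => w.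
  by rewrite cis_mulD; ring.
Qed.

Lemma spectrum_geX c F n : spectrum_ge c F -> spectrum_ge (c *+ n) (fun x => F x ^+ n).
Proof.
move=> Fc; elim: n => [|n IH]; first exact: spectrum_ge1.
rewrite mulrS (_ : (fun x => _) = (fun x => F x * F x ^+ n)); first exact: spectrum_geM.
by apply/funext => x; rewrite exprS.
Qed.

Lemma spectrum_ge_shift c h F : spectrum_ge c F ->
  spectrum_ge (c + h) (fun x => cis (2 * pi * (x * h)) * F x).
Proof.
move=> [d [T [nu [a [xi [ai mxi axi FE]]]]]].
exists d, T, nu, a, (fun w => xi w + h); split => //.
- exact: measurable_funD.
- by move=> w /axi; rewrite lerD2r.
- move=> x; rewrite FE -cintegralZ; last first.
    by apply: cintegrable_cis => //; apply: measurable_funM => //; exact: measurable_funM.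
  apply: eq_cintegral => w /=.
  by rewrite cis_mulD; ring.
Qed.

Lemma spectrum_geW c c' F : c' <= c -> spectrum_ge c F -> spectrum_ge c' F.
Proof.
move=> cc [d [T [nu [a [xi [ai mxi axi FE]]]]]].
by exists d, T, nu, a, xi; split => // w /axi; exact: le_trans.
Qed.

(** The damped integral of [F] averages [poisson e] over frequencies at least [c], hence is O(e); it
    also tends to the integral of [F]. *)
Let spectrum_gt_cintegral c F : 0 < c -> spectrum_ge c F -> cintegrable mu F ->
  cintegral mu F = 0.
Proof.
move=> c0 [d [T [nu [a [xi [ai mxi axi FE]]]]]] Fi; have p0 := pi_gt0 R.
apply: (ccvg_unique (cvg_damping_cintegral Fi)); rewrite /ccvg.
pose K := Rintegral nu setT (fun w => normc (a w)).
have c2 : (fun n => harmonic n * (2 / (2 * pi * c) ^+ 2 * K)) @ \oo --> (0 : R).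
  by rewrite -[X in _ --> X](mul0r (2 / (2 * pi * c) ^+ 2 * K)); apply: cvgM;
    [exact: cvg_harmonic|exact: cvg_cst].
apply: (squeeze_cvgr _ (cvg_cst 0) c2); apply: nearW => n.
have e0 := harmonic_gt0' n; rewrite subr0.
apply/andP; split; first exact: normc_ge0.
under eq_cintegral do rewrite FE.
rewrite damping_pairing//.
have bd w : normc ((poisson (harmonic n) (xi w))%:C * a w) <=
    2 * harmonic n / (2 * pi * c) ^+ 2 * normc (a w).
  (* Where [a] vanishes the frequency is not constrained, but the integrand is 0. *)
  rewrite normcM; have [->|a0] := eqVneq (a w) 0; first by rewrite normc0 !mulr0.
  rewrite ler_wpM2r ?normc_ge0// normc_real ger0_norm ?poisson_ge0//.
  by apply: poisson_le => //; exact: axi.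
have gi : nu.-integrable setT (fun w => (2 * harmonic n / (2 * pi * c) ^+ 2 * normc (a w))%:E).
  by under eq_fun do rewrite EFinM; apply: integrableZl => //; exact: cintegrable_normc.
apply: le_trans (normc_cintegral_le _ bd gi) _.
  apply: (le_cintegrable _ bd gi).
  apply: cmeasurableM (cintegrable_cmeasurable ai).
  by apply: cmeasurable_real; exact: (measurableT_comp (measurable_poisson e0)).
rewrite RintegralZl//; last exact: cintegrable_normc.
by rewrite -/K le_eqVlt; apply/orP; left; apply/eqP; ring.
Qed.

(* Modulating by a small positive frequency moves the spectrum off zero. *)
Lemma spectrum_ge0_cintegral F : spectrum_ge 0 F -> cintegrable mu F ->
  cintegral mu F = 0.
Proof.
move=> F0 Fi; have mF := cintegrable_cmeasurable Fi.
pose G n x := cis (2 * pi * (x * harmonic n)) * F x.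
have mc n : measurable_fun setT (fun x : R => 2 * pi * (x * harmonic n)).
  by apply: measurable_funM => //; exact: measurable_funM.
have cvg : ccvg (fun n => cintegral mu (G n)) (cintegral mu F).
  apply: (@cintegral_dct _ (measurableTypeR R) R mu G F (fun x => normc (F x))) => //.
  - by move=> n; exact: (cmeasurableM (cmeasurable_cis (mc n)) mF).
  - apply: nearW => x; rewrite /G -[X in ccvg _ X](mul1r (F x)) -cis0; apply: ccvgM; last exact:
      ccvg_cst.
    have c0 : (fun n => 2 * pi * (x * harmonic n)) @ \oo --> (0 : R).
      rewrite -[X in _ --> X](mulr0 (2 * pi)); apply: cvgM; first exact: cvg_cst.
      by rewrite -[X in _ --> X](mulr0 x); apply: cvgM; [exact: cvg_cst|exact: cvg_harmonic].
    apply: ccvg_ReIm => /=.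
    + by apply: continuous_cvg => //; exact: continuous_cos.
    + by apply: continuous_cvg => //; exact: continuous_sin.
  - exact: cintegrable_normc.
  - by move=> n x; rewrite /G normcM normc_cis mul1r.
apply: (ccvg_unique cvg); rewrite (_ : (fun n => _) = fun=> 0); first exact: ccvg_cst.
apply/funext => n; apply: (spectrum_gt_cintegral (harmonic_gt0' n)).
  by rewrite -[harmonic n]add0r; exact: spectrum_ge_shift.
exact: (cintegrable_cis Fi (mc n)).
Qed.

End spectral_representation.

(** * Plancherel's inequality *)

#[global] Arguments cintegral : simpl never.
#[global] Arguments ComplexField.Normc.normc : simpl never.

Section fatou_bound.
Context d (T : measurableType d) (R : realType).
Variable mu : {measure set T -> \bar R}.

Lemma limn_einf_le (u : nat -> \bar R) (B : \bar R) :
  (forall n, u n <= B)%E -> (limn_einf u <= B)%E.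
Proof.
move=> uB; rewrite limn_einf_lim; apply: lime_le; first exact: is_cvg_einfs.
apply: nearW => n; apply: le_trans (uB n); apply: ereal_inf_lbound.
by exists n => /=.
Qed.

Lemma limn_einf_ge0 (u : nat -> \bar R) :
  (forall n, 0 <= u n)%E -> (0 <= limn_einf u)%E.
Proof.
move=> u0; rewrite limn_einf_lim; apply: lime_ge; first exact: is_cvg_einfs.
by apply: nearW => n; apply: le_ereal_inf_tmp => _ [k _ <-].
Qed.

Lemma fatou_bound (f : nat -> T -> R) (l : T -> R) (B : \bar R) :
  (forall n, measurable_fun setT (f n)) -> measurable_fun setT l ->
  (forall n x, 0 <= f n x) -> (forall x, 0 <= l x) ->
  {ae mu, forall x, (fun n => f n x) @ \oo --> l x} ->
  (forall n, \int[mu]_x (f n x)%:E <= B)%E -> (\int[mu]_x (l x)%:E <= B)%E.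
Proof.
move=> mf ml f0 l0 fl fB.
have mfE n : measurable_fun setT (fun x => (f n x)%:E) by exact/measurable_EFinP.
have fE0 n x : setT x -> (0 <= (f n x)%:E)%E by rewrite lee_fin.
have h := fatou mu measurableT mfE fE0.
apply: le_trans (le_trans h (limn_einf_le fB)).
apply: ae_ge0_le_integral => //.
- by move=> x _; rewrite lee_fin.
- exact/measurable_EFinP.
- by move=> x _; apply: limn_einf_ge0 => n; rewrite lee_fin.
- rewrite /limn_einf; apply: measurableT_comp => //.
  by apply: measurable_fun_limn_esup => n; exact: measurableT_comp.
- apply: filterS fl => x xl _.
  have /cvg_limn_einf_sup[-> _] : (fun n => (f n x)%:E) @ \oo --> (l x)%:E.
    by apply: cvg_EFin => //; exact: nearW.
  by [].
Qed.

End fatou_bound.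

Section plancherel.
Variable R : realType.
Local Notation mu := (@lebesgue_measure R).

Lemma poisson_bound e z : 0 < e -> poisson e z <= 2 / e :> R.
Proof.
move=> e0; have -> : 2 / e = 2 * e / e ^+ 2 by field; rewrite gt_eqF.
rewrite /poisson; apply: ler_wpM2l; first by rewrite mulr_ge0// ltW.
by rewrite lef_pV2 ?posrE ?poisson_den_gt0 ?exprn_gt0// lerDl sqr_ge0.
Qed.

Lemma integral_poisson_affine (e a b : R) : 0 < e -> a != 0 ->
  (\int[mu]_z (poisson e (a * z + b))%:E = (`|a|^-1)%:E)%E.
Proof.
move=> e0 a0; rewrite (ge0_integral_affine b a0 (f := fun z => (poisson e z)%:E)).
- by rewrite integral_poisson// mule1.
- by apply/measurable_EFinP; exact: measurable_poisson.
- by move=> z; rewrite lee_fin poisson_ge0.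
Qed.

Lemma integral_poisson_subl (e y : R) : 0 < e ->
  (\int[mu]_z (poisson e (y - z))%:E = 1)%E.
Proof.
move=> e0; have n10 : (-1 : R) != 0 by rewrite oppr_eq0 oner_eq0.
have := integral_poisson_affine y e0 n10; rewrite normrN normr1 invr1 => <-.
by apply: eq_integral => z _; rewrite mulN1r addrC.
Qed.

Lemma integral_poisson_subr (e y : R) : 0 < e ->
  (\int[mu]_z (poisson e (z - y))%:E = 1)%E.
Proof.
move=> e0.
have := integral_poisson_affine (- y) e0 (oner_neq0 _); rewrite normr1 invr1 => <-.
by apply: eq_integral => z _; rewrite mul1r.
Qed.

Lemma measurable_poisson_comp d (T : measurableType d) (e : R) (h : T -> R) :
  0 < e -> measurable_fun setT h -> measurable_fun setT (fun x => poisson e (h x)).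
Proof. by move=> e0 mh; exact: (measurableT_comp (measurable_poisson e0) mh). Qed.

Variable g : R -> R[i].
Hypothesis gi : cintegrable mu g.
Let mg : cmeasurable g. Proof. exact: cintegrable_cmeasurable gi. Qed.
Let G x := cintegral mu (fun y => cis (2 * pi * (x * y)) * g y).

Let mphase (x : R) : measurable_fun setT (fun y : R => 2 * pi * (x * y)).
Proof. by apply: measurable_funM => //; exact: measurable_funM. Qed.

Lemma cmeasurable_transform : cmeasurable G.
Proof.
apply: (cmeasurable_cintegral_prod mu (T1 := measurableTypeR R)
  (F := fun z : R * R => cis (2 * pi * (z.1 * z.2)) * g z.2)).
apply: cmeasurableM; last exact: (cmeasurable_comp mg measurable_snd).
apply: cmeasurable_cis; apply: measurable_funM => //.
by apply: measurable_funM; [exact: measurable_fst|exact: measurable_snd].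
Qed.

Lemma normc_transform_le x : normc (G x) <= Rintegral mu setT (fun y => normc (g y)).
Proof.
apply: normc_cintegral_le; last exact: cintegrable_normc.
- exact: (cintegrable_cis gi (mphase x)).
- by move=> y; rewrite normcM normc_cis mul1r.
Qed.

(** Expanding |G|^2 gives a superposition of characters of frequencies y - y', so the damped
    integral is the double integral of g(y) conj(g(y')) poisson e (y - y'). The inequality 2uv <=
    u^2 + v^2 and the unit mass of the kernel bound it. *)
Let damped e : 0 < e ->
  (\int[mu]_x (damping e x * normc (G x) ^+ 2)%:E <=
   \int[mu]_y (normc (g y) ^+ 2)%:E)%E.
Proof.
move=> e0; set K := Rintegral mu setT (fun y => normc (g y)).
have mG := cmeasurable_transform.
have DGi : mu.-integrable setT (fun x => (damping e x * normc (G x) ^+ 2)%:E).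
  apply: (@le_integrable _ (measurableTypeR R) R mu setT measurableT _
    (fun x => (K ^+ 2)%:E * (damping e x)%:E)%E).
  - apply/measurable_EFinP; apply: measurable_funM; first exact: measurable_damping.
    by apply: measurable_funX; exact: measurable_normc.
  - move=> x _; rewrite /= lee_fin !normrM mulrC; apply: ler_wpM2r => //.
    rewrite -!normrM -!expr2 !ger0_norm ?sqr_ge0// lerXn2r ?nnegrE ?normc_ge0//.
      by rewrite (le_trans _ (normc_transform_le x))// normc_ge0.
    exact: normc_transform_le.
  - by apply: integrableZl => //; exact: integrable_damping.
have gci := cintegrable_conj gi.
pose a (w : R * R) := g w.1 * conjc (g w.2).
pose xi (w : measurableTypeR R * measurableTypeR R) : R := w.1 - w.2.
have ai : cintegrable (product_sigma_finite mu mu) a.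
  exact: (cintegrable_tensor gi gci).
have mxi : measurable_fun setT xi.
  by apply: measurable_funB; [exact: measurable_fst|exact: measurable_snd].
have GG x : (normc (G x) ^+ 2)%:C =
    cintegral (product_sigma_finite mu mu) (fun w => cis (2 * pi * (x * xi w)) * a w).
  rewrite -mulc_conj /G -cintegral_conj; last exact: (cintegrable_cis gi (mphase x)).
  have ci2 : cintegrable mu (fun y => conjc (cis (2 * pi * (x * y)) * g y)).
    under eq_fun do rewrite conjcM conj_cis.
    by apply: (cintegrable_cis gci); apply: measurableT_comp => //; exact: mphase.
  rewrite -(cintegral_tensor (cintegrable_cis gi (mphase x)) ci2).
  apply: eq_cintegral => w; rewrite /a /xi cis_mulD conjcM conj_cis !mulrN /=; ring.
have -> : (\int[mu]_x (damping e x * normc (G x) ^+ 2)%:E =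
    (normc (cintegral (product_sigma_finite mu mu)
       (fun w => (poisson e (xi w))%:C * a w)))%:E)%E.
  rewrite -(damping_pairing ai mxi e0) -[LHS]fineK; last exact: integrable_fin_num.
  congr EFin; under [in RHS]eq_cintegral do rewrite -GG -rmorphM.
  rewrite cintegral_real normc_real ger0_norm//.
  by apply: Rintegral_ge0 => x _; rewrite mulr_ge0 ?damping_ge0 ?sqr_ge0.
have mP : measurable_fun setT (fun w => poisson e (xi w)).
  exact: (measurableT_comp (measurable_poisson e0) mxi).
have Pai : cintegrable (product_sigma_finite mu mu) (fun w => (poisson e (xi w))%:C * a w).
  apply: (cintegrable_bounded (K := 2 / e) ai (cmeasurable_real mP)).
  by move=> w; rewrite normc_real ger0_norm ?poisson_ge0// poisson_bound.
have ng2 : measurable_fun setT (fun y => normc (g y) ^+ 2).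
  by apply: measurable_funX; exact: measurable_normc.
pose h (w : measurableTypeR R * measurableTypeR R) :=
  poisson e (xi w) * (normc (g w.1) ^+ 2 / 2).
pose h' (w : measurableTypeR R * measurableTypeR R) :=
  poisson e (xi w) * (normc (g w.2) ^+ 2 / 2).
have mh : measurable_fun setT h.
  apply: measurable_funM => //; apply: measurable_funM => //.
  exact: (measurableT_comp ng2 measurable_fst).
have mh' : measurable_fun setT h'.
  apply: measurable_funM => //; apply: measurable_funM => //.
  exact: (measurableT_comp ng2 measurable_snd).
have h0 w : 0 <= h w by rewrite mulr_ge0 ?poisson_ge0 ?divr_ge0 ?sqr_ge0.
have h0' w : 0 <= h' w by rewrite mulr_ge0 ?poisson_ge0 ?divr_ge0 ?sqr_ge0.
apply: le_trans (_ : (\int[product_sigma_finite mu mu]_w ((h w)%:E + (h' w)%:E) <= _)%E).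
  apply: (@le_trans _ _ (Rintegral (product_sigma_finite mu mu) setT
      (fun w => normc ((poisson e (xi w))%:C * a w)))%:E).
    by rewrite lee_fin normc_cintegral.
  rewrite /Rintegral fineK; last by apply: integrable_fin_num => //; exact: cintegrable_normc.
  apply: ge0_le_integral => //.
  - by move=> w _; rewrite lee_fin normc_ge0.
  - by apply/measurable_EFinP; apply: measurable_normc; exact: cintegrable_cmeasurable Pai.
  - by apply: emeasurable_funD; exact/measurable_EFinP.
  - move=> w _; rewrite -EFinD lee_fin /h /h' -mulrDr !normcM normc_conj normc_real.
    rewrite ger0_norm ?poisson_ge0// ler_wpM2l ?poisson_ge0//.
    have := sqr_ge0 (normc (g w.1) - normc (g w.2)).
    by move: (normc (g w.1)) (normc (g w.2)) => u v; nra.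
rewrite ge0_integralD//; try exact/measurable_EFinP; last 2 first.
- by move=> w _; rewrite lee_fin.
- by move=> w _; rewrite lee_fin.
have E1 : (\int[product_sigma_finite mu mu]_w (h w)%:E =
    \int[mu]_y (normc (g y) ^+ 2 / 2)%:E)%E.
  rewrite (fubini_tonelli1 (m1 := mu) (m2 := mu) (EFin \o h))//; last exact/measurable_EFinP.
  apply: eq_integral => y _; rewrite /fubini_F /h /xi /=.
  under eq_integral => z _ do rewrite mulrC EFinM.
  rewrite ge0_integralZl_EFin//.
  + by rewrite integral_poisson_subl// mule1.
  + by move=> z _; rewrite lee_fin poisson_ge0.
  + by apply/measurable_EFinP; apply: measurable_poisson_comp => //; exact: measurable_funB.
  + by rewrite divr_ge0 ?sqr_ge0.
have E2 : (\int[product_sigma_finite mu mu]_w (h' w)%:E =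
    \int[mu]_y (normc (g y) ^+ 2 / 2)%:E)%E.
  rewrite (fubini_tonelli2 (m1 := mu) (m2 := mu) (EFin \o h'))//; last exact/measurable_EFinP.
  apply: eq_integral => y _; rewrite /fubini_G /h' /xi /=.
  under eq_integral => z _ do rewrite mulrC EFinM.
  rewrite ge0_integralZl_EFin//.
  + by rewrite integral_poisson_subr// mule1.
  + by move=> z _; rewrite lee_fin poisson_ge0.
  + by apply/measurable_EFinP; apply: measurable_poisson_comp => //; exact: measurable_funB.
  + by rewrite divr_ge0 ?sqr_ge0.
rewrite E1 E2 -ge0_integralD//; try (by apply/measurable_EFinP; exact: measurable_funM);
  try (by move=> y _; rewrite lee_fin divr_ge0 ?sqr_ge0).
rewrite le_eqVlt; apply/orP; left; apply/eqP.
by apply: eq_integral => y _; rewrite -EFinD -splitr.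
Qed.

(** The damped bounds are uniform in [e], and Fatou's lemma removes the damping without presupposing
    that the left side is finite. *)
Lemma plancherel_le : (\int[mu]_x (normc (G x) ^+ 2)%:E <=
   \int[mu]_y (normc (g y) ^+ 2)%:E)%E.
Proof.
have mG := cmeasurable_transform.
have mG2 : measurable_fun setT (fun x => normc (G x) ^+ 2).
  by apply: measurable_funX; exact: measurable_normc.
apply: (@fatou_bound _ (measurableTypeR R) R mu
  (fun n x => damping (harmonic n) x * normc (G x) ^+ 2)) => //.
- by move=> n; apply: measurable_funM => //; exact: measurable_damping.
- by move=> n x; rewrite mulr_ge0 ?damping_ge0 ?sqr_ge0.
- by move=> x; rewrite sqr_ge0.
- apply: nearW => x; rewrite -[X in _ --> X]mul1r; apply: cvgM; last exact: cvg_cst.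
  exact: cvg_damping.
- by move=> n; exact/damped/harmonic_gt0'.
Qed.

End plancherel.

(** * The L^p norm *)

Section cLnorm_theory.
Context d (T : measurableType d) (R : realType).
Variable mu : {measure set T -> \bar R}.
Variable k : nat.
Hypothesis k0 : (0 < k)%N.
Implicit Types (f g : T -> R[i]).

(** The [k]-th power of the norm. Its natural exponent avoids real powers, and [cLnorm_le] carries
    bounds from one to the other. *)
Definition pmass f : \bar R := (\int[mu]_x (normc (f x) ^+ k)%:E)%E.

Local Notation N f := (cLnorm mu k%:R f).

Let kR0 : 0 < k%:R :> R. Proof. by rewrite ltr0n. Qed.

Lemma pmass_ge0 f : (0 <= pmass f)%E.
Proof. by apply: integral_ge0 => x _; rewrite lee_fin exprn_ge0// normc_ge0. Qed.

Lemma measurable_pmass f : cmeasurable f ->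
  measurable_fun setT (fun x => normc (f x) ^+ k).
Proof. by move=> mf; apply: measurable_funX; exact: measurable_normc. Qed.

Lemma cLnormE f : N f = (pmass f `^ (k%:R^-1))%E.
Proof.
rewrite /cLnorm unlock; congr (_ `^ _)%E; apply: eq_integral => x _.
by rewrite /= ger0_norm ?normc_ge0// powR_mulrn// normc_ge0.
Qed.

Lemma cLnorm_ge0 f : (0 <= N f)%E.
Proof. by rewrite cLnormE poweR_ge0. Qed.

Lemma cLnormX f : (N f `^ k%:R)%E = pmass f.
Proof. by rewrite cLnormE -poweRrM mulVf ?gt_eqF// poweRe1// pmass_ge0. Qed.

Lemma cLnorm_le f (c : R) : 0 <= c -> ((N f <= c%:E) = (pmass f <= (c ^+ k)%:E))%E.
Proof.
move=> c0; have E : ((c ^+ k)%:E = c%:E `^ k%:R)%E by rewrite poweR_EFin powR_mulrn.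
apply/idP/idP => h.
- rewrite E -cLnormX gt0_ler_poweR ?ler0n//.
  + by rewrite in_itv /= cLnorm_ge0 leey.
  + by rewrite in_itv /= lee_fin c0 leey.
- rewrite cLnormE (_ : c%:E = (c ^+ k)%:E `^ (k%:R^-1))%E; last first.
    by rewrite E -poweRrM mulfV ?gt_eqF// poweRe1.
  rewrite gt0_ler_poweR ?invr_ge0 ?ler0n//.
  + by rewrite in_itv /= pmass_ge0 leey.
  + by rewrite in_itv /= lee_fin exprn_ge0 //= leey.
Qed.

Lemma cLnorm_lty f : ((N f < +oo) = (pmass f < +oo))%E.
Proof.
apply/idP/idP => h.
- by rewrite -cLnormX poweR_lty.
- by rewrite cLnormE poweR_lty.
Qed.

Lemma le_pmass f g : cmeasurable f -> cmeasurable g ->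
  {ae mu, forall x, normc (f x) <= normc (g x)} -> (pmass f <= pmass g)%E.
Proof.
move=> mf mg fg; apply: ae_ge0_le_integral => //.
- by move=> x _; rewrite lee_fin exprn_ge0// normc_ge0.
- by apply/measurable_EFinP; exact: measurable_pmass.
- by move=> x _; rewrite lee_fin exprn_ge0// normc_ge0.
- by apply/measurable_EFinP; exact: measurable_pmass.
- apply: filterS fg => x fgx _; rewrite lee_fin.
  by rewrite lerXn2r ?nnegrE ?normc_ge0.
Qed.

Lemma ae_eq_cLnorm f g : cmeasurable f -> cmeasurable g ->
  {ae mu, forall x, f x = g x} -> N f = N g.
Proof.
move=> mf mg fg; rewrite !cLnormE; congr (_ `^ _)%E; apply/eqP; rewrite eq_le.
by apply/andP; split; apply: le_pmass => //; apply: filterS fg => x ->.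
Qed.

Lemma cLnormZ (c : R[i]) f : cmeasurable f ->
  N (fun x => c * f x) = ((normc c)%:E * N f)%E.
Proof.
move=> mf; rewrite !cLnormE.
have -> : pmass (fun x => c * f x) = ((normc c ^+ k)%:E * pmass f)%E.
  rewrite /pmass -ge0_integralZl_EFin ?exprn_ge0 ?normc_ge0//.
  - by apply: eq_integral => x _; rewrite normcM exprMn EFinM.
  - by move=> x _; rewrite lee_fin exprn_ge0// normc_ge0.
  - by apply/measurable_EFinP; exact: measurable_pmass.
rewrite poweRM ?pmass_ge0 ?lee_fin ?exprn_ge0 ?normc_ge0//; congr (_ * _)%E.
rewrite poweR_EFin -powR_mulrn ?normc_ge0// -powRrM mulfV ?gt_eqF// powRr1//.
exact: normc_ge0.
Qed.

Lemma cLnormN f : cmeasurable f -> N (fun x => - f x) = N f.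
Proof.
move=> mf; under [fun x => _]eq_fun do rewrite -mulN1r.
by rewrite cLnormZ// normcN normc1 mul1e.
Qed.

Lemma cLnormD f g : cmeasurable f -> cmeasurable g ->
  (N (fun x => f x + g x)%R <= N f + N g)%E.
Proof.
move=> mf mg; have k1 : 1 <= k%:R :> R by rewrite ler1n.
apply: le_trans (minkowski_EFin mu (measurable_normc mf) (measurable_normc mg) k1).
rewrite /cLnorm unlock; apply: gt0_ler_poweR.
- by rewrite invr_ge0 ler0n.
- by rewrite in_itv /= leey andbT; apply: integral_ge0 => x _; rewrite lee_fin powR_ge0.
- by rewrite in_itv /= leey andbT; apply: integral_ge0 => x _; rewrite lee_fin powR_ge0.
apply: ge0_le_integral => //.
- by move=> x _; exact: poweR_ge0.
- apply: (measurableT_comp (measurable_poweR _)); apply: measurableT_comp => //.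
  by apply/measurable_EFinP; apply: measurable_normc; exact: cmeasurableD.
- apply: (measurableT_comp (measurable_poweR _)); apply: measurableT_comp => //.
  by apply/measurable_EFinP; apply: measurable_funD; exact: measurable_normc.
- move=> x _ /=; rewrite lee_fin !powR_mulrn// lerXn2r ?nnegrE//.
  by rewrite !ger0_norm ?addr_ge0 ?normc_ge0// normcD.
Qed.

Lemma cLnormB f g : cmeasurable f -> cmeasurable g ->
  (N (fun x => f x - g x)%R <= N f + N g)%E.
Proof.
move=> mf mg; rewrite -(cLnormN mg); apply: cLnormD => //.
exact: cmeasurableN.
Qed.

Lemma cLnorm_eq0 f : cmeasurable f -> N f = 0%E -> {ae mu, forall x, f x = 0}.
Proof.
move=> mf f0.
have i0 : (\int[mu]_x `|(normc (f x) ^+ k)%:E| = 0)%E.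
  transitivity (pmass f); last by rewrite -cLnormX f0 poweR0r ?gt_eqF.
  by apply: eq_integral => x _; rewrite /= ger0_norm// exprn_ge0// normc_ge0.
have := (ae_eq_integral_abs mu measurableT
  ((measurable_EFinP _ _).2 (measurable_pmass mf))).1 i0.
apply: filterS => x /(_ I)/eqP; rewrite eqe expf_eq0 k0 /= => /eqP.
exact: normc_eq0.
Qed.

Lemma cLnorm0 : N (fun=> 0) = 0%E.
Proof.
rewrite cLnormE /pmass normc0 expr0n eqn0Ngt k0 integral0 poweR0r//.
by rewrite invr_eq0 gt_eqF.
Qed.

Lemma cLp_add (c : R[i]) f g : cLp mu k%:R f -> cLp mu k%:R g ->
  cLp mu k%:R (fun x => c * f x + g x).
Proof.
move=> [mf f1] [mg g1].
have mcf : cmeasurable (fun x => c * f x).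
  by apply: cmeasurableM => //; exact: cmeasurable_cst.
split; first exact: cmeasurableD.
rewrite (le_lt_trans (cLnormD mcf mg))// lte_add_pinfty//.
by rewrite cLnormZ// lte_mul_pinfty// lee_fin normc_ge0.
Qed.

Lemma cLpB f g : cLp mu k%:R f -> cLp mu k%:R g ->
  cLp mu k%:R (fun x => f x - g x).
Proof.
move=> [mf f1] [mg g1]; split; first exact: cmeasurableB.
by rewrite (le_lt_trans (cLnormB mf mg))// lte_add_pinfty.
Qed.

Lemma cLnorm_fatou (u : nat -> T -> R[i]) v (c : R) : 0 <= c ->
  (forall n, cmeasurable (u n)) -> cmeasurable v ->
  {ae mu, forall x, ccvg (fun n => u n x) (v x)} ->
  (forall n, N (u n) <= c%:E)%E -> (N v <= c%:E)%E.
Proof.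
move=> c0 mu_ mv uv uc; rewrite cLnorm_le//.
apply: (@fatou_bound _ T R mu (fun n x => normc (u n x) ^+ k)).
- by move=> n; exact: measurable_pmass.
- exact: measurable_pmass.
- by move=> n x; rewrite exprn_ge0// normc_ge0.
- by move=> x; rewrite exprn_ge0// normc_ge0.
- apply: filterS uv => x /ccvg_normc h.
  have c2 := @exprn_continuous R k (normc (v x)).
  exact: (@cvg_comp _ _ _ (fun n => normc (u n x)) (fun z : R => z ^+ k) _ _ _ h c2).
- by move=> n; have := uc n; rewrite cLnorm_le.
Qed.

(* The weights 2^n make the series of the [normc (u n.+1 x - u n x)] summable
   almost everywhere without Minkowski's inequality for infinite sums. *)
Lemma cLnorm_fast_cauchy (u : nat -> T -> R[i]) :
  (forall n, cmeasurable (u n)) ->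
  (forall n, N (fun x => u n.+1 x - u n x)%R <= ((4 ^- n)%R)%:E)%E ->
  {ae mu, forall x, exists l, ccvg (fun n => u n x) l}.
Proof.
move=> mu_ fast; pose w n x : R := (2 ^+ n * normc (u n.+1 x - u n x)) ^+ k.
have w0 n x : 0 <= w n x by rewrite exprn_ge0// mulr_ge0 ?exprn_ge0// normc_ge0.
have mw n : measurable_fun setT (w n).
  apply: measurable_funX; apply: measurable_funM => //.
  by apply: measurable_normc; exact: cmeasurableB.
have wint n : (\int[mu]_x (w n x)%:E <= (2^-1 ^+ n)%:E)%E.
  have -> : (\int[mu]_x (w n x)%:E =
      ((2 ^+ n) ^+ k)%:E * pmass (fun x => u n.+1 x - u n x)%R)%E.
    rewrite /pmass -ge0_integralZl_EFin//.
    - by apply: eq_integral => x _; rewrite -EFinM -exprMn.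
    - by move=> x _; rewrite lee_fin exprn_ge0// normc_ge0.
    - by apply/measurable_EFinP; apply: measurable_pmass; exact: cmeasurableB.
  have := fast n; rewrite cLnorm_le ?invr_ge0 ?exprn_ge0// => h.
  apply: le_trans (lee_pmul _ _ (lexx _) h) _ => //.
    exact: pmass_ge0.
  rewrite -EFinM lee_fin -exprMn.
  have -> : 2 ^+ n * 4 ^- n = 2^-1 ^+ n :> R.
    by rewrite -exprVn -exprMn; congr (_ ^+ _); field.
  rewrite -[leRHS]expr1 ler_wiXn2l ?exprn_ge0 ?invr_ge0//.
  by rewrite exprn_ile1 ?invr_ge0// invf_le1// ler1n.
have S : (\int[mu]_x (\sum_(0 <= n <oo) (w n x)%:E) < +oo)%E.
  rewrite integral_nneseries//; last 2 first.
  - by move=> n; exact/measurable_EFinP.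
  - by move=> n x _; rewrite lee_fin.
  apply: le_lt_trans (_ : (\sum_(0 <= n <oo) (2^-1 ^+ n)%:E < +oo)%E).
    apply: lee_nneseries => [n *|n *]; last exact: wint.
    by apply: integral_ge0 => x _; rewrite lee_fin.
  have c : (fun n => (\sum_(0 <= i < n) (2^-1 ^+ i)%:E)%E) @ \oo --> (2 : R)%:E.
    under [fun n => _]eq_fun do rewrite sumEFin.
    apply: cvg_EFin; first exact: nearW.
    have h1 : `|2^-1 : R| < 1 by rewrite ger0_norm ?invr_ge0// invf_lt1// ltr1n.
    have := cvg_geometric_series (a := 1) h1.
    rewrite (_ : 1 / (1 - 2^-1) = 2); last by field.
    rewrite (_ : fine \o _ = series (geometric 1 (2^-1 : R)))//.
    apply/funext => n /=; rewrite /series /geometric /=.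
    by apply: eq_bigr => i _; rewrite mul1r.
  by rewrite (cvg_lim _ c)// ltry.
have ifin : mu.-integrable setT (fun x => \sum_(0 <= n <oo) (w n x)%:E)%E.
  apply/integrableP; split.
    apply: ge0_emeasurable_sum => [n x *|n *]; last exact/measurable_EFinP.
    by rewrite lee_fin.
  apply: le_lt_trans S; apply: ge0_le_integral => //.
  - by apply: measurableT_comp => //; apply: ge0_emeasurable_sum => [n x *|n *];
      [rewrite lee_fin|exact/measurable_EFinP].
  - by apply: ge0_emeasurable_sum => [n x *|n *]; [rewrite lee_fin|exact/measurable_EFinP].
  - by move=> x _; rewrite gee0_abs//; apply: nneseries_ge0 => n *; rewrite lee_fin.
have := integrable_ae measurableT ifin; apply: filterS => x /(_ I) fx.
have [M M0 wM] : exists2 M : R, 0 <= M & forall n, normc (u n.+1 x - u n x) <= M * 2^-1 ^+ n.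
  pose s := fine (\sum_(0 <= n <oo) (w n x)%:E)%E.
  (* If a weighted increment exceeds 1, it is at most its own [k]-th power, which is a term of the
     series with sum [s]. *)
  exists (Num.max 1 s); first by rewrite le_max ler01.
  move=> n; have ws : w n x <= s.
    rewrite -lee_fin /s fineK//.
    have := @nneseries_lim_ge R (fun n => (w n x)%:E) xpredT 0 n.+1.
    rewrite big_nat_recr//= => h; apply: le_trans (h _); last by move=> *; rewrite lee_fin.
    by rewrite leeDr// sume_ge0// => i _; rewrite lee_fin.
  rewrite -(ler_pM2r (_ : 0 < 2 ^+ n)) ?exprn_gt0// -mulrA -exprMn mulVf// expr1n mulr1.
  rewrite mulrC; set a := _ * _ in ws *.
  have [a1|a1] := leP a 1; first by rewrite le_max a1.
  rewrite le_max; apply/orP; right; apply: le_trans ws.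
  by rewrite /w -/a -[leLHS]expr1 ler_weXn2l// ltW.
have gc : cvgn (series (geometric M (2^-1 : R))).
  apply: is_cvg_geometric_series.
  by rewrite ger0_norm ?invr_ge0// invf_lt1// ltr1n.
(* Real and imaginary parts are treated alike: their increments are dominated by a geometric series
   and telescope. *)
have cv (F : R[i] -> R) : (forall y z, F (y - z) = F y - F z) ->
    (forall z, `|F z| <= normc z) -> cvgn (fun n => F (u n x)).
  move=> FB Fn.
  have : cvgn (series (fun n => F (u n.+1 x) - F (u n x))).
    apply: normed_cvg; apply: series_le_cvg gc => // n.
    - by rewrite /= normr_ge0.
    - by rewrite /geometric /= mulr_ge0// exprn_ge0// invr_ge0.
    - by rewrite /geometric /= -FB (le_trans (Fn _)).
  rewrite (_ : series _ = series (telescope (fun n => F (u n x))))// telescopeK => h.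
  have /cvg_ex[l hl] := h; apply/cvg_ex; exists (l + F (u 0%N x)).
  have c : (fun n => (F (u n x) - F (u 0%N x)) + F (u 0%N x)) @ \oo --> l + F (u 0%N x).
    by apply: cvgD => //; exact: cvg_cst.
  by rewrite (_ : (fun n => _) = (fun n => (F (u n x) - F (u 0%N x)) + F (u 0%N x)))//;
    apply/funext => n; rewrite subrK.
have /cvg_ex[a ca] := cv (@Re R) (@ReB R) (@normc_Re R).
have /cvg_ex[b cb] := cv (@Im R) (@ImB R) (@normc_Im R).
by exists (a +i* b); exact: ccvg_ReIm.
Qed.

End cLnorm_theory.

(** * Extension of a bounded operator by density *)

Section extension_by_density.
Context d (T : measurableType d) (R : realType).
Variable mu : {measure set T -> \bar R}.
Variable k : nat.
Hypothesis k0 : (0 < k)%N.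

Local Notation N f := (cLnorm mu k%:R f).
Local Notation Lp := (cLp mu k%:R).

Variables (test : set (T -> R[i])) (L0 : (T -> R[i]) -> T -> R[i]) (B : R).
Hypothesis test_add : forall (c : R[i]) f g, test f -> test g ->
  test (fun x => c * f x + g x).
Hypothesis test_Lp : forall f, test f -> Lp f.
Hypothesis test_dense : forall f, Lp f -> forall e : R, 0 < e ->
  exists2 g, test g & (N (fun x => f x - g x)%R <= e%:E)%E.
Hypothesis L0_measurable : forall f, test f -> cmeasurable (L0 f).
Hypothesis L0_add : forall (c : R[i]) f g, test f -> test g ->
  forall x, L0 (fun t => c * f t + g t) x = c * L0 f x + L0 g x.
Hypothesis B0 : 0 <= B.
Hypothesis L0_bound : forall f, test f -> (N (L0 f) <= B%:E * N f)%E.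

Let cLnorm_triangle f g (a b : R) : cmeasurable f -> cmeasurable g ->
  (N f <= a%:E)%E -> (N g <= b%:E)%E ->
  (N (fun x => f x + g x)%R <= (a + b)%:E)%E.
Proof.
by move=> mf mg fa gb; rewrite (le_trans (cLnormD mu k0 mf mg))// EFinD leeD.
Qed.

Let test_sub f g : test f -> test g -> test (fun x => g x - f x).
Proof.
move=> tf tg; rewrite (_ : (fun x => _) = (fun x => -1 * f x + g x)).
  exact: test_add.
by apply/funext => x; rewrite mulN1r addrC.
Qed.

Let L0_sub f g x : test f -> test g ->
  L0 (fun t => g t - f t) x = L0 g x - L0 f x.
Proof.
move=> tf tg; rewrite (_ : (fun x => _) = (fun x => -1 * f x + g x)).
  by rewrite L0_add// mulN1r addrC.
by apply/funext => y; rewrite mulN1r addrC.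
Qed.

Let L0_lip f g (c : R) : 0 <= c -> test f -> test g ->
  (N (fun x => g x - f x)%R <= c%:E)%E ->
  (N (fun x => L0 g x - L0 f x)%R <= (B * c)%:E)%E.
Proof.
move=> c0 tf tg h; rewrite (_ : (fun x => _) = L0 (fun t => g t - f t)); last first.
  by apply/funext => x; rewrite L0_sub.
by rewrite (le_trans (L0_bound (test_sub tf tg)))// EFinM lee_wpmul2l ?lee_fin.
Qed.

(** Approximation within [err n] makes the images of consecutive approximants differ by at most
    [4 ^- n], the rate required by [cLnorm_fast_cauchy]. The denominator has [B + 1] because [B] may
    be 0. *)
Let err (n : nat) : R := 4 ^- n / (2 * (B + 1)).

Let B1 : 0 < B + 1. Proof. by rewrite ltr_wpDl. Qed.

Let err_gt0 n : 0 < err n.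
Proof. by rewrite divr_gt0 ?mulr_gt0// invr_gt0 exprn_gt0. Qed.

Let err_le m n : err (n + m)%N <= err m.
Proof.
rewrite /err ler_pM2r ?invr_gt0 ?mulr_gt0//.
rewrite lef_pV2 ?posrE ?exprn_gt0// exprD ler_peMl ?exprn_ge0//.
by rewrite exprn_ege1// ler1n.
Qed.

Let errB n : B * (err n + err n) <= 4 ^- n.
Proof.
rewrite /err -mulr2n -[_ *+ 2]mulr_natl mulrA mulrC.
have -> : 4 ^- n / (2 * (B + 1)) * (B * 2) = 4 ^- n * (B / (B + 1)).
  by move: (4 ^- n) => q; field; rewrite gt_eqF.
rewrite ler_piMr ?invr_ge0 ?exprn_ge0// ler_pdivrMr// mul1r.
by rewrite lerDl.
Qed.

Let err_small (e : R) : 0 < e -> exists m, err m <= e.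
Proof.
move=> e0; have h : (fun n => 4^-1 ^+ n) @ \oo --> (0 : R).
  by apply: cvg_expr; rewrite ger0_norm ?invr_ge0// invf_lt1// ltr1n.
have /cvgrPdist_lt/(_ _ e0)[m _ /(_ m (leqnn m))] := h.
rewrite sub0r normrN ger0_norm ?exprn_ge0 ?invr_ge0// => hm.
exists m; rewrite /err -exprVn (le_trans _ (ltW hm))// ler_piMr ?exprn_ge0 ?invr_ge0//.
rewrite invf_le1 ?mulr_gt0//; have := B0; lra.
Qed.

Let approximants : exists u : (T -> R[i]) -> nat -> T -> R[i], forall f, Lp f ->
  forall n, test (u f n) /\ (N (fun x => f x - u f n x)%R <= (err n)%:E)%E.
Proof.
have /choice[u uP] : forall f, exists u : nat -> T -> R[i], Lp f ->
    forall n, test (u n) /\ (N (fun x => f x - u n x)%R <= (err n)%:E)%E.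
  move=> f; have [Lf|nLf] := pselect (Lp f); last by exists (fun _ _ => 0) => /nLf.
  have : forall n, exists g, test g /\ (N (fun x => f x - g x)%R <= (err n)%:E)%E.
    by move=> n; have [g tg gn] := test_dense Lf (err_gt0 n); exists g.
  by move=> /choice[u uP]; exists u => _ n; exact: uP.
by exists u.
Qed.

Lemma exists_bounded_extension :
  exists2 L, bounded_extension mu k%:R test L0 L & (Lp_opnorm mu k%:R L <= B%:E)%E.
Proof.
have [u uP] := approximants.
(* Upper limits exist everywhere and are measurable; almost everywhere they are the true limits, by
   [cLnorm_fast_cauchy]. *)
pose L f x : R[i] :=
  fine (limn_esup (fun n => (Re (L0 (u f n) x))%:E)) +i*
  fine (limn_esup (fun n => (Im (L0 (u f n) x))%:E)).
have mL f : Lp f -> cmeasurable (L f).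
  move=> Lf; split => /=; apply: measurableT_comp; try exact: fine_measurable.
  - apply: measurable_fun_limn_esup => n; apply/measurable_EFinP.
    by have [tn _] := uP _ Lf n; have [] := L0_measurable tn.
  - apply: measurable_fun_limn_esup => n; apply/measurable_EFinP.
    by have [tn _] := uP _ Lf n; have [] := L0_measurable tn.
have cL f : Lp f -> {ae mu, forall x, ccvg (fun n => L0 (u f n) x) (L f x)}.
  move=> Lf.
  have := @cLnorm_fast_cauchy _ T R mu k k0 (fun n => L0 (u f n))
    (fun n => L0_measurable (uP _ Lf n).1).
  have fast n : (N (fun x => L0 (u f n.+1) x - L0 (u f n) x)%R <= (4 ^- n)%:E)%E.
    have [tn en] := uP _ Lf n; have [tn1 en1] := uP _ Lf n.+1.
    have [mf _] := Lf; have [mn _] := test_Lp tn; have [mn1 _] := test_Lp tn1.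
    apply: (@le_trans _ _ (B * (err n + err n))%:E); last by rewrite lee_fin errB.
    apply: L0_lip => //; first by rewrite addr_ge0// ltW.
    rewrite (_ : (fun x => _) = (fun x => (f x - u f n x) + - (f x - u f n.+1 x))).
      apply: cLnorm_triangle => //.
      - exact: cmeasurableB.
      - by apply: cmeasurableN; exact: cmeasurableB.
      - rewrite cLnormN//; last exact: cmeasurableB.
        by rewrite (le_trans en1)// lee_fin -(addn1 n) addnC err_le.
    by apply/funext => x; ring.
  move=> /(_ fast); apply: filterS => x [l cl].
  suff -> : L f x = l by [].
  apply: complexP => /=.
  - have /cvg_limn_einf_sup[_ ->] : (fun n => (Re (L0 (u f n) x))%:E) @ \oo --> (Re l)%:E.
      by apply: cvg_EFin; [exact: nearW|exact: ccvg_Re cl].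
    by [].
  - have /cvg_limn_einf_sup[_ ->] : (fun n => (Im (L0 (u f n) x))%:E) @ \oo --> (Im l)%:E.
      by apply: cvg_EFin; [exact: nearW|exact: ccvg_Im cl].
    by [].
(* The estimate from which the rest follows: [L] stays within [B * c] of [L0] at test functions that
   are within [c]. The bound on [L], its linearity and its agreement with [L0] all come from
   comparison with test functions. *)
have key f g (c : R) : 0 <= c -> Lp f -> test g ->
    (N (fun x => f x - g x)%R <= c%:E)%E ->
    (N (fun x => L f x - L0 g x)%R <= (B * c)%:E)%E.
  move=> c0 Lf tg fg; apply/lee_addgt0Pr => e e0.
  have e1 : 0 < e / (B + 1) by rewrite divr_gt0.
  (* Dropping the first [m] approximants makes their own error negligible against [e]. *)
  have [m em] := err_small e1.
  have [mf _] := Lf; have [mg _] := test_Lp tg.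
  rewrite -EFinD; apply: (@cLnorm_fatou _ T R mu k k0
     (fun n x => L0 (u f (n + m)%N) x - L0 g x)).
  - by rewrite addr_ge0 ?mulr_ge0// ltW.
  - move=> n; have [tn _] := uP _ Lf (n + m)%N.
    by apply: cmeasurableB; exact: L0_measurable.
  - by apply: cmeasurableB; [exact: mL|exact: L0_measurable].
  - apply: filterS (cL _ Lf) => x cx; rewrite /ccvg.
    rewrite (_ : (fun n => _) = (fun n => normc (L0 (u f (n + m)%N) x - L f x))).
      by rewrite (cvg_shiftn m (fun n => normc (L0 (u f n) x - L f x))).
    by apply/funext => n; congr normc; ring.
  - move=> n; have [tn en] := uP _ Lf (n + m)%N; have [mn _] := test_Lp tn.
    apply: (@le_trans _ _ (B * (c + err m))%:E); last first.
      rewrite lee_fin mulrDr lerD2l (le_trans (ler_wpM2l B0 em))//.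
      by rewrite mulrCA ler_piMr ?(ltW e0)// ler_pdivrMr// mul1r lerDl.
    apply: L0_lip => //; first by rewrite addr_ge0// ltW.
    rewrite (_ : (fun x => _) = (fun x => (f x - g x) + - (f x - u f (n + m)%N x))).
      apply: cLnorm_triangle => //.
      - exact: cmeasurableB.
      - by apply: cmeasurableN; exact: cmeasurableB.
      - rewrite cLnormN//; last exact: cmeasurableB.
        by rewrite (le_trans en)// lee_fin err_le.
    by apply/funext => x; ring.
have bound f : Lp f -> (N (L f) <= B%:E * N f)%E.
  move=> Lf; have [mf fo] := Lf.
  have ffin : N f \is a fin_num by rewrite ge0_fin_numE// cLnorm_ge0.
  rewrite -(fineK ffin) -EFinM; apply/lee_addgt0Pr => e e0; rewrite -EFinD.
  have e1 : 0 < e / (2 * (B + 1)) by rewrite divr_gt0// mulr_gt0.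
  have [g tg fg] := test_dense Lf e1; have [mg _] := test_Lp tg.
  set h := e / _ in e1 fg.
  have Ng : (N g <= (fine (N f) + h)%:E)%E.
    rewrite (_ : g = (fun x => f x + - (f x - g x))); last by apply/funext => x; ring.
    apply: cLnorm_triangle => //.
    - by apply: cmeasurableN; exact: cmeasurableB.
    - by rewrite fineK.
    - by rewrite cLnormN//; exact: cmeasurableB.
  have Lg : (N (L0 g) <= (B * (fine (N f) + h))%:E)%E.
    by rewrite (le_trans (L0_bound tg))// EFinM lee_wpmul2l// lee_fin.
  apply: (@le_trans _ _ (B * h + B * (fine (N f) + h))%:E); last first.
    rewrite lee_fin mulrDr addrCA lerD2l -mulrDr.
    have -> : h + h = e / (B + 1) by rewrite /h; field; rewrite gt_eqF.
    by rewrite mulrCA ler_piMr ?(ltW e0)// ler_pdivrMr// mul1r lerDl.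
  rewrite [X in cLnorm _ _ X](_ : _ = (fun x => (L f x - L0 g x) + L0 g x)); last first.
    by apply/funext => x; rewrite subrK.
  apply: cLnorm_triangle => //.
  - by apply: cmeasurableB; [exact: mL|exact: L0_measurable].
  - exact: L0_measurable.
  - by apply: key => //; exact: ltW.
have opb : (Lp_opnorm mu k%:R L <= B%:E)%E.
  apply: ge_ereal_sup => _ [f [Lf f1] <-].
  by rewrite (le_trans (bound _ Lf))// -[leRHS]mule1 lee_wpmul2l// lee_fin.
exists L => //; split => //.
- move=> f Lf; split; first exact: mL.
  by rewrite (le_lt_trans (bound _ Lf))// lte_mul_pinfty ?lee_fin//; have [] := Lf.
- move=> c f g Lf Lg.
  have Lh := cLp_add k0 c Lf Lg; have [mf _] := Lf; have [mg _] := Lg.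
  have [mh _] := Lh.
  (* The defect of linearity. Each of its three terms is close to its value at a test function,
     where [L0] is linear, so its norm is 0. *)
  pose D x := L (fun t => c * f t + g t) x - (c * L f x + L g x).
  have mcL : cmeasurable (fun x => c * L f x).
    by apply: cmeasurableM; [exact: cmeasurable_cst|exact: mL].
  have mD : cmeasurable D.
    by apply: cmeasurableB; [exact: mL|apply: cmeasurableD => //; exact: mL].
  suff D0 : N D = 0%E.
    apply: filterS (cLnorm_eq0 k0 mD D0) => x /eqP.
    by rewrite subr_eq0 => /eqP.
  apply/eqP; rewrite eq_le cLnorm_ge0// andbT; apply/lee_addgt0Pr => e e0.
  rewrite add0e; have nc := normc_ge0 c.
  (* The total error will be 2 B h (|c| + 1), which this choice of [h] turns into e B / (B + 1). *)
  have K0 : 0 < (2 * (B + 1)) * (normc c + 1) by rewrite !mulr_gt0// ltr_wpDl.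
  pose h := e / ((2 * (B + 1)) * (normc c + 1)).
  have h0 : 0 < h by rewrite divr_gt0.
  have [f' tf' ff'] := test_dense Lf h0; have [g' tg' gg'] := test_dense Lg h0.
  have [mf' _] := test_Lp tf'; have [mg' _] := test_Lp tg'.
  have th' := test_add c tf' tg'.
  have mcd : cmeasurable (fun x => c * (f x - f' x)).
    by apply: cmeasurableM; [exact: cmeasurable_cst|exact: cmeasurableB].
  have hh' : (N (fun x => (c * f x + g x) - (c * f' x + g' x))%R <=
      (normc c * h + h)%:E)%E.
    rewrite (_ : (fun x => _) = (fun x => c * (f x - f' x) + (g x - g' x))); last first.
      by apply/funext => x; ring.
    apply: cLnorm_triangle => //; first exact: cmeasurableB.
    rewrite cLnormZ//; last exact: cmeasurableB.
    by rewrite EFinM lee_wpmul2l ?lee_fin.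
  have hle := ltW h0.
  have q0 : 0 <= normc c * h + h by exact: (addr_ge0 (mulr_ge0 nc hle) hle).
  have k1 := key _ _ _ q0 Lh th' hh'.
  have k2 := key _ _ _ (ltW h0) Lf tf' ff'.
  have k3 := key _ _ _ (ltW h0) Lg tg' gg'.
  have mLf := cmeasurableB (mL _ Lf) (L0_measurable tf').
  have mLg := cmeasurableB (mL _ Lg) (L0_measurable tg').
  have mcLf : cmeasurable (fun x => - c * (L f x - L0 f' x)).
    by apply: cmeasurableM => //; exact: cmeasurable_cst.
  rewrite (_ : D = (fun x => (L (fun t => c * f t + g t) x -
       L0 (fun t => c * f' t + g' t) x) + (- c * (L f x - L0 f' x) +
       - (L g x - L0 g' x)))); last first.
    by apply/funext => x; rewrite L0_add// /D; ring.
  apply: (@le_trans _ _ (B * (normc c * h + h) + (normc c * (B * h) + B * h))%:E).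
    apply: cLnorm_triangle => //.
    + by apply: cmeasurableB; [exact: mL|exact: L0_measurable].
    + by apply: cmeasurableD => //; exact: cmeasurableN.
    + apply: cLnorm_triangle => //; first exact: cmeasurableN.
        by rewrite cLnormZ// normcN EFinM lee_wpmul2l ?lee_fin.
      by rewrite cLnormN.
  rewrite lee_fin.
  have -> : B * (normc c * h + h) + (normc c * (B * h) + B * h) = e * (B / (B + 1)).
    by rewrite /h; field; rewrite !gt_eqF// ltr_wpDl.
  by rewrite ler_piMr ?(ltW e0)// ler_pdivrMr// mul1r lerDl.
- by rewrite (le_lt_trans opb)// ltry.
- move=> f tf; have Lf := test_Lp tf; have [mf _] := Lf.
  have mD : cmeasurable (fun x => L f x - L0 f x).
    by apply: cmeasurableB; [exact: mL|exact: L0_measurable].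
  have D0 : N (fun x => L f x - L0 f x) = 0%E.
    apply/eqP; rewrite eq_le cLnorm_ge0// andbT.
    rewrite -[0%E]/(0%:E) -(mulr0 B); apply: key => //.
    under [X in cLnorm _ _ X]eq_fun do rewrite subrr.
    by rewrite cLnorm0.
  by apply: filterS (cLnorm_eq0 k0 mD D0) => x /eqP; rewrite subr_eq0 => /eqP.
Qed.

End extension_by_density.

(** * Multiplier norms and Fourier inversion *)

Section multiplier_operators.
Context d (T : measurableType d) (R : realType).
Variable mu : {sigma_finite_measure set T -> \bar R}.
Variable dot : T -> T -> R.
Hypothesis mdot : measurable_fun setT (fun z : T * T => dot z.1 z.2).
Implicit Types (f g m : T -> R[i]).

Let mdot1 x : measurable_fun setT (fun y => dot x y).
Proof. exact: (measurable_fun_pair2 x mdot). Qed.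

Let mdot2 y : measurable_fun setT (fun x => dot x y).
Proof. exact: (measurable_fun_pair1 y mdot). Qed.

Lemma cmeasurable_fourier f : cmeasurable f -> cmeasurable (fourier mu dot f).
Proof.
move=> mf; apply: (cmeasurable_cintegral_prod mu
  (F := fun z : T * T => cis (- (2 * pi * dot z.2 z.1)) * f z.2)).
apply: cmeasurableM; last exact: (cmeasurable_comp mf measurable_snd).
apply: cmeasurable_cis; apply: measurableT_comp => //.
apply: measurable_funM => //.
exact: (measurableT_comp mdot (measurable_fun_pair measurable_snd measurable_fst)).
Qed.

Lemma cintegrable_fourier_kernel f y : cintegrable mu f ->
  cintegrable mu (fun x => cis (- (2 * pi * dot x y)) * f x).
Proof.
move=> fi; apply: cintegrable_cis => //; apply: measurableT_comp => //.
exact: measurable_funM.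
Qed.

Lemma normc_fourier_le f y : cintegrable mu f ->
  normc (fourier mu dot f y) <= Rintegral mu setT (fun x => normc (f x)).
Proof.
move=> fi; apply: normc_cintegral_le; last exact: cintegrable_normc.
- exact: cintegrable_fourier_kernel.
- by move=> x; rewrite normcM normc_cis mul1r.
Qed.

Lemma fourier_add (c : R[i]) f g y : cintegrable mu f -> cintegrable mu g ->
  fourier mu dot (fun t => c * f t + g t) y =
  c * fourier mu dot f y + fourier mu dot g y.
Proof.
move=> fi gi; rewrite /fourier -cintegralZ; last exact: cintegrable_fourier_kernel.
rewrite -cintegralD; last 2 first.
- by apply: cintegrableZ; exact: cintegrable_fourier_kernel.
- exact: cintegrable_fourier_kernel.
by apply: eq_cintegral => x; ring.
Qed.

Lemma multiplier_opE m f x : multiplier_op mu dot m f x =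
  cintegral mu (fun y => cis (2 * pi * dot x y) * (m y * fourier mu dot f y)).
Proof. by apply: eq_cintegral => y; rewrite mulrA. Qed.

(** Absolute convergence of the integral that defines the multiplier operator at [f]. *)
Definition admissible m f := cintegrable mu (fun y => m y * fourier mu dot f y).

Lemma cintegrable_multiplier_kernel m f x : admissible m f ->
  cintegrable mu (fun y => cis (2 * pi * dot x y) * (m y * fourier mu dot f y)).
Proof. by move=> mfi; apply: cintegrable_cis => //; exact: measurable_funM. Qed.

Lemma multiplier_op_add m (c : R[i]) f g x :
  cintegrable mu f -> cintegrable mu g -> admissible m f -> admissible m g ->
  multiplier_op mu dot m (fun t => c * f t + g t) x =
  c * multiplier_op mu dot m f x + multiplier_op mu dot m g x.
Proof.
move=> fi gi mf mg; rewrite !multiplier_opE -cintegralZ; last first.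
  exact: cintegrable_multiplier_kernel.
rewrite -cintegralD; last 2 first.
- by apply: cintegrableZ; exact: cintegrable_multiplier_kernel.
- exact: cintegrable_multiplier_kernel.
by apply: eq_cintegral => y; rewrite fourier_add//; ring.
Qed.

Lemma cmeasurable_multiplier_op m f : cmeasurable m -> cmeasurable f ->
  cmeasurable (multiplier_op mu dot m f).
Proof.
move=> mm mf; apply: (cmeasurable_cintegral_prod mu
  (F := fun z : T * T => cis (2 * pi * dot z.1 z.2) * m z.2 * fourier mu dot f z.2)).
apply: cmeasurableM; last first.
  exact: (cmeasurable_comp (cmeasurable_fourier mf) measurable_snd).
apply: cmeasurableM; last exact: (cmeasurable_comp mm measurable_snd).
by apply: cmeasurable_cis; exact: measurable_funM.
Qed.

Section norm.
Variables (k : nat) (test : set (T -> R[i])).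
Hypothesis k0 : (0 < k)%N.
Hypothesis test_Lp : forall f, test f -> cLp mu k%:R f.

Local Notation N f := (cLnorm mu k%:R f).

(** The norm is an infimum over bounded extensions, and the extension by density is one whose norm
    is at most [B]. *)
Lemma multiplier_norm_le m (B : R) :
  (forall (c : R[i]) f g, test f -> test g -> test (fun x => c * f x + g x)) ->
  (forall f, cLp mu k%:R f -> forall e : R, 0 < e ->
     exists2 g, test g & (N (fun x => f x - g x)%R <= e%:E)%E) ->
  (forall f, test f -> cintegrable mu f) ->
  cmeasurable m -> (forall f, test f -> admissible m f) -> 0 <= B ->
  (forall f, test f -> (N (multiplier_op mu dot m f) <= B%:E * N f)%E) ->
  (multiplier_norm mu dot test k%:R m <= B%:E)%E.
Proof.
move=> tadd tdense tint mm adm B0 bound.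
have [L Lext LB] := exists_bounded_extension k0 tadd test_Lp tdense
  (fun f tf => cmeasurable_multiplier_op mm (test_Lp tf).1)
  (fun c f g tf tg x => multiplier_op_add c x (tint _ tf) (tint _ tg) (adm _ tf) (adm _ tg))
  B0 bound.
by apply: le_trans LB; apply: ereal_inf_lbound; exists L.
Qed.

Lemma cLnorm_le_opnorm L f (B : R) : Lp_linear mu k%:R L ->
  (forall f, cLp mu k%:R f -> cLp mu k%:R (L f)) ->
  (Lp_opnorm mu k%:R L <= B%:E)%E -> cLp mu k%:R f -> (N (L f) <= B%:E * N f)%E.
Proof.
move=> Llin LLp LB Lf; have [mf fo] := Lf.
have L0p : cLp mu k%:R (fun=> 0 : R[i]).
  by split; [exact: cmeasurable_cst|rewrite cLnorm0].
(* Linearity holds only almost everywhere, so even this has to be derived, from L 0 = L 0 + L 0. *)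
have L00 : {ae mu, forall x, L (fun=> 0) x = 0}.
  apply: filterS (Llin 1 _ _ L0p L0p) => x.
  rewrite (_ : (fun t => _) = fun=> 0); last by apply/funext => t; rewrite mulr0 addr0.
  by rewrite mul1r => /eqP; rewrite -subr_eq subrr eq_sym => /eqP.
have B0 : 0 <= B.
  rewrite -lee_fin; apply: le_trans LB; apply: (le_trans (cLnorm_ge0 mu k (L (fun=> 0)))).
  by apply: ereal_sup_ubound; exists (fun=> 0) => //; split => //; rewrite cLnorm0.
have ffin : N f \is a fin_num by rewrite ge0_fin_numE// cLnorm_ge0.
have a0 : 0 <= fine (N f) by rewrite fine_ge0// cLnorm_ge0.
(* The operator norm only sees the unit ball. Dividing [f] by slightly more than its norm covers the
   functions of norm 0 as well. *)
have step (e : R) : 0 < e -> (N (L f) <= (B * (fine (N f) + e))%:E)%E.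
  move=> e0; have b0 : 0 < fine (N f) + e by rewrite ltr_wpDl.
  pose c : R[i] := ((fine (N f) + e)^-1)%:C.
  have nc : normc c = (fine (N f) + e)^-1 by rewrite normc_real gtr0_norm// invr_gt0.
  pose g t := c * f t + 0.
  have gE : g = (fun t => c * f t) by apply/funext => t; rewrite /g addr0.
  have Lg : cLp mu k%:R g by exact: (cLp_add k0 c Lf L0p).
  have g1 : (N g <= 1)%E.
    rewrite gE cLnormZ// -(fineK ffin) nc -EFinM lee_fin.
    by rewrite mulrC ler_pdivrMr// mul1r lerDl ltW.
  have LgB : (N (L g) <= B%:E)%E.
    by apply: le_trans LB; apply: ereal_sup_ubound; exists g.
  have mLf : cmeasurable (L f) by have [] := LLp _ Lf.
  have E : N (L g) = ((normc c)%:E * N (L f))%E.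
    rewrite -cLnormZ//; apply: ae_eq_cLnorm => //.
    - by have [] := LLp _ Lg.
    - by apply: cmeasurableM => //; exact: cmeasurable_cst.
    - apply: filterS2 L00 (Llin c _ _ Lf L0p) => x h1 h2.
      by rewrite /g h2 h1 addr0.
  have LLfin : N (L f) \is a fin_num.
    by rewrite ge0_fin_numE ?cLnorm_ge0//; have [] := LLp _ Lf.
  move: LgB; rewrite E -(fineK LLfin) -EFinM !lee_fin nc mulrC.
  by rewrite ler_pdivrMr.
rewrite -(fineK ffin) -EFinM; apply/lee_addgt0Pr => e e0; rewrite -EFinD.
have B1 : 0 < B + 1 by rewrite ltr_wpDl.
have e1 : 0 < e / (B + 1) by rewrite divr_gt0.
apply: le_trans (step _ e1) _; rewrite lee_fin mulrDr lerD2l.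
by rewrite mulrCA ler_piMr ?(ltW e0)// ler_pdivrMr// mul1r lerDl.
Qed.

(** The strict inequality extracts from the infimum an actual extension of norm below [B]; on test
    functions it agrees almost everywhere with the operator. *)
Lemma multiplier_norm_ge m f (B : R) : cmeasurable m -> test f ->
  (multiplier_norm mu dot test k%:R m < B%:E)%E ->
  (N (multiplier_op mu dot m f) <= B%:E * N f)%E.
Proof.
move=> mm tf /ereal_inf_lt[_ [L [LLp Llin Loo LT]] <-] LB.
have Lf := test_Lp tf.
have <- : N (L f) = N (multiplier_op mu dot m f).
  apply: ae_eq_cLnorm; last exact: LT.
  - by have [] := LLp _ Lf.
  - exact: (cmeasurable_multiplier_op mm Lf.1).
exact: (cLnorm_le_opnorm Llin LLp (ltW LB) Lf).
Qed.

Lemma multiplier_norm_ge0 m : (0 <= multiplier_norm mu dot test k%:R m)%E.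
Proof.
apply: le_ereal_inf_tmp => _ [L [LLp Llin Loo LT] <-].
have L0p : cLp mu k%:R (fun=> 0 : R[i]).
  by split; [exact: cmeasurable_cst|rewrite cLnorm0].
apply: (le_trans (cLnorm_ge0 mu k (L (fun=> 0)))).
by apply: ereal_sup_ubound; exists (fun=> 0) => //; split => //; rewrite cLnorm0.
Qed.

End norm.

End multiplier_operators.

Section inversion.
Variable R : realType.
Local Notation mu := (@lebesgue_measure R).
Variable f : R -> R[i].
Variable K : R.
Hypotheses (fi : cintegrable mu f) (fK : forall x, normc (f x) <= K).
Hypothesis fc : forall (x : R) (h : nat -> R), h @ \oo --> (0 : R) ->
  ccvg (fun n => f (x + h n)) (f x).
Let fhat := fourier mu (fun x y : R => x * y) f.
Hypothesis fhati : cintegrable mu fhat.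

(** Damping turns the inverse transform into a mean of [f] against the Poisson kernel centred at
    [x]. Substituting u = x - e v freezes the kernel at [poisson 1], and dominated convergence then
    uses only the boundedness and the continuity of [f]. *)
Lemma fourier_inversion x :
  cintegral mu (fun y => cis (2 * pi * (x * y)) * fhat y) = f x.
Proof.
have mf := cintegrable_cmeasurable fi.
pose F y := cis (2 * pi * (x * y)) * fhat y.
have Fi : cintegrable mu F.
  by apply: cintegrable_cis => //; apply: measurable_funM => //; exact: measurable_funM.
apply: (ccvg_unique (cvg_damping_cintegral Fi)).
have FE y : F y = cintegral mu (fun u => cis (2 * pi * (y * (x - u))) * f u).
  rewrite /F /fhat /fourier -cintegralZ; last first.
    apply: cintegrable_cis => //; apply: measurableT_comp => //.
    by apply: measurable_funM => //; exact: measurable_funM.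
  by apply: eq_cintegral => u; rewrite cis_mulD !mulrN (mulrC y x) (mulrC y u) mulrA.
have msub : measurable_fun setT (fun u : R => x - u) by exact: measurable_funB.
pose e n : R := harmonic n.
have e0 n : 0 < e n by exact: harmonic_gt0'.
have P1E (n : nat) v : poisson (e n) (e n * v) = (e n)^-1 * poisson 1 v.
  have d0 := poisson_den_gt0 v (ltr01 : 0 < (1 : R)).
  have d1 := poisson_den_gt0 (e n * v) (e0 n); rewrite expr1n in d0.
  rewrite /poisson; move: pi (e n) (e0 n) d0 d1 => q a a0 d0 d1; field.
  by rewrite ?(gt_eqF a0) ?(gt_eqF d0) ?(gt_eqF d1).
have E (n : nat) : cintegral mu (fun y => (damping (e n) y)%:C * F y) =
    cintegral mu (fun v => (poisson 1 v)%:C * f (x + - (e n * v))).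
  under eq_cintegral do rewrite FE.
  rewrite (damping_pairing fi msub (e0 n)).
  have ne0 : - e n != 0 by rewrite oppr_eq0 gt_eqF.
  have gi : cintegrable mu (fun u => (poisson (e n) (x - u))%:C * f u).
    apply: (cintegrable_bounded (K := 2 / e n) fi).
      by apply: cmeasurable_real; exact: measurable_poisson_comp.
    by move=> u; rewrite normc_real ger0_norm ?poisson_ge0// poisson_bound.
  have [_ h] := scales_cintegral (scales_affine x ne0) gi.
  have c0 : ((e n)^-1)%:C != 0 :> R[i].
    by apply/eqP => /(congr1 (@Re R)) /= /eqP; rewrite gt_eqF// invr_gt0.
  apply: (mulfI c0); rewrite normrN gtr0_norm// in h.
  rewrite -h -cintegralZ.
    apply: eq_cintegral => v; rewrite (_ : x - (- e n * v + x) = e n * v); last by ring.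
    by rewrite P1E rmorphM /= mulrA mulNr addrC.
  have := (scales_cintegral (scales_affine x ne0) gi).1 => hi.
  rewrite (_ : (fun v => _) = (fun v => (e n)%:C * ((poisson (e n) (x - (- e n * v + x)))%:C * f
    (- e n * v + x)))).
    exact: cintegrableZ.
  apply/funext => v; rewrite (_ : x - (- e n * v + x) = e n * v); last by ring.
  have -> : (poisson 1 v)%:C = (e n)%:C * (poisson (e n) (e n * v))%:C :> R[i].
    by rewrite P1E -rmorphM /= mulrA mulfV ?gt_eqF// mul1r.
  by rewrite -mulrA mulNr [- _ + x]addrC.
rewrite (_ : (fun n => _) = (fun n =>
  cintegral mu (fun v => (poisson 1 v)%:C * f (x + - (e n * v))))); last first.
  by apply/funext => n; exact: E.
have -> : f x = cintegral mu (fun v => f x * (poisson 1 v)%:C).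
  rewrite cintegralZ ?cintegral_real; last first.
    by apply: cintegrable_real; exact: integrable_poisson.
  by rewrite /Rintegral integral_poisson//= mulr1.
have K0 : 0 <= K by rewrite (le_trans (normc_ge0 (f x))).
apply: (@cintegral_dct _ (measurableTypeR R) R mu _ _ (fun v => K * poisson 1 v)).
- move=> n; apply: cmeasurableM.
    by apply: cmeasurable_real; exact: measurable_poisson.
  apply: (cmeasurable_comp mf); apply: measurable_funD => //.
  by apply: measurableT_comp => //; exact: measurable_funM.
- apply: cmeasurableM; first exact: cmeasurable_cst.
  by apply: cmeasurable_real; exact: measurable_poisson.
- apply: nearW => v; rewrite [X in ccvg _ X]mulrC; apply: ccvgM; first exact: ccvg_cst.
  apply: fc; rewrite -[X in _ --> X]oppr0; apply: cvgN.
  by rewrite -[X in _ --> X](mul0r v); apply: cvgM; [exact: cvg_harmonic|exact: cvg_cst].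
- by under eq_fun do rewrite EFinM; apply: integrableZl => //; exact: integrable_poisson.
- move=> n v; rewrite normcM normc_real ger0_norm ?poisson_ge0// mulrC.
  by rewrite ler_wpM2r ?poisson_ge0.
- move=> v; rewrite normcM normc_real ger0_norm ?poisson_ge0//.
  by rewrite ler_wpM2r ?poisson_ge0.
Qed.

End inversion.

(** * Smooth functions *)

Section smooth_functions.
Context {R : realType}.
Implicit Types (V W : normedModType R).

(** Only stability under one derivation has to be checked: the iterated derivatives in [smooth] then
    remain in the class [C]. *)
Lemma smooth_ind V (C : set (V -> R)) :
  (forall f, C f -> forall x, differentiable f x) ->
  (forall f v, C f -> C (fun y => 'D_v f y)) ->
  forall f, C f -> smooth f.
Proof.
move=> Cdiff CD f Cf s; suff : C (foldr (fun v (g : V -> R) => fun y => 'D_v g y) f s).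
  by move=> /Cdiff.
by elim: s => [//|v s IH] /=; exact: CD.
Qed.

Lemma smooth_differentiable V (f : V -> R) x : smooth f -> differentiable f x.
Proof. by move=> /(_ [::] x). Qed.

Lemma smooth_continuous V (f : V -> R) : smooth f -> continuous f.
Proof. by move=> sf x; apply: differentiable_continuous; exact: smooth_differentiable. Qed.

Lemma smooth_derive V (f : V -> R) v : smooth f -> smooth (fun y => 'D_v f y).
Proof. by move=> sf s x; have := sf (rcons s v) x; rewrite foldr_rcons. Qed.

(** The algebra generated by [G]. By the Leibniz rule it is stable under derivation as soon as it
    contains the derivatives of its generators, so no formula for higher derivatives has to be
    written. *)
Inductive generated V (G : set (V -> R)) : (V -> R) -> Prop :=
| generated_gen g : G g -> generated G g
| generated_cst c : generated G (fun=> c)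
| generated_add f g : generated G f -> generated G g -> generated G (fun x => f x + g x)
| generated_mul f g : generated G f -> generated G g -> generated G (fun x => f x * g x).

Lemma generated_smooth V (G : set (V -> R)) :
  (forall g x, G g -> differentiable g x) ->
  (forall g v, G g -> generated G (fun y => 'D_v g y)) ->
  forall f, generated G f -> smooth f.
Proof.
move=> Gdiff GD.
have Cd f : generated G f -> forall x, differentiable f x.
  elim=> [g Gg x|c x|{}f g _ IHf _ IHg x|{}f g _ IHf _ IHg x].
  - exact: Gdiff.
  - exact: differentiable_cst.
  - exact: differentiableD.
  - exact: differentiableM.
apply: smooth_ind => // f v.
elim=> [g Gg|c|{}f g Cf IHf Cg IHg|{}f g Cf IHf Cg IHg].
- exact: GD.
- rewrite (_ : 'D_v _ = fun=> 0); last by apply/funext => y; exact: (@derive_cst _ _ R^o).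
  exact: (@generated_cst V G 0).
- rewrite (_ : (fun y => _) = fun y => 'D_v f y + 'D_v g y); first exact: generated_add.
  by apply/funext => y; rewrite deriveD//; apply: diff_derivable; exact: Cd.
- rewrite (_ : (fun y => _) = fun y => f y * 'D_v g y + g y * 'D_v f y).
    by apply: generated_add; exact: generated_mul.
  by apply/funext => y; rewrite deriveM//; apply: diff_derivable; exact: Cd.
Qed.

Lemma smooth_generated V (f : V -> R) : generated (@smooth R V) f -> smooth f.
Proof.
apply: generated_smooth => [g x|g v sg]; first exact: smooth_differentiable.
by apply: generated_gen; exact: smooth_derive.
Qed.

Lemma smooth_cst V (c : R) : @smooth R V (fun=> c).
Proof. by apply: smooth_generated; exact: generated_cst. Qed.

Lemma smoothD V (f g : V -> R) : smooth f -> smooth g -> smooth (fun x => f x + g x).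
Proof. by move=> sf sg; apply: smooth_generated; apply: generated_add; exact: generated_gen. Qed.

Lemma smoothM V (f g : V -> R) : smooth f -> smooth g -> smooth (fun x => f x * g x).
Proof. by move=> sf sg; apply: smooth_generated; apply: generated_mul; exact: generated_gen. Qed.

Lemma smoothN V (f : V -> R) : smooth f -> smooth (fun x => - f x).
Proof.
move=> sf; rewrite (_ : (fun x => _) = fun x => (- 1) * f x).
  exact: smoothM (@smooth_cst V (-1)) sf.
by apply/funext => x; rewrite mulN1r.
Qed.

(** The differential of [phi] is the same at every point, so the functions [h \o phi] with [h]
    smooth form a class stable under derivation. *)
Lemma smooth_comp V W (phi : W -> V) (phi0 : W -> V) (f : V -> R) :
  (forall x, is_diff x phi phi0) -> smooth f -> smooth (fun x => f (phi x)).
Proof.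
move=> dphi sf; apply: (@smooth_ind W [set g | exists2 h, smooth h & g = h \o phi]).
- move=> g [h sh ->] x; apply: differentiable_comp; last exact: smooth_differentiable.
  by have := dphi x => -[].
- move=> g v [h sh ->]; exists (fun y => 'D_(phi0 v) h y); first exact: smooth_derive.
  apply/funext => y /=.
  have dh : differentiable h (phi y) by exact: smooth_differentiable.
  have dp : differentiable phi y by have := dphi y => -[].
  rewrite !deriveE//; last exact: differentiable_comp.
  rewrite diff_comp//= (_ : 'd phi y = phi0 :> (W -> V))//.
  by have := dphi y => -[].
- by exists f.
Qed.

Lemma is_diff_affine1 (a b x : R^o) :
  is_diff x (fun x : R^o => a * x + b : R^o) (fun x : R^o => a * x : R^o).
Proof.
have h := is_diffD (is_diff_scaler a x) (is_diff_cst (b : R^o) x).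
apply: (is_diff_eq h).
by apply/funext => y /=; rewrite addr0.
Qed.

Lemma is_diff_fst (x : R^o * R^o) : is_diff x (fun x : R^o * R^o => x.1 : R^o) (fun x : R^o * R^o
  => x.1 : R^o).
Proof.
split; first by apply: linear_differentiable => y; exact: cvg_fst.
by rewrite diff_lin// => y; exact: cvg_fst.
Qed.

Lemma is_diff_snd (x : R^o * R^o) : is_diff x (fun x : R^o * R^o => x.2 : R^o) (fun x : R^o * R^o
  => x.2 : R^o).
Proof.
split; first by apply: linear_differentiable => y; exact: cvg_snd.
by rewrite diff_lin// => y; exact: cvg_snd.
Qed.

Lemma is_diff_affine2 (a1 b1 a2 b2 : R) (x : R^o * R^o) :
  is_diff x (fun x : R^o * R^o => (a1 * x.1 + b1, a2 * x.2 + b2) : R^o * R^o)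
    (fun x : R^o * R^o => (a1 * x.1, a2 * x.2) : R^o * R^o).
Proof.
apply: is_diff_pair.
- exact: (@is_diff_comp _ _ _ _ _ _ _ _ _ (is_diff_fst x) (is_diff_affine1 a1 b1 x.1)).
- exact: (@is_diff_comp _ _ _ _ _ _ _ _ _ (is_diff_snd x) (is_diff_affine1 a2 b2 x.2)).
Qed.

Lemma derive1_scale (f : R^o -> R) v x : differentiable f x -> 'D_v f x = v * 'D_1 f x.
Proof.
move=> df; rewrite !deriveE// -[in LHS](mulr1 v).
by rewrite (_ : v * 1 = v *: (1 : R^o))// linearZ.
Qed.

Lemma differentiable_is_derive1 (f : R^o -> R) x (d : R) :
  is_derive x (1 : R^o) f d -> differentiable f x.
Proof. by move=> [df _]; exact/derivable1_diffP. Qed.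

Lemma generated_smooth1 (G : set (R^o -> R)) :
  (forall g, G g -> exists2 d, generated G d & forall x, is_derive x (1 : R^o) g (d x)) ->
  forall f, generated G f -> smooth f.
Proof.
move=> GD; apply: generated_smooth => [g x /GD[d _ gd]|g v /GD[d Gd gd]].
  exact: differentiable_is_derive1 (gd x).
rewrite (_ : (fun y => _) = fun y => v * d y).
  by apply: generated_mul => //; exact: generated_cst.
apply/funext => y; rewrite derive1_scale; last exact: differentiable_is_derive1 (gd y).
by have [_ ->] := gd y.
Qed.

Lemma smooth_cos_sin : smooth (cos : R^o -> R) /\ smooth (sin : R^o -> R).
Proof.
pose G : set (R^o -> R) := [set f | f = cos \/ f = sin].
have GD g : G g -> exists2 d, generated G d & forall x, is_derive x (1 : R^o) g (d x).
  case=> ->.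
  - exists (fun x => -1 * sin x).
      by apply: generated_mul; [exact: generated_cst|apply: generated_gen; right].
    by move=> x; rewrite mulN1r; exact: is_derive_cos.
  - by exists cos; [apply: generated_gen; left|exact: is_derive_sin].
by split; apply: (generated_smooth1 GD); apply: generated_gen; [left|right].
Qed.

(** The classical flat function is the case [k = 0]. The extra power of 1 / x makes the family
    stable under derivation, up to linear combinations. *)
Definition flat (k : nat) (x : R) : R := if 0 < x then x^-1 ^+ k * expR (- x^-1) else 0.

Lemma expRN_inv_le n (x : R) : 0 < x -> expR (- x^-1) <= (n.+1)`!%:R * x ^+ n.+1.
Proof.
move=> x0; have xV : 0 <= x^-1 by rewrite invr_ge0 ltW.
have h := expR_ge1Dxn n xV.
have fx : 0 < (n.+1)`!%:R * x ^+ n.+1 by rewrite mulr_gt0 ?exprn_gt0// ltr0n fact_gt0.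
rewrite expRN -[leRHS]invrK lef_pV2 ?posrE ?expR_gt0 ?invr_gt0//.
rewrite invfM -exprVn mulrC; apply: le_trans h.
by rewrite lerDr.
Qed.

Lemma flat_ge0 k x : 0 <= flat k x.
Proof. by rewrite /flat; case: ifP => // x0; rewrite mulr_ge0 ?expR_ge0// exprn_ge0// invr_ge0
  ltW. Qed.

(** One term of the exponential series gives this quadratic bound, which makes [flat k]
    differentiable at 0 with derivative 0. *)
Lemma flat_le k x : flat k x <= (k.+2)`!%:R * x ^+ 2.
Proof.
rewrite /flat; case: ifP => x0; last by rewrite mulr_ge0// sqr_ge0.
have := expRN_inv_le k.+1 x0 => /(ler_wpM2l (_ : 0 <= x^-1 ^+ k)) => /(_ _) h.
apply: le_trans (h _) _; first by rewrite exprn_ge0// invr_ge0 ltW.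
rewrite -addn2 exprD mulrCA [x^-1 ^+ k * _]mulrA -exprMn mulVf ?gt_eqF// expr1n mul1r.
by [].
Qed.

Lemma is_derive_flat k x :
  is_derive x (1 : R^o) (flat k : R^o -> R) (- k%:R * flat k.+1 x + flat k.+2 x).
Proof.
have [x0|x0|x0] := ltgtP 0 x.
- apply: (@near_eq_is_derive _ _ _ (fun x : R^o => x^-1 ^+ k * expR (- x^-1) : R)).
  + near=> y; rewrite /flat ifT//; near: y; exact: lt_nbhsr.
  + have xN : x != 0 by rewrite gt_eqF.
    have hV : is_derive (x : R^o) (1 : R^o) (fun y : R^o => y^-1 : R) (- x ^- 2).
      have := @is_deriveV R id x 1 1 xN (is_derive_id _ _).
      by move=> h; apply: is_derive_eq; rewrite scaler1.
    have hX := @is_deriveX R R^o (fun y : R^o => y^-1 : R) k x 1 _ hV.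
    have hN := is_deriveN hV.
    have hE := @is_derive1_comp R expR (fun y : R => - y^-1) x _ _ (is_derive_expR _) hN.
    have hM := is_deriveM hX hE.
    rewrite (_ : (fun y : R^o => _) = (fun y : R^o => y^-1 : R) ^+ k * (expR \o (fun y : R => -
      y^-1))); last first.
      by apply/funext => y; rewrite !exprfctE.
    apply: (is_derive_eq hM); rewrite /flat.
    rewrite (_ : (0 < (x : R))%R = true)//= !exprfctE /GRing.scale/=.
    case: (k) => [|k'] /=; first by rewrite !mul0r; field.
    by rewrite !exprS; field; rewrite xN.
- apply: (@near_eq_is_derive _ _ _ (fun x : R^o => 0 : R)).
  + near=> y; rewrite /flat ifF//; apply/negbTE; rewrite -leNgt ltW//; near: y.
    exact: lt_nbhsl.
  + by rewrite /flat ltNge (ltW x0)/= mulr0 addr0; exact: is_derive_cst.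
(* At 0 the difference quotient is at most (k + 2)! |h|, by [flat_le]. *)
- have cv : h^-1 *: ((flat k \o shift x) (h *: (1 : R^o)) - flat k x) @[h --> (0 : R)^'] --> (0 :
    R^o).
    apply/cvgr0Pnorm_le => e e0; near=> h.
    have hN : h != 0 by near: h; exact: nbhs_dnbhs_neq.
    rewrite -x0 /= addr0 [flat k 0]/flat ltxx subr0 normrZ normfV (ger0_norm (flat_ge0 k _)).
    rewrite (_ : h *: 1 = h); last by rewrite /GRing.scale/= mulr1.
    rewrite ler_pdivrMl ?normr_gt0//; apply: le_trans (flat_le k h) _.
    have fk : 0 < (k.+2)`!%:R :> R by rewrite ltr0n fact_gt0.
    rewrite -(ger0_norm (sqr_ge0 h)) normrX expr2 mulrA mulrC ler_wpM2l//.
    rewrite mulrC -ler_pdivlMr//; near: h; apply: dnbhs0_le; exact: divr_gt0.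
  split; first by apply/cvg_ex; exists 0.
  rewrite /derive (cvg_lim _ cv)//.
  by rewrite -x0 /flat ltxx mulr0 addr0.
Unshelve. all: by end_near.
Qed.

Lemma smooth_flat k : smooth (flat k : R^o -> R).
Proof.
pose G : set (R^o -> R) := [set f | exists k, f = flat k].
have GD g : G g -> exists2 d, generated G d & forall x, is_derive x (1 : R^o) g (d x).
  move=> [j ->]; exists (fun x => (- j%:R) * flat j.+1 x + flat j.+2 x); last exact: is_derive_flat.
  apply: generated_add; last by apply: generated_gen; exists j.+2.
  by apply: generated_mul; [exact: generated_cst|apply: generated_gen; exists j.+1].
by apply: (generated_smooth1 GD); apply: generated_gen; exists k.
Qed.

(** The factor [n.+1] steepens both ramps: the bumps vanish outside ]a, b[, lie between 0 and 1 and
    tend pointwise to the indicator function of ]a, b[. *)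
Definition bump (n : nat) (a b x : R) : R := flat 0 (n.+1%:R * x - n.+1%:R * a) * flat 0 (n.+1%:R
  * b - n.+1%:R * x).

Lemma smooth_bump n a b : smooth (bump n a b : R^o -> R).
Proof.
apply: smoothM.
- exact: (smooth_comp (is_diff_affine1 n.+1%:R (- (n.+1%:R * a))) (smooth_flat 0)).
- have := smooth_comp (is_diff_affine1 (- n.+1%:R) (n.+1%:R * b)) (smooth_flat 0).
  by congr smooth; apply/funext => x; congr (flat 0 _); ring.
Qed.

Lemma flat0E (x : R) : flat 0 x = if 0 < x then expR (- x^-1) else 0.
Proof. by rewrite /flat expr0 mul1r. Qed.

Lemma flat0_ge0_le1 (x : R) : 0 <= flat 0 x <= 1.
Proof.
rewrite flat_ge0 flat0E; case: ifP => x0; last exact: ler01.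
by rewrite -expR0 ler_expR oppr_le0 invr_ge0 ltW.
Qed.

Lemma bump_ge0_le1 n a b x : 0 <= bump n a b x <= 1.
Proof.
have /andP[h1 h2] := flat0_ge0_le1 (n.+1%:R * x - n.+1%:R * a).
have /andP[h3 h4] := flat0_ge0_le1 (n.+1%:R * b - n.+1%:R * x).
by rewrite /bump mulr_ge0//= mulr_ile1.
Qed.

Lemma bump_out n a b x : ~~ (a < x < b) -> bump n a b x = 0.
Proof.
rewrite /bump !flat0E -!mulrBr !pmulr_rgt0 ?ltr0n// !subr_gt0.
by case: ltP => /= _; case: ltP => /= _ //; rewrite ?mulr0 ?mul0r.
Qed.

Lemma cvg_flat0 (x : R) : 0 < x -> (fun n => flat 0 (n.+1%:R * x)) @ \oo --> (1 : R).
Proof.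
move=> x0.
rewrite (_ : (fun n => _) = (fun n => expR (- (x^-1 * n.+1%:R^-1)))); last first.
  by apply/funext => n; rewrite flat0E pmulr_lgt0// ltr0n invfM mulrC.
rewrite -[in X in _ --> X]expR0; apply: continuous_cvg; first exact: continuous_expR.
rewrite -[X in _ --> X]oppr0; apply: cvgN; rewrite -[X in _ --> X](mulr0 x^-1); apply: cvgMr.
exact: cvg_harmonic.
Qed.

Lemma cvg_bump a b x : (fun n => bump n a b x) @ \oo --> (\1_(`]a, b[%classic) x : R).
Proof.
have [|h] := boolP (a < x < b); last first.
  rewrite indicE memNset ?in_itv//=; last by apply/negP; rewrite in_itv.
  rewrite (_ : (fun n => _) = fun=> 0); first exact: cvg_cst.
  by apply/funext => n; exact: bump_out.
move=> /andP[ax xb]; rewrite indicE mem_set/= ?in_itv/= ?ax ?xb//.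
rewrite -[_%:R]mulr1; apply: cvgM.
- by under eq_fun do rewrite -mulrBr; apply: cvg_flat0; rewrite subr_gt0.
- by under eq_fun do rewrite -mulrBr; apply: cvg_flat0; rewrite subr_gt0.
Qed.

End smooth_functions.

(** * Test functions *)

Definition csmooth (R : realType) (V : normedModType R) (f : V -> R[i]) : Prop :=
  smooth (fun x => Re (f x)) /\ smooth (fun x => Im (f x)).

Section csmooth_functions.
Context {R : realType}.
Implicit Types (V W : normedModType R).

Lemma csmooth_cst V (c : R[i]) : @csmooth R V (fun=> c).
Proof. by split; exact: smooth_cst. Qed.

Lemma csmoothD V (f g : V -> R[i]) : csmooth f -> csmooth g -> csmooth (fun x => f x + g x).
Proof.
move=> [f1 f2] [g1 g2]; split.
- by under eq_fun do rewrite ReD; exact: smoothD.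
- by under eq_fun do rewrite ImD; exact: smoothD.
Qed.

Lemma csmoothM V (f g : V -> R[i]) : csmooth f -> csmooth g -> csmooth (fun x => f x * g x).
Proof.
move=> [f1 f2] [g1 g2]; split.
- under eq_fun do rewrite ReM; apply: smoothD; first exact: smoothM.
  by apply: smoothN; exact: smoothM.
- by under eq_fun do rewrite ImM; apply: smoothD; exact: smoothM.
Qed.

Lemma csmooth_comp V W (phi phi0 : W -> V) (f : V -> R[i]) :
  (forall x, is_diff x phi phi0) -> csmooth f -> csmooth (fun x => f (phi x)).
Proof. by move=> dphi [f1 f2]; split; [exact: smooth_comp f1|exact: smooth_comp f2]. Qed.

Lemma csmooth_real V (f : V -> R) : smooth f -> csmooth (fun x => (f x)%:C).
Proof. by move=> sf; split => //=; exact: smooth_cst. Qed.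

Lemma csmooth_cis (w c : R) : csmooth (fun x : R^o => cis (w * x + c)).
Proof.
have [sc ss] := @smooth_cos_sin R.
have h : csmooth (fun x : R^o => cis (x : R)) by split.
exact: csmooth_comp (is_diff_affine1 w c) h.
Qed.

End csmooth_functions.

Section test_functions.
Context {R : realType} {V : normedModType R}.
Hypothesis HV : forall M : R, compact [set x : V | `|x| <= M].
Implicit Types (f g : V -> R[i]).

(** The Heine-Borel property, assumed as [HV] and checked later for the line and the plane, replaces
    compact supports by bounded ones. *)
Lemma bounded_compact_closure (A : set V) :
  compact (closure A) <-> exists M : R, forall x, A x -> `|x| <= M.
Proof.
split.
  move=> /compact_bounded[M [_ hM]]; exists (M + 1) => x Ax.
  by apply: (hM (M + 1)); [rewrite ltrDl|exact: subset_closure].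
move=> [M hM]; suff h : closure A `<=` [set x | `|x| <= M].
  exact (@subclosed_compact V _ _ (@closed_closure V A) (@HV M) h).
move=> x /(closureS (hM : A `<=` [set x | `|x| <= M])).
exact (@compact_closed V _ (@norm_hausdorff _ V) (@HV M) x).
Qed.

Lemma test_functionP f : test_function f <->
  csmooth f /\ exists M : R, forall x, f x != 0 -> `|x| <= M.
Proof.
split=> [[f1 f2 /bounded_compact_closure fM]|[[f1 f2] fM]]; first by split.
by split => //; apply/bounded_compact_closure.
Qed.

Lemma test_function_add (c : R[i]) f g : test_function f -> test_function g ->
  test_function (fun x => c * f x + g x).
Proof.
move=> /test_functionP[sf [M fM]] /test_functionP[sg [K gK]]; apply/test_functionP; split.
  by apply: csmoothD => //; apply: csmoothM => //; exact: csmooth_cst.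
exists (Num.max M K) => x h; rewrite le_max.
have [fx|fx] := eqVneq (f x) 0; last by rewrite (fM _ fx).
by move: h; rewrite fx mulr0 add0r => /gK ->; rewrite orbT.
Qed.

Lemma test_function_mul f g : csmooth f -> test_function g ->
  test_function (fun x => f x * g x).
Proof.
move=> sf /test_functionP[sg [K gK]]; apply/test_functionP; split; first exact: csmoothM.
by exists K => x h; apply: gK; apply: contraNN h => /eqP ->; rewrite mulr0.
Qed.

Lemma test_function_comp (phi phi0 : V -> V) f : (forall x, is_diff x phi phi0) ->
  (forall M : R, exists M' : R, forall x, `|phi x| <= M -> `|x| <= M') ->
  test_function f -> test_function (fun x => f (phi x)).
Proof.
move=> dphi phiM /test_functionP[sf [M fM]]; apply/test_functionP; split.
  exact: csmooth_comp dphi sf.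
by have [M' hM'] := phiM M; exists M' => x /fM /hM'.
Qed.

Lemma test_continuous f : test_function f ->
  continuous (fun x => Re (f x)) /\ continuous (fun x => Im (f x)).
Proof. by move=> [f1 f2 _]; split; exact: smooth_continuous. Qed.

Lemma test_function_bounded f : test_function f -> exists2 K : R, 0 <= K & forall x, normc (f x)
  <= K.
Proof.
move=> tf; have [cRe cIm] := test_continuous tf.
have /test_functionP[_ [M fM]] := tf.
have bnd (h : V -> R) : continuous h -> exists K : R, forall x, `|x| <= M -> `|h x| <= K.
  move=> ch; have : compact (h @` [set x | `|x| <= M]).
    by apply: continuous_compact; [exact: continuous_subspaceT|exact: HV].
  move=> /compact_bounded[K [_ hK]]; exists (K + 1) => x xM.
  by apply: (hK (K + 1)); [rewrite ltrDl|exists x].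
have [K1 h1] := bnd _ cRe; have [K2 h2] := bnd _ cIm.
exists (Num.max 0 (K1 + K2)) => [|x]; first by rewrite le_max lexx.
rewrite le_max; have [->|fx] := eqVneq (f x) 0; first by rewrite normc0 lexx.
apply/orP; right; apply: le_trans (normc_le _) _.
by rewrite lerD// ?h1 ?h2//; exact: fM.
Qed.

End test_functions.

Section bounded_functions.
Context d (T : measurableType d) (R : realType).
Variable mu : {measure set T -> \bar R}.
Variables (f : T -> R[i]) (A : set T) (K : R).
Hypotheses (mf : cmeasurable f) (mA : measurable A) (Afin : (mu A < +oo)%E).
Hypotheses (K0 : 0 <= K) (fK : forall x, normc (f x) <= K) (fA : forall x, f x != 0 -> A x).

Let integrable_dominant (M : R) : mu.-integrable setT (fun x => (M * \1_A x)%:E).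
Proof.
apply: (@eq_integrable _ _ _ _ _ measurableT (fun x => M%:E * (\1_A x)%:E)%E) => //.
by apply: integrableZl => //; exact: integrable_indicator.
Qed.

Lemma bounded_cintegrable : cintegrable mu f.
Proof.
apply: (le_cintegrable mf (g := fun x => K * \1_A x)) => [x|]; last exact: integrable_dominant.
have [fx|/fA Ax] := eqVneq (f x) 0; first by rewrite fx normc0 mulr_ge0// indicE.
by rewrite indicE mem_set// mulr1.
Qed.

Lemma bounded_cLp k : (0 < k)%N -> cLp mu k%:R f.
Proof.
move=> k0; split => //; rewrite cLnorm_lty//.
have /integrableP[_] := integrable_dominant (K ^+ k).
apply: le_lt_trans; apply: ge0_le_integral => //.
- by move=> x _; rewrite lee_fin exprn_ge0// normc_ge0.
- by apply/measurable_EFinP; exact: measurable_pmass.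
- apply/measurable_EFinP; apply: measurableT_comp => //.
  by apply: measurable_funM => //; exact: measurable_indic.
- move=> x _; rewrite lee_fin normrM (ger0_norm (exprn_ge0 _ K0)).
  have [fx|/fA Ax] := eqVneq (f x) 0.
    by rewrite fx normc0 expr0n gtn_eqF// mulr_ge0// exprn_ge0.
  by rewrite indicE mem_set// normr1 mulr1 lerXn2r ?nnegrE ?normc_ge0.
Qed.

End bounded_functions.

Section euclidean_test_functions.
Context {R : realType}.
Local Notation mu := (@lebesgue_measure R).

Lemma compact_ball1 (M : R) : compact [set x : R^o | `|x| <= M].
Proof.
rewrite (_ : [set x | _] = `[- M, M]%classic); first exact: segment_compact.
by apply/seteqP; split => x /=; rewrite in_itv/= -ler_norml.
Qed.

Lemma norm2_le (x : R^o * R^o) (M : R) : (`|x| <= M) = (`|x.1| <= M) && (`|x.2| <= M).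
Proof. by rewrite prod_normE/= ge_max. Qed.

Lemma compact_ball2 (M : R) : compact [set x : R^o * R^o | `|x| <= M].
Proof.
rewrite (_ : [set x | _] = [set x : R^o | `|x| <= M] `*` [set x : R^o | `|x| <= M]).
  by apply: compact_setX; exact: compact_ball1.
by apply/seteqP; split => x /=; rewrite norm2_le => /andP.
Qed.

(** An open set is the union of the boxes with rational corners that it contains, and these are
    countably many. *)
Lemma open_measurable2 (U : set (R^o * R^o)) : open U -> measurable (U : set (R * R)).
Proof.
move=> oU; pose box (q : rat * rat * rat * rat) : set (R * R) :=
  `]ratr q.1.1.1, ratr q.1.1.2[%classic `*` `]ratr q.1.2, ratr q.2[%classic.
rewrite (_ : U = \bigcup_q (if pselect (box q `<=` U) then box q else set0)); last first.
  apply/seteqP; split => [z Uz|z [q _]]; last by case: pselect => // h /h.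
  have [e /= e0 he] := (iffLR (nbhs_ballP _ _) (open_nbhs_nbhs (conj oU Uz))).
  have ltl (x : R) : x - e < x by rewrite ltrBlDr ltrDl.
  have ltr (x : R) : x < x + e by rewrite ltrDl.
  have [q1] := rat_in_itvoo (ltl z.1); have [q2] := rat_in_itvoo (ltr z.1).
  have [q3] := rat_in_itvoo (ltl z.2); have [q4] := rat_in_itvoo (ltr z.2).
  rewrite !in_itv/= => /andP[h7 h8] /andP[h5 h6] /andP[h3 h4] /andP[h1 h2].
  exists (q1, q2, q3, q4) => //; case: pselect => [hb|].
    by split => /=; rewrite in_itv/= ?h2 ?h3 ?h6 ?h7.
  case=> w [/=]; rewrite !in_itv/= => /andP[w1 w2] /andP[w3 w4]; apply: he.
  split; rewrite /ball/= ltr_norml; apply/andP; split; lra.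
apply: (@countable_bigcupT_measurable _ _ _ _ _) => // q.
case: pselect => [hq|hq]; last exact: measurable0.
by apply: measurableX; exact: measurable_itv.
Qed.

Lemma continuous_measurable2 (f : R^o * R^o -> R) : continuous f ->
  measurable_fun setT (f : R * R -> R).
Proof.
move=> cf mT; apply: (measurability _ (RGenOInfty.measurableE R)) => //.
move=> _ [_ [a ->] <-]; apply: measurableI => //; apply: open_measurable2.
by apply: open_comp => [x _|]; [exact: cf|exact: rray_open].
Qed.

Lemma continuous_measurable1 (f : R^o -> R) : continuous f ->
  measurable_fun setT (f : R -> R).
Proof. by move=> cf; exact: continuous_measurable_fun. Qed.

End euclidean_test_functions.

Section euclidean_test_functions_theory.
Context {R : realType}.
Local Notation mu := (@lebesgue_measure R).
Local Notation test1 := (@test_function R R^o).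
Local Notation test2 := (@test_function R (R^o * R^o)%type).

Lemma test1_cmeasurable f : test1 f -> cmeasurable (f : R -> R[i]).
Proof. by move=> /test_continuous[c1 c2]; split; exact: continuous_measurable1. Qed.

Lemma test2_cmeasurable f : test2 f -> cmeasurable (f : R * R -> R[i]).
Proof. by move=> /test_continuous[c1 c2]; split; exact: continuous_measurable2. Qed.

Lemma finite_box1 (M : R) : (mu `[(- M)%R, M]%classic < +oo)%E.
Proof. by rewrite lebesgue_measure_itv/=; case: ifP => // _; rewrite -EFinB ltry. Qed.

Lemma finite_box2 (M : R) : ((mu \x mu) (`[(- M)%R, M]%classic `*` `[(- M)%R, M]%classic) < +oo)%E.
Proof.
rewrite product_measure1E//; try exact: measurable_itv.
by rewrite lte_mul_pinfty ?ge0_fin_numE ?finite_box1.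
Qed.

Lemma test1_integrable f : test1 f -> cintegrable mu f.
Proof.
move=> tf; have [K K0 hK] := test_function_bounded compact_ball1 tf.
have /(test_functionP compact_ball1)[_ [M fM]] := tf.
apply: (@bounded_cintegrable _ _ _ mu f `[(- M), M]%classic K) => //.
- exact: test1_cmeasurable.
- exact: finite_box1.
- by move=> x /fM; rewrite /= in_itv/= -ler_norml.
Qed.

Lemma test1_Lp f k : (0 < k)%N -> test1 f -> cLp mu k%:R f.
Proof.
move=> k0 tf; have [K K0 hK] := test_function_bounded compact_ball1 tf.
have /(test_functionP compact_ball1)[_ [M fM]] := tf.
apply: (@bounded_cLp _ _ _ mu f `[(- M), M]%classic K) => //.
- exact: test1_cmeasurable.
- exact: finite_box1.
- by move=> x /fM; rewrite /= in_itv/= -ler_norml.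
Qed.

Lemma test2_integrable f : test2 f -> cintegrable (mu \x mu)%E f.
Proof.
move=> tf; have [K K0 hK] := test_function_bounded compact_ball2 tf.
have /(test_functionP compact_ball2)[_ [M fM]] := tf.
apply: (@bounded_cintegrable _ _ _ (mu \x mu)%E f (`[(- M), M]%classic `*` `[(- M), M]%classic) K)
  => //.
- exact: test2_cmeasurable.
- by apply: measurableX; exact: measurable_itv.
- exact: finite_box2.
- by move=> x /fM; rewrite norm2_le => /andP[h1 h2]; split => /=; rewrite in_itv/= -ler_norml.
Qed.

Lemma test2_Lp f k : (0 < k)%N -> test2 f -> cLp (mu \x mu)%E k%:R f.
Proof.
move=> k0 tf; have [K K0 hK] := test_function_bounded compact_ball2 tf.
have /(test_functionP compact_ball2)[_ [M fM]] := tf.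
apply: (@bounded_cLp _ _ _ (mu \x mu)%E f (`[(- M), M]%classic `*` `[(- M), M]%classic) K) => //.
- exact: test2_cmeasurable.
- by apply: measurableX; exact: measurable_itv.
- exact: finite_box2.
- by move=> x /fM; rewrite norm2_le => /andP[h1 h2]; split => /=; rewrite in_itv/= -ler_norml.
Qed.

Lemma test_tensor (f g : R -> R[i]) : test1 f -> test1 g -> test2 (fun z => f z.1 * g z.2).
Proof.
move=> /(test_functionP compact_ball1)[sf [M fM]] /(test_functionP compact_ball1)[sg [K gK]].
apply/(test_functionP compact_ball2); split.
  apply: csmoothM; first exact: csmooth_comp is_diff_fst sf.
  exact: csmooth_comp is_diff_snd sg.
exists (Num.max M K) => x h; rewrite norm2_le !le_max.
have [fx|fx] := eqVneq (f x.1) 0; first by move: h; rewrite fx mul0r eqxx.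
have [gx|gx] := eqVneq (g x.2) 0; first by move: h; rewrite gx mulr0 eqxx.
by rewrite fM//= gK// orbT.
Qed.

Lemma affine_coercive (a b M x : R) : a != 0 -> `|a * x + b| <= M -> `|x| <= `|a|^-1 * (M + `|b|).
Proof.
move=> a0 h; rewrite mulrC ler_pdivlMr ?normr_gt0// mulrC -normrM.
rewrite -[a * x](addrK b); apply: le_trans (ler_normB _ _) _.
by rewrite lerD2r.
Qed.

Lemma test2_affine (a1 b1 a2 b2 : R) f : a1 != 0 -> a2 != 0 -> test2 f ->
  test2 (fun x => f (a1 * x.1 + b1, a2 * x.2 + b2)).
Proof.
move=> a10 a20; apply: (test_function_comp compact_ball2 (is_diff_affine2 a1 b1 a2 b2)) => M.
exists (Num.max (`|a1|^-1 * (M + `|b1|)) (`|a2|^-1 * (M + `|b2|))) => x.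
rewrite !norm2_le !le_max/= => /andP[/(affine_coercive a10) -> /(affine_coercive a20) ->].
by rewrite orbT.
Qed.

Lemma test2_cis (w1 w2 : R) f : test2 f -> test2 (fun x => cis (w1 * x.1 + w2 * x.2) * f x).
Proof.
move=> tf; apply: (test_function_mul compact_ball2) => //.
have := csmoothM (csmooth_comp is_diff_fst (csmooth_cis w1 0)) (csmooth_comp is_diff_snd
  (csmooth_cis w2 0)).
by congr csmooth; apply/funext => x; rewrite !addr0 -cisD.
Qed.

Lemma test_bump n (a b : R) : test1 (fun x => (bump n a b x)%:C).
Proof.
apply/(test_functionP compact_ball1); split.
  by apply: csmooth_real; exact: smooth_bump.
exists (Num.max `|a| `|b|) => x h.
have /andP[ax xb] : a < x < b.
  by apply: contraNT h => /(bump_out n) ->.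
rewrite le_max !ler_norml; apply/orP; have [x0|x0] := leP 0 x.
- by right; apply/andP; split; [apply: le_trans x0; rewrite oppr_le0|apply: le_trans (ler_norm _);
    exact: ltW].
- left; apply/andP; split; last by apply: le_trans (ltW x0) _.
  by rewrite lerNl -normrN; apply: le_trans (ler_norm _); rewrite lerN2 ltW.
Qed.

End euclidean_test_functions_theory.

(** * Density of test functions *)

Lemma cvg_expn (R : realType) (u : nat -> R) (l : R) n :
  u @ \oo --> l -> (fun j => u j ^+ n) @ \oo --> l ^+ n.
Proof.
move=> ul; elim: n => [|n IH].
  by under eq_fun do rewrite expr0; rewrite expr0; exact: cvg_cst.
by under eq_fun do rewrite exprS; rewrite exprS; exact: cvgM.
Qed.

Section density.
Import HBNNSimple.
Context d (T : measurableType d) (R : realType).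
Variable mu : {measure set T -> \bar R}.
Variables (k : nat) (test : set (T -> R[i])).
Hypothesis k0 : (0 < k)%N.
Hypothesis test_add : forall (c : R[i]) f g, test f -> test g -> test (fun x => c * f x + g x).
Hypothesis test_Lp : forall f, test f -> cLp mu k%:R f.
Implicit Types (f g : T -> R[i]).
Local Notation N f := (cLnorm mu k%:R f).

Definition approximable f := cLp mu k%:R f /\
  forall e : R, 0 < e -> exists2 g, test g & (N (fun x => f x - g x)%R <= e%:E)%E.

Lemma test_approximable f : test f -> approximable f.
Proof.
move=> tf; split; first exact: test_Lp.
move=> e e0; exists f => //; rewrite (_ : (fun x => _) = fun=> 0).
  by rewrite cLnorm0// lee_fin ltW.
by apply/funext => x; rewrite subrr.
Qed.

Lemma approximable_add (c : R[i]) f g : approximable f -> approximable g ->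
  approximable (fun x => c * f x + g x).
Proof.
move=> [Lf af] [Lg ag]; split; first exact: cLp_add.
move=> e e0.
have c1 : 0 < normc c + 1 by rewrite ltr_wpDl ?normc_ge0.
have ec : 0 < e / 2 / (normc c + 1) by rewrite !divr_gt0.
have [f' tf' Nf'] := af _ ec.
have [g' tg' Ng'] := ag _ (divr_gt0 e0 (ltr0n R 2)).
exists (fun x => c * f' x + g' x); first exact: test_add.
have [mf' _] := test_Lp tf'; have [mg' _] := test_Lp tg'.
have mfB := cmeasurableB Lf.1 mf'; have mgB := cmeasurableB Lg.1 mg'.
rewrite (_ : (fun x => _) = (fun x => c * (f x - f' x) + (g x - g' x))); last first.
  by apply/funext => x; ring.
have mc : cmeasurable (fun x => c * (f x - f' x)) by apply: cmeasurableM => //; exact: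
  cmeasurable_cst.
rewrite (le_trans (cLnormD mu k0 mc mgB))// (splitr e) EFinD leeD// cLnormZ//.
apply: le_trans (lee_wpmul2l _ Nf') _; first by rewrite lee_fin normc_ge0.
rewrite -EFinM lee_fin mulrCA ler_piMr ?divr_ge0 ?(ltW e0)//.
by rewrite ler_pdivrMr// mul1r lerDl.
Qed.

(** Dominated convergence, with dominating function (2 G)^k, puts some [u n] within e / 2 of [f]; a
    test function within e / 2 of [u n] concludes. *)
Lemma approximable_lim (u : nat -> T -> R[i]) f (G : T -> R) :
  (forall n, approximable (u n)) -> cmeasurable f ->
  (forall x, ccvg (fun n => u n x) (f x)) ->
  mu.-integrable setT (fun x => (G x ^+ k)%:E) ->
  (forall n x, normc (u n x) <= G x) -> (forall x, normc (f x) <= G x) ->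
  approximable f.
Proof.
move=> au mf cu Gi uG fG.
have mu_ n : cmeasurable (u n) by have [[]] := au n.
have G0 x : 0 <= G x by apply: le_trans (fG x); exact: normc_ge0.
have Lf : cLp mu k%:R f.
  split => //; rewrite cLnorm_lty//; have /integrableP[_] := Gi.
  apply: le_lt_trans; apply: ge0_le_integral => //.
  - by move=> x _; rewrite lee_fin exprn_ge0// normc_ge0.
  - by apply/measurable_EFinP; exact: measurable_pmass.
  - by apply: measurableT_comp => //; have /integrableP[] := Gi.
  - move=> x _; rewrite lee_fin ger0_norm ?exprn_ge0//.
    by rewrite lerXn2r ?nnegrE ?normc_ge0.
split => // e e0.
have cR : (fun n => Rintegral mu setT (fun x => normc (f x - u n x) ^+ k)) @ \oo --> (0 : R).
  rewrite (_ : 0 = Rintegral mu setT (fun _ : T => 0 : R)); last by rewrite /Rintegral integral0.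
  apply: (Rintegral_dct (g := fun x => 2 ^+ k * G x ^+ k)).
  - by move=> n; apply: measurable_pmass; exact: cmeasurableB.
  - exact: measurable_cst.
  - apply: nearW => x; rewrite (_ : 0 = 0 ^+ k :> R); last by rewrite expr0n gtn_eqF.
    apply: cvg_expn.
    by move: (cu x); rewrite /ccvg; under eq_fun do rewrite normc_distC.
  - apply: (@eq_integrable _ _ _ _ _ measurableT (fun x => (2 ^+ k)%:E * (G x ^+ k)%:E)%E) => //.
    exact: integrableZl.
  - move=> n x; rewrite ger0_norm ?exprn_ge0 ?normc_ge0// -exprMn.
    rewrite lerXn2r ?nnegrE ?normc_ge0 ?mulr_ge0//.
    by apply: le_trans (normcD _ _) _; rewrite normcN mulr_natl mulr2n lerD.
have e2k : 0 < (e / 2) ^+ k by rewrite exprn_gt0// divr_gt0.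
have [n _ /(_ n (leqnn n))] := (iffLR (cvgr0Pnorm_le _) cR) _ e2k.
rewrite /= => hn.
have Nn : (N (fun x => f x - u n x)%R <= (e / 2)%:E)%E.
  rewrite cLnorm_le ?divr_ge0 ?(ltW e0)//.
  have Lu := (au n).1.
  have [_] := cLpB k0 Lf Lu; rewrite cLnorm_lty// => pfin.
  have pE : pmass mu k (fun x => f x - u n x)%R \is a fin_num.
    by rewrite ge0_fin_numE// pmass_ge0.
  rewrite -(fineK pE) lee_fin; apply: le_trans (ler_norm _) hn.
have [g tg Ng] := (au n).2 _ (divr_gt0 e0 (ltr0n R 2)).
exists g => //; have [mg _] := test_Lp tg.
rewrite (_ : (fun x => _) = (fun x => (f x - u n x) + (u n x - g x))); last first.
  by apply/funext => x; ring.
have m1 := cmeasurableB mf (mu_ n); have m2 := cmeasurableB (mu_ n) mg.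
by rewrite (le_trans (cLnormD mu k0 m1 m2))// (splitr e) EFinD leeD.
Qed.

Section indicators.
Variables (K : set T).
Hypotheses (mK : measurable K) (Kfin : (mu K < +oo)%E).

Let chiK_integrable : mu.-integrable setT (fun x => ((\1_K x : R) ^+ k)%:E).
Proof.
apply: (@eq_integrable _ _ _ _ _ measurableT (fun x => (\1_K x)%:E)) => //.
  by move=> x _; rewrite indicE; case: (x \in K); rewrite ?expr1n// expr0n gtn_eqF.
exact: integrable_indicator.
Qed.

Lemma approximable_lim_in (u : nat -> T -> R[i]) f :
  (forall n, approximable (u n)) -> cmeasurable f ->
  (forall x, ccvg (fun n => u n x) (f x)) ->
  (forall n x, normc (u n x) <= \1_K x) -> (forall x, normc (f x) <= \1_K x) ->
  approximable f.
Proof. by move=> h1 h2 h3 h4 h5; apply: (approximable_lim h1 h2 h3 chiK_integrable h4 h5). Qed.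

(** A Dynkin class argument. Intersecting with a set [K] of finite measure keeps everything in L^p:
    complements become differences from [chi K], and disjoint unions become limits dominated by
    [chi K]. *)
Lemma approximable_dynkin (G : set (set T)) :
  @measurable _ T = <<s G >> -> setI_closed G ->
  approximable (chi K) -> (forall A, G A -> approximable (chi (A `&` K))) ->
  forall A, measurable A -> approximable (chi (A `&` K)).
Proof.
move=> GE GI aK aG; suff h A : <<s G >> A -> approximable (chi (A `&` K)) by move=> A; rewrite GE;
  exact: h.
apply: (dynkin_induction (P := fun A => approximable (chi (A `&` K))) GE GI) => //.
- by rewrite setTI.
- move=> S mS aS; rewrite (_ : chi _ = (fun x => (-1) * chi (S `&` K) x + chi K x)).
    exact: approximable_add.
  apply/funext => x; rewrite /chi !indicE !in_setI in_setC.
  by case: (x \in S); case: (x \in K); rewrite /= ?mulr0 ?addr0 ?add0r ?mulr1 ?addNr.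
- move=> F mF tF aF.
  pose u n x : R[i] := \sum_(j < n) chi (F j `&` K) x.
  have a0 : approximable (fun=> 0).
    rewrite (_ : (fun=> 0) = (fun x => (-1) * chi K x + chi K x)).
      exact: approximable_add.
    by apply/funext => x; rewrite mulN1r addNr.
  have au n : approximable (u n).
    elim: n => [|n IH]; first by rewrite (_ : u 0%N = fun=> 0)//; apply/funext => x; rewrite /u
      big_ord0.
    rewrite (_ : u n.+1 = (fun x => 1 * u n x + chi (F n `&` K) x)); first exact: approximable_add.
    by apply/funext => x; rewrite /u big_ord_recr mul1r.
  have uE0 x n : ~ ((\bigcup_j F j) `&` K) x -> u n x = 0.
    move=> nx; rewrite /u big1// => j _; apply: chi_notin => -[Fx Kx]; apply: nx.
    by split => //; exists j.
  have uE1 x j n : F j x -> K x -> u n x = (j < n)%N%:R.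
    move=> Fx Kx; elim: n => [|n IH]; first by rewrite /u big_ord0.
    rewrite /u big_ord_recr/= -/(u n x) IH; have [jn|jn|<-] := ltngtP j n.
    - rewrite chi_notin => [|[Fn _]]; first by rewrite addr0 ltnS ltnW.
      by have := (iffLR trivIsetP tF j n I I) (negbT (ltn_eqF jn)) => /seteqP[/(_ x (conj Fx Fn))].
    - rewrite chi_notin => [|[Fn _]]; first by rewrite addr0 ltnS leqNgt jn.
      by have := (iffLR trivIsetP tF n j I I) (negbT (ltn_eqF jn)) => /seteqP[/(_ x (conj Fn Fx))].
    - by rewrite chi_in// add0r ltnS leqnn.
  apply: (@approximable_lim_in u) => //.
  - apply: cmeasurable_chi; apply: measurableI => //.
    by apply: bigcup_measurable => n _; exact: mF.
  - move=> x; have [xF|xF] := pselect (((\bigcup_j F j) `&` K) x).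
      have [[j _ Fx] Kx] := xF; rewrite chi_in//.
      rewrite /ccvg; apply: cvg_near_cst; exists j.+1 => // n /= jn.
      by rewrite (uE1 _ _ _ Fx Kx) jn subrr normc0.
    rewrite chi_notin// (_ : (fun n => _) = fun=> 0); first exact: ccvg_cst.
    by apply/funext => n; rewrite uE0.
  - move=> n x; have [xF|xF] := pselect (((\bigcup_j F j) `&` K) x).
      have [[j _ Fx] Kx] := xF; rewrite (uE1 _ _ _ Fx Kx) indicE mem_set//.
      by case: (j < n)%N; rewrite ?normc0 ?normc1.
    by rewrite uE0// normc0.
  - by move=> x; rewrite normr_chi !indicE in_setI; case: (x \in K); rewrite ?andbF ?andbT// lern1
      leq_b1.
Qed.

End indicators.

Section all_of_Lp.
Variables (K : nat -> set T).
Hypothesis (cK : forall x, \forall n \near \oo, K n x).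
Hypothesis aK : forall n A, measurable A -> approximable (chi (A `&` K n)).

Lemma approximable_nonneg (f : T -> R) : (forall x, 0 <= f x) -> measurable_fun setT f ->
  mu.-integrable setT (fun x => (f x ^+ k)%:E) -> approximable (fun x => (f x)%:C).
Proof.
move=> f0 mf fi.
have mfE : measurable_fun setT (fun x => (f x)%:E) by exact/measurable_EFinP.
have [s [nds cs]] := approximation measurableT mfE (fun t _ => f0 t : (0 <= (f t)%:E)%E).
have sc x : (fun n => s n x) @ \oo --> f x.
  by have /fine_cvg := cs x I.
have sf n x : s n x <= f x.
  by rewrite -(cvg_lim _ (sc x))//; apply: nondecreasing_cvgn_le; [move=> a b ab; exact: (lefP _ _
    (nds _ _ ab) x)|apply/cvg_ex; exists (f x)].
(* Cutting the simple functions off to [K n] makes their level sets approximable; the limit is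
   unchanged because each point is eventually in [K n]. *)
pose u n x : R[i] := (s n x)%:C * chi (K n) x.
have a0 : approximable (fun=> 0).
  rewrite (_ : (fun=> 0) = chi (set0 `&` K 0%N)); first exact: aK.
  by apply/funext => x; rewrite chi_notin// set0I.
have mu_ n : approximable (u n).
  rewrite (_ : u n = fun x => \sum_(y \in range (s n)) y%:C * chi (s n @^-1` [set y] `&` K n) x).
    rewrite (_ : (fun x => _) = fun x => \sum_(y <- finmap.enum_fset (fset_set (range (s n))))
      y%:C * chi (s n @^-1` [set y] `&` K n) x); last first.
      by apply/funext => x; rewrite fsbig_finite.
    elim: (finmap.enum_fset _) => [|y r IH].
      by rewrite (_ : (fun x => _) = fun=> 0)//; apply/funext => x; rewrite big_nil.
    rewrite (_ : (fun x => _) = (fun x => y%:C * chi (s n @^-1` [set y] `&` K n) x + \sum_(y <- r)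
      y%:C * chi (s n @^-1` [set y] `&` K n) x)).
      by apply: approximable_add => //; apply: aK; exact: measurable_funPTI.
    by apply/funext => x; rewrite big_cons.
  apply/funext => x; rewrite /u [in LHS](fimfunE (s n) x) !fsbig_finite//.
  rewrite rmorph_sum mulr_suml; apply: eq_bigr => y _.
  rewrite rmorphM -mulrA; congr (_ * _).
  by rewrite /chi -rmorphM !indicE in_setI; case: (x \in _); case: (x \in K n); rewrite ?mulr0
    ?mul0r ?mulr1.
have cu x : ccvg (fun n => u n x) (f x)%:C.
  have [m _ hm] := cK x.
  have := ccvg_real (sc x); rewrite /ccvg.
  apply: cvg_trans; apply: near_eq_cvg; exists m => // n /= mn.
  by rewrite /u chi_in ?mulr1//; exact: hm.
apply: (approximable_lim (G := f) mu_ _ cu fi).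
- exact: cmeasurable_real.
- move=> n x; rewrite /u normcM normc_real ger0_norm// normr_chi.
  by apply: le_trans (sf n x); rewrite ler_piMr// indicE lern1 leq_b1.
- by move=> x; rewrite normc_real ger0_norm.
Qed.

Lemma Lp_approximable f : cLp mu k%:R f -> approximable f.
Proof.
move=> Lf; have [mf fo] := Lf.
have part (g : T -> R) : measurable_fun setT g -> (forall x, 0 <= g x <= normc (f x)) ->
    approximable (fun x => (g x)%:C).
  move=> mg gf; have g0 x : 0 <= g x by have /andP[] := gf x.
  apply: approximable_nonneg => //; apply/integrableP; split.
    by apply/measurable_EFinP; exact: (measurable_funX k mg).
  move: fo; rewrite cLnorm_lty//; apply: le_lt_trans; apply: ge0_le_integral => //.
  - by apply/measurable_EFinP; apply: measurableT_comp => //; exact: (measurable_funX k mg).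
  - by apply/measurable_EFinP; exact: measurable_pmass.
  - move=> x _; rewrite /= lee_fin ger0_norm ?exprn_ge0//.
    by rewrite lerXn2r ?nnegrE ?normc_ge0//; have /andP[] := gf x.
have posneg (g : T -> R) : measurable_fun setT g -> (forall x, `|g x| <= normc (f x)) ->
    approximable (fun x => (g x)%:C).
  move=> mg gf.
  have h1 : approximable (fun x => (Num.max (g x) 0)%:C).
    apply: part => [|x]; first exact: measurable_maxr.
    by rewrite le_max lexx orbT ge_max normc_ge0 (le_trans (ler_norm _) (gf x)).
  have h2 : approximable (fun x => (Num.max (- g x) 0)%:C).
    apply: part => [|x]; first by apply: measurable_maxr => //; exact: measurableT_comp.
    rewrite le_max lexx orbT ge_max normc_ge0 andbT; apply: le_trans (gf x).
    by rewrite -normrN ler_norm.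
  rewrite (_ : (fun x => _) = (fun x => (-1) * (Num.max (- g x) 0)%:C + (Num.max (g x) 0)%:C)).
    exact: approximable_add.
  apply/funext => x; rewrite mulN1r -rmorphN -rmorphD/=; congr (_%:C).
  by have [h|h] := leP (g x) 0; have [h'|h'] := leP (- g x) 0; lra.
have a1 := posneg _ mf.1 (fun x => normc_Re (f x)).
have a2 := posneg _ mf.2 (fun x => normc_Im (f x)).
rewrite (_ : f = fun x => 'i * (Im (f x))%:C + (Re (f x))%:C); first exact: approximable_add.
by apply/funext => x; apply: complexP; rewrite !ReImE/=; ring.
Qed.

End all_of_Lp.
End density.

Lemma chi_setX (R : realType) (T1 T2 : Type) (A : set T1) (B : set T2) z :
  chi (A `*` B) z = chi A z.1 * chi B z.2 :> R[i].
Proof. by rewrite /chi -rmorphM !indicE in_setX; case: (_ \in _); case: (_ \in _); rewrite ?mulr0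
  ?mulr1. Qed.

Section tensor_norm.
Context d1 d2 (T1 : measurableType d1) (T2 : measurableType d2) (R : realType).
Variables (m1 : {sigma_finite_measure set T1 -> \bar R}).
Variables (m2 : {sigma_finite_measure set T2 -> \bar R}).
Variable k : nat.
Hypothesis k0 : (0 < k)%N.
Implicit Types (f : T1 -> R[i]) (g : T2 -> R[i]).

Lemma pmass_tensor f g : cmeasurable f -> cmeasurable g ->
  (pmass (m1 \x m2) k (fun z => f z.1 * g z.2)%R = pmass m1 k f * pmass m2 k g)%E.
Proof.
move=> mf mg; have mF := measurable_pmass k mf; have mG := measurable_pmass k mg.
rewrite /pmass (fubini_tonelli1 (m1 := m1) (m2 := m2) (fun z => (normc (f z.1 * g z.2) ^+ k)%:E));
  last 2 first.
- apply/measurable_EFinP; apply: measurable_pmass; apply: cmeasurableM.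
  + exact: (cmeasurable_comp mf measurable_fst).
  + exact: (cmeasurable_comp mg measurable_snd).
- by move=> z; rewrite lee_fin exprn_ge0 ?normc_ge0.
rewrite muleC -ge0_integralZl//; last 3 first.
- by apply/measurable_EFinP.
- by move=> x _; rewrite lee_fin exprn_ge0 ?normc_ge0.
- exact: pmass_ge0.
apply: eq_integral => x _; rewrite /fubini_F /= muleC -ge0_integralZl//; last 3 first.
- by apply/measurable_EFinP.
- by move=> y _; rewrite lee_fin exprn_ge0 ?normc_ge0.
- by rewrite lee_fin exprn_ge0 ?normc_ge0.
by apply: eq_integral => y _; rewrite normcM exprMn EFinM.
Qed.

Lemma cLnorm_tensor f g : cmeasurable f -> cmeasurable g ->
  (cLnorm (m1 \x m2) k%:R (fun z => f z.1 * g z.2)%R = cLnorm m1 k%:R f * cLnorm m2 k%:R g)%E.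
Proof. by move=> mf mg; rewrite !cLnormE// pmass_tensor// poweRM ?pmass_ge0. Qed.

End tensor_norm.

Section euclidean_density.
Context {R : realType}.
Variable k : nat.
Hypothesis k0 : (0 < k)%N.
Local Notation mu := (@lebesgue_measure R).
Local Notation test1 := (@test_function R R^o).
Local Notation test2 := (@test_function R (R^o * R^o)%type).
Local Notation N f := (cLnorm mu k%:R f).
Local Notation N2 f := (cLnorm (mu \x mu)%E k%:R f).
Local Notation app1 := (@approximable _ (measurableTypeR R) R mu k test1).
Local Notation app2 := (@approximable _ _ R (mu \x mu)%E k test2).

Lemma finite_itvoo (a b : R) : (mu `]a, b[%classic < +oo)%E.
Proof. by rewrite lebesgue_measure_itv/=; case: ifP => // _; rewrite -EFinB ltry. Qed.

Lemma finite_boxoo (a b : R) : ((mu \x mu) (`]a, b[%classic `*` `]a, b[%classic) < +oo)%E.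
Proof.
rewrite product_measure1E//; try exact: measurable_itv.
by rewrite lte_mul_pinfty ?ge0_fin_numE ?finite_itvoo.
Qed.

Lemma approximable_itvoo (a b : R) : app1 (chi `]a, b[%classic).
Proof.
have mI : measurable (`]a, b[%classic : set (measurableTypeR R)) by exact: measurable_itv.
have H := (@approximable_lim_in _ (measurableTypeR R) R mu k test1 k0 (fun f => @test1_Lp R f k
  k0) _ mI (finite_itvoo a b) (fun n x => (bump n a b x)%:C)).
apply: H.
- move=> n; apply: test_approximable => //; first by move=> f; exact: test1_Lp.
  exact: test_bump.
- exact: cmeasurable_chi.
- by move=> x; rewrite /chi; apply: ccvg_real; exact: cvg_bump.
- move=> n x; rewrite normc_real; have /andP[b0 b1] := bump_ge0_le1 n a b x.
  rewrite ger0_norm// indicE; have [h|h] := boolP (a < x < b).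
    by rewrite mem_set ?in_itv.
  by rewrite bump_out.
- by move=> x; rewrite normr_chi.
Qed.

Lemma approximable_box1 n A : measurable (A : set (measurableTypeR R)) ->
  app1 (chi (A `&` `](- n%:R)%R, n%:R[%classic)).
Proof.
have H := (@approximable_dynkin _ (measurableTypeR R) R mu k test1 k0 (test_function_add
  compact_ball1) (fun f => @test1_Lp R f k k0) _ _ _ (@RGenOInfty.G R)).
apply: H.
- exact: measurable_itv.
- exact: finite_itvoo.
- exact: RGenOInfty.measurableE.
- move=> _ _ [x ->] [y ->]; exists (Num.max x y).
  by apply/seteqP; split => z /=; rewrite !in_itv/= !andbT gt_max => /andP.
- exact: approximable_itvoo.
- move=> _ [x ->]; rewrite (_ : _ `&` _ = `](Num.max x (- n%:R)), n%:R[%classic).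
    exact: approximable_itvoo.
  apply/seteqP; split => z /=; rewrite !in_itv/= !andbT gt_max.
    by move=> [-> /andP[-> ->]].
  by move=> /andP[/andP[-> ->] ->].
Qed.

Lemma near_box (x : R) : \forall n \near \oo, `](- n%:R)%R, n%:R[%classic x.
Proof.
near=> n; rewrite /= in_itv/= -ltr_norml; near: n.
exact: nbhs_infty_gtr.
Unshelve. all: by end_near.
Qed.

Lemma test1_dense f : cLp mu k%:R f -> forall e : R, 0 < e ->
  exists2 g, test1 g & (N (fun x => f x - g x)%R <= e%:E)%E.
Proof.
move=> Lf; have [] := @Lp_approximable _ (measurableTypeR R) R mu k test1 k0 (test_function_add
  compact_ball1) (fun f => @test1_Lp R f k k0) (fun n => `](- n%:R)%R, n%:R[%classic) near_box
  approximable_box1 f Lf.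
by [].
Qed.

Lemma approximable_tensor f g : app1 f -> app1 g -> app2 (fun z => f z.1 * g z.2).
Proof.
move=> [Lf af] [Lg ag]; have [mf fo] := Lf; have [mg go] := Lg.
have mT (u v : R -> R[i]) : cmeasurable (u : measurableTypeR R -> _) -> cmeasurable (v :
  measurableTypeR R -> _) ->
    cmeasurable (fun z : R * R => u z.1 * v z.2).
  move=> h1 h2; apply: cmeasurableM.
  + exact: (cmeasurable_comp h1 measurable_fst).
  + exact: (cmeasurable_comp h2 measurable_snd).
have fin u : (N u < +oo)%E -> N u = (fine (N u))%:E.
  by move=> h; rewrite fineK// ge0_fin_numE// cLnorm_ge0.
split; first split; first exact: mT.
  by rewrite cLnorm_tensor// (fin f)// (fin g)// -EFinM ltry.
have nf0 : 0 <= fine (N f) by rewrite fine_ge0// cLnorm_ge0.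
have ng0 : 0 <= fine (N g) by rewrite fine_ge0// cLnorm_ge0.
move: (fin _ fo) (fin _ go) nf0 ng0; set nf := fine (N f); set ng := fine (N g) => fE gE nf0 ng0 e
  e0.
have s0 : 0 < nf + ng + 1 by rewrite ltr_wpDl// addr_ge0.
(* The error will be e' ng + (nf + 1) e', where e' <= 1 is what bounds the norm of [f'] by nf +
   1. *)
pose e' := Num.min 1 (e / (nf + ng + 1)).
have e'0 : 0 < e' by rewrite lt_min ltr01 divr_gt0.
have [f' tf' Nf'] := af _ e'0; have [g' tg' Ng'] := ag _ e'0.
exists (fun z => f' z.1 * g' z.2); first exact: test_tensor.
have mf' := test1_cmeasurable tf'; have mg' := test1_cmeasurable tg'.
have mfB := cmeasurableB mf mf'; have mgB := cmeasurableB mg mg'.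
have Nf'1 : (N f' <= (nf + 1)%:E)%E.
  rewrite (_ : f' = (fun x => f x - (f x - f' x))); last by apply/funext => x; ring.
  rewrite (le_trans (cLnormB mu k0 mf mfB))// fE EFinD leeD2l//.
  by apply: le_trans Nf' _; rewrite lee_fin ge_min lexx.
rewrite (_ : (fun z => _) = (fun z => (f z.1 - f' z.1) * g z.2 + f' z.1 * (g z.2 - g' z.2))); last
  first.
  by apply/funext => z; ring.
have h1 := mT _ _ mfB mg; have h2 := mT _ _ mf' mgB.
rewrite (le_trans (cLnormD (mu \x mu)%E k0 h1 h2))//.
rewrite (cLnorm_tensor mu mu k mfB mg) (cLnorm_tensor mu mu k mf' mgB).
apply: (@le_trans _ _ (e'%:E * ng%:E + (nf + 1)%:E * e'%:E)%E).
  rewrite leeD//; first by rewrite gE lee_wpmul2r// lee_fin.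
  by apply: lee_pmul => //; exact: cLnorm_ge0.
rewrite -!EFinM -EFinD lee_fin [leLHS](_ : _ = e' * (nf + ng + 1)); last by ring.
by rewrite -ler_pdivlMr// ge_min lexx orbT.
Qed.

(** Rectangles form a class stable under intersection that generates the product sigma-algebra, and
    the indicator function of a rectangle is a tensor product. *)
Lemma test2_dense f : cLp (mu \x mu)%E k%:R f -> forall e : R, 0 < e ->
  exists2 g, test2 g & (N2 (fun x => f x - g x)%R <= e%:E)%E.
Proof.
move=> Lf; pose I n : set R := `](- n%:R)%R, n%:R[%classic.
have mI n : measurable (I n : set (measurableTypeR R)) by exact: measurable_itv.
have aI n (A B : set R) : measurable (A : set (measurableTypeR R)) -> measurable (B : set
  (measurableTypeR R)) ->
    app2 (chi ((A `*` B) `&` (I n `*` I n))).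
  move=> mA mB; have := approximable_tensor (approximable_box1 n mA) (approximable_box1 n mB).
  by congr app2; apply/funext => z; rewrite -setXI chi_setX.
have [] := @Lp_approximable _ _ R (mu \x mu)%E k test2 k0 (test_function_add compact_ball2) (fun f
  => @test2_Lp R f k k0) (fun n => I n `*` I n) _ _ f Lf.
- move=> z; have h1 := near_box z.1; have h2 := near_box z.2.
  by near=> n; split; near: n.
- move=> n A.
  apply: (@approximable_dynkin _ _ R (mu \x mu)%E k test2 k0 (test_function_add compact_ball2)
    (fun f => @test2_Lp R f k k0) _ _ _ [set A1 `*` A2 | A1 in measurable & A2 in measurable]).
  + exact: measurableX.
  + exact: finite_boxoo.
  + exact: measurable_prod_measurableType.
  + move=> _ _ [A1 mA1 [A2 mA2 <-]] [B1 mB1 [B2 mB2 <-]]; rewrite -setXI.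
    by exists (A1 `&` B1); [exact: measurableI|exists (A2 `&` B2) => //; exact: measurableI].
  + by rewrite -(setTI (I n `*` I n)) -setXTT; exact: aI.
  + by move=> _ [A1 mA1 [A2 mA2 <-]]; exact: aI.
- by [].
Unshelve. all: by end_near.
Qed.

End euclidean_density.

(** * Decay of the Fourier transform of a test function *)

Lemma integrable_scale d (T : measurableType d) (R : realType) (m : {measure set T -> \bar R})
    (c : R) (f : T -> R) :
  m.-integrable setT (fun x => (f x)%:E) -> m.-integrable setT (fun x => (c * f x)%:E).
Proof. by move=> fi; under eq_fun do rewrite EFinM; exact: integrableZl. Qed.

Section fourier_decay.
Context {R : realType}.
Local Notation mu := (@lebesgue_measure R).
Local Notation test1 := (@test_function R R^o).
Local Notation mul := (fun x y : R => x * y).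

Lemma le_dist_derive (g dg : R^o -> R) (K : R) (u v : R) :
  (forall x, is_derive x (1 : R^o) g (dg x)) -> (forall x, `|dg x| <= K) ->
  `|g u - g v| <= K * `|u - v|.
Proof.
move=> gd gK; wlog vu : u v / v <= u.
  move=> H; have [|/ltW] := leP v u; first exact: H.
  by move=> /H; rewrite distrC [`|u - v|]distrC.
have cg : {within `[v, u], continuous g}.
  apply: continuous_subspaceT => x; apply: differentiable_continuous.
  exact: differentiable_is_derive1 (gd x).
have [c _ ->] := MVT_segment vu (fun x _ => gd x) cg.
by rewrite normrM ler_wpM2r.
Qed.

Lemma smooth_is_derive1 (g : R^o -> R) x : smooth g -> is_derive x (1 : R^o) g ('D_1 g x).
Proof. by move=> sg; apply: derivableP; apply: diff_derivable; exact: smooth_differentiable. Qed.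

(** The mean value theorem twice: it bounds the derivative of [D], then [D x - D (x - h)], which is
    the second difference. *)
Lemma second_difference_le (g : R^o -> R) (K x h : R) : smooth g ->
  (forall x, `|'D_1 (fun y => 'D_1 g y : R) x| <= K) ->
  `|g (x + h) + g (x - h) - 2 * g x| <= K * h ^+ 2.
Proof.
move=> sg gK; have sg' := smooth_derive (1 : R^o) sg.
pose D u := g (u + h) - g u.
have dD u : is_derive u (1 : R^o) (D : R^o -> R) ('D_1 g (u + h) - 'D_1 g u).
  apply: is_deriveB; last exact: smooth_is_derive1.
  have hs : is_derive u (1 : R^o) (fun u : R^o => u + h : R^o) 1.
    have := is_deriveD (is_derive_id u (1 : R^o)) (is_derive_cst (h : R^o) u (1 : R^o)).
    by rewrite addr0.
  have := @is_derive1_comp R g (fun u => u + h) u _ _ (smooth_is_derive1 _ sg) hs.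
  by rewrite mulr1.
have DK u : `|'D_1 g (u + h) - 'D_1 g u| <= K * `|h|.
  have := le_dist_derive (u + h) u (fun x => smooth_is_derive1 x sg') gK.
  by rewrite addrAC subrr add0r.
have := le_dist_derive x (x - h) dD DK.
rewrite (_ : x - (x - h) = h); last by ring.
rewrite -mulrA -expr2 real_normK ?num_real//.
by congr (_ <= _); congr (`|_|); rewrite /D subrK; ring.
Qed.

Lemma derive_out (g : R^o -> R) (M : R) : (forall x, M < `|x| -> g x = 0) ->
  forall x, M < `|x| -> 'D_1 g x = 0.
Proof.
move=> gM x Mx; rewrite (near_eq_derive (g := fun=> 0)); first exact: (@derive_cst _ _ R^o).
near=> y; apply: gM; near: y.
by apply: (cvgr_gt `|x|) => //; exact: norm_continuous.
Unshelve. all: by end_near.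
Qed.

Lemma derive2_bounded (g : R^o -> R) (M : R) : smooth g -> (forall x, M < `|x| -> g x = 0) ->
  exists2 K : R, 0 <= K & forall x, `|'D_1 (fun y => 'D_1 g y : R) x| <= K.
Proof.
move=> sg gM; pose h : R^o -> R := 'D_1 (fun y => 'D_1 g y : R).
have sh : smooth h by do 2 apply: smooth_derive.
have th : test1 (fun x => (h x)%:C).
  apply/(test_functionP compact_ball1); split; first exact: csmooth_real.
  exists M => x hx; rewrite leNgt; apply: contraNN hx => Mx.
  by rewrite /h (derive_out (derive_out gM)).
have [K K0 hK] := test_function_bounded compact_ball1 th.
by exists K => // x; have := hK x; rewrite normc_real.
Qed.

Lemma fourier_translate f (s y : R) : cintegrable mu f ->
  fourier mu mul (fun x => f (x + s)) y = cis (2 * pi * (s * y)) * fourier mu mul f y.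
Proof.
move=> fi; pose F u := cis (2 * pi * (s * y)) * (cis (- (2 * pi * (u * y))) * f u).
have mm : measurable_fun setT (fun z : R * R => z.1 * z.2) by exact: measurable_funM.
have ki := cintegrable_fourier_kernel (mu := mu) (dot := mul) mm y fi.
have Fi : cintegrable mu F by exact: cintegrableZ.
have [_ E] := scales_cintegral (scales_affine s (oner_neq0 R)) Fi.
have FE : cintegral mu F = cis (2 * pi * (s * y)) * fourier mu mul f y by exact: cintegralZ.
transitivity (cintegral mu (fun x => F (1 * x + s))).
  by apply: eq_cintegral => x; rewrite /F mul1r [RHS]mulrA -cisD; congr (cis _ * _); ring.
by rewrite E normr1 invr1 -FE; exact: mul1r.
Qed.

Lemma cis_pi : cis pi = -1 :> R[i].
Proof. by rewrite /cis cospi sinpi; apply: complexP => /=; rewrite ?oppr0. Qed.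

(** Decay of order y^-2, stated through an integrable kernel proportional to 1 / (1 + y^2). A
    translation by 1 / (2y) is half a period of the character of frequency [y], so a second
    difference with that step recovers the transform without integrating by parts. *)
Lemma fourier_decay f : test1 f -> exists2 C : R, 0 <= C &
  forall y, normc (fourier mu mul f y) <= C * poisson (2 * pi) y.
Proof.
move=> tf; have fi := test1_integrable tf; have p0 := pi_gt0 R.
have /(test_functionP compact_ball1)[[s1 s2] [M0 fM0]] := tf.
pose M := Num.max M0 0.
have M_ge0 : 0 <= M by rewrite le_max lexx orbT.
have fM x : M < `|x| -> f x = 0.
  move=> Mx; apply/eqP; apply: contraTT Mx => /fM0 h.
  by rewrite -leNgt le_max h.
have [K1 K10 hK1] := derive2_bounded s1 (fun x Mx => congr1 (@complex.Re R) (fM x Mx)).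
have [K2 K20 hK2] := derive2_bounded s2 (fun x Mx => congr1 (@complex.Im R) (fM x Mx)).
have mm : measurable_fun setT (fun z : R * R => z.1 * z.2) by exact: measurable_funM.
pose C0 := Rintegral mu setT (fun x => normc (f x)).
have C0le y : normc (fourier mu mul f y) <= C0 by exact: (normc_fourier_le (mu := mu) mm).
have C00 : 0 <= C0 by apply: le_trans (C0le 0); exact: normc_ge0.
(* Obtained from 4 |F f y| <= (K1 + K2) h^2 * 2 (M + 1) with h^2 = 1 / (4 y^2); the half-length is M
   + 1 because |h| <= 1. *)
pose C1 := (K1 + K2) * (M + 1) / 8.
have C10 : 0 <= C1 by rewrite divr_ge0// mulr_ge0 ?addr_ge0.
have far y : 1 <= `|y| -> normc (fourier mu mul f y) * y ^+ 2 <= C1.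
  move=> y1; have y0 : y != 0 by rewrite -normr_gt0; exact: lt_le_trans y1.
  (* The second difference of [f] with step [h] has transform [- 4 * F f y] at [y]. *)
  pose h := (2 * y)^-1.
  have h1 : `|h| <= 1.
    rewrite /h normfV invf_le1 ?normr_gt0 ?mulf_neq0// normrM ger0_norm//.
    by apply: le_trans y1 _; rewrite ler_peMl// ler1n.
  pose g x := f (x + h) + f (x + (- h)) + (- 2) * f x.
  have hE : 2 * pi * (h * y) = pi.
    by rewrite /h; move: (pi : R) => q; field.
  have sfi s : cintegrable mu (fun x => f (x + s)).
    have [] := scales_cintegral (scales_affine s (oner_neq0 R)) fi.
    by under eq_fun do rewrite mul1r.
  have gE : fourier mu mul g y = (- 4) * fourier mu mul f y.
    rewrite /g -[LHS](_ : fourier mu mul (fun x => 1 * (1 * f (x + h) + f (x + (- h))) + (- 2) * f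
      x) y = _); last first.
      by apply: eq_cintegral => x; congr (_ * _); rewrite !mul1r.
    rewrite (fourier_add (mu := mu) mm); last 2 first.
    - by apply: cintegrableD; [exact: cintegrableZ|exact: sfi].
    - exact: cintegrableZ.
    rewrite (fourier_add (mu := mu) mm) ?sfi// !fourier_translate//.
    rewrite [fourier mu mul (fun x => (- 2) * f x) y](_ : _ = (- 2) * fourier mu mul f y).
      have -> : cis (2 * pi * (h * y)) = -1 by rewrite hE cis_pi.
      have -> : cis (2 * pi * (- h * y)) = -1.
        rewrite mulNr mulrN hE -conj_cis cis_pi.
        by apply: complexP; rewrite !ReImE/= ?oppr0.
      by ring.
    rewrite /fourier -cintegralZ; last exact: (cintegrable_fourier_kernel (mu := mu) mm).
    by apply: eq_cintegral => x; ring.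
  have gle x : normc (g x) <= (K1 + K2) * h ^+ 2 * \1_(`[- (M + 1), M + 1]%classic) x.
    rewrite indicE; have [xM|xM] := leP `|x| (M + 1).
      rewrite mem_set ?mulr1; last by rewrite /= in_itv/= -ler_norml.
      apply: le_trans (normc_le _) _; rewrite mulrDl lerD//.
      - have := second_difference_le x h s1 hK1; congr (_ <= _); congr `|_|.
        by rewrite /g !ReImE/=; ring.
      - have := second_difference_le x h s2 hK2; congr (_ <= _); congr `|_|.
        by rewrite /g !ReImE/=; ring.
    have out s : `|s| <= 1 -> f (x + s) = 0.
      move=> s1'; apply: fM; rewrite -(ltrD2r 1); apply: (lt_le_trans xM).
      rewrite -[x in leLHS](addrK s); apply: le_trans (ler_normB _ _) _.
      by rewrite lerD2l.
    have := out 0; rewrite addr0 normr0 => /(_ ler01) fx.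
    rewrite /g !out ?normrN// fx !mulr0 !addr0 normc0 mulr_ge0// mulr_ge0 ?addr_ge0//.
    exact: sqr_ge0.
  have gi : cintegrable mu g.
    by apply: cintegrableD; [apply: cintegrableD; exact: sfi|exact: cintegrableZ].
  have := normc_fourier_le (mu := mu) mm y gi; rewrite gE normcM.
  rewrite (_ : normc (- 4) = 4); last by rewrite normcN (_ : 4 = 4%:C) ?normc_real ?ger0_norm//;
    rewrite rmorph_nat.
  move=> hle.
  have : Rintegral mu setT (fun x => normc (g x)) <= (K1 + K2) * h ^+ 2 * (2 * (M + 1)).
    have mI : measurable (`[- (M + 1), M + 1]%classic : set (measurableTypeR R)) by exact:
      measurable_itv.
    have Ifin : (mu `[(- (M + 1))%R, (M + 1)%R]%classic < +oo)%E by exact: finite_box1.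
    have muI : mu `[(- (M + 1))%R, (M + 1)%R]%classic = (2 * (M + 1))%:E.
      rewrite lebesgue_measure_itv/= lte_fin ifT; last by lra.
      by rewrite -EFinB; congr (_%:E); ring.
    have -> : (K1 + K2) * h ^+ 2 * (2 * (M + 1)) =
        Rintegral mu setT (fun x => (K1 + K2) * h ^+ 2 * \1_(`[- (M + 1), M + 1]%classic) x).
      rewrite RintegralZl//; last exact: integrable_indicator.
      congr (_ * _); rewrite /Rintegral integral_indic// setIT.
      by rewrite [X in fine X](_ : _ = (2 * (M + 1))%:E)//; exact: muI.
    apply: le_Rintegral => //; first exact: cintegrable_normc.
    by apply: integrable_scale; exact: integrable_indicator.
  move=> /(le_trans hle); rewrite /h exprVn exprMn.
  have y20 : 0 < y ^+ 2 by rewrite exprn_even_gt0//= y0.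
  rewrite -(ler_pM2r y20) [leRHS](_ : _ = (K1 + K2) * (M + 1) / 2); last by field.
  by rewrite /C1; lra.
(* The kernel is the inverse of pi (1 + y^2). The first [C0] bounds the transform, and [C0 + C1]
   bounds y^2 times it, both for |y| < 1 and for |y| >= 1. *)
exists (pi * (C0 + (C0 + C1))) => [|y]; first by apply: mulr_ge0; [exact: ltW|rewrite !addr_ge0].
have pE : poisson (2 * pi) y = (pi * (1 + y ^+ 2))^-1.
  rewrite /poisson; move: p0; move: (pi : R) => q q0.
  have y2N : 1 + y ^+ 2 != 0 by rewrite gt_eqF// ltr_wpDr// sqr_ge0.
  rewrite (_ : _ + _ = 4 * q * (q * (1 + y ^+ 2))); last by ring.
  by field; rewrite y2N gt_eqF.
have y2 : 0 < 1 + y ^+ 2 by rewrite ltr_wpDr// sqr_ge0.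
rewrite pE invfM mulrACA mulfV ?gt_eqF// mul1r ler_pdivlMr// mulrDr mulr1.
rewrite lerD//; have [/far h|y1] := leP 1 `|y|; first by rewrite (le_trans h)// lerDr.
apply: (@le_trans _ _ C0); last by rewrite lerDl.
apply: le_trans (C0le y); rewrite ler_piMr ?normc_ge0//.
by rewrite -real_normK ?num_real// expr_le1// ltW.
Qed.

Lemma fourier1_integrable f : test1 f -> cintegrable mu (fourier mu mul f).
Proof.
move=> tf; have [C C0 fC] := fourier_decay tf.
have mm : measurable_fun setT (fun z : R * R => z.1 * z.2) by exact: measurable_funM.
apply: (le_cintegrable _ fC).
  exact: (cmeasurable_fourier mu mm (test1_cmeasurable tf)).
by apply: (@integrable_scale _ (measurableTypeR R) R mu); apply: integrable_poisson; rewrite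
  mulr_gt0// pi_gt0.
Qed.

End fourier_decay.

(** * Affine changes of variables and tensor products of multipliers *)

Lemma eq_cLnorm d (T : measurableType d) (R : realType) (mu : {measure set T -> \bar R}) k (f g :
  T -> R[i]) :
  (forall x, normc (f x) = normc (g x)) -> cLnorm mu k%:R f = cLnorm mu k%:R g.
Proof. by move=> fg; rewrite !cLnormE; congr (_ `^ _)%E; apply: eq_integral => x _; rewrite fg. Qed.

Section scaling_norm.
Context d (T : measurableType d) (R : realType).
Variable mu : {measure set T -> \bar R}.
Variables (phi : T -> T) (c : R) (k : nat).
Hypothesis phic : scales mu phi c.

Lemma scales_pmass f : cmeasurable f -> (pmass mu k (fun x => f (phi x)) = c%:E * pmass mu k f)%E.
Proof.
case: phic => _ _ H mf; apply: (H (fun x => (normc (f x) ^+ k)%:E)).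
- by apply/measurable_EFinP; exact: measurable_pmass.
- by move=> x; rewrite lee_fin exprn_ge0 ?normc_ge0.
Qed.

Lemma scales_cLnorm f : cmeasurable f ->
  (cLnorm mu k%:R (fun x => f (phi x)) = (c `^ k%:R^-1)%:E * cLnorm mu k%:R f)%E.
Proof.
case: (phic) => c0 _ _ mf.
by rewrite !cLnormE scales_pmass// poweRM ?pmass_ge0 ?lee_fin ?ltW// poweR_EFin.
Qed.

End scaling_norm.

Section euclidean_multipliers.
Context {R : realType}.
Local Notation mu := (@lebesgue_measure R).
Local Notation mu2 := (@lebesgue_measure R \x @lebesgue_measure R)%E.
Local Notation mu2s := (product_sigma_finite (@lebesgue_measure R) (@lebesgue_measure R)).
Local Notation test1 := (@test_function R R^o).
Local Notation test2 := (@test_function R (R^o * R^o)%type).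
Local Notation mul := (fun x y : R => x * y).
Local Notation dot := (fun x y : R * R => x.1 * y.1 + x.2 * y.2).
Local Notation T1 := (multiplier_op mu mul).
Local Notation T2 := (multiplier_op mu2 dot).
Local Notation F1 := (fourier mu mul).
Local Notation F2 := (fourier mu2 dot).

Lemma measurable_mul : measurable_fun setT (fun z : R * R => z.1 * z.2).
Proof. exact: measurable_funM. Qed.

Lemma measurable_dot : measurable_fun setT (fun z : (R * R) * (R * R) => z.1.1 * z.2.1 + z.1.2 *
  z.2.2).
Proof.
by apply: measurable_funD; apply: measurable_funM; apply: measurableT_comp.
Qed.

Lemma fourier_tensor (f1 f2 : R -> R[i]) y : cintegrable mu f1 -> cintegrable mu f2 ->
  F2 (fun z => f1 z.1 * f2 z.2) y = F1 f1 y.1 * F1 f2 y.2.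
Proof.
move=> i1 i2; rewrite -cintegral_tensor; last 2 first.
- exact: (cintegrable_fourier_kernel (mu := mu) (dot := mul) measurable_mul _ i1).
- exact: (cintegrable_fourier_kernel (mu := mu) (dot := mul) measurable_mul _ i2).
by apply: eq_cintegral => x; rewrite mulrDr opprD cisD; ring.
Qed.

Lemma multiplier_tensor (m1 m2 f1 f2 : R -> R[i]) x :
  cintegrable mu f1 -> cintegrable mu f2 ->
  admissible mu mul m1 f1 -> admissible mu mul m2 f2 ->
  T2 (fun z => m1 z.1 * m2 z.2) (fun z => f1 z.1 * f2 z.2) x = T1 m1 f1 x.1 * T1 m2 f2 x.2.
Proof.
move=> i1 i2 a1 a2; rewrite !multiplier_opE -cintegral_tensor; last 2 first.
- exact: (cintegrable_multiplier_kernel (mu := mu) (dot := mul) measurable_mul _ a1).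
- exact: (cintegrable_multiplier_kernel (mu := mu) (dot := mul) measurable_mul _ a2).
by apply: eq_cintegral => y; rewrite fourier_tensor// mulrDr cisD; ring.
Qed.

(** The transform of a test function of the plane is merely bounded here; integrability comes from
    the bounded support of [m]. *)
Lemma bounded_multiplier_admissible (m f : R * R -> R[i]) (K M : R) : cmeasurable m -> 0 <= K ->
  (forall x, normc (m x) <= K) -> (forall x, m x != 0 -> `|x.1| <= M /\ `|x.2| <= M) ->
  test2 f -> admissible mu2s dot m f.
Proof.
move=> mm K0 mK mM tf; have fi := test2_integrable tf; have mf := test2_cmeasurable tf.
pose C := Rintegral mu2 setT (fun x => normc (f x)).
have hC y : normc (F2 f y) <= C by exact: (normc_fourier_le (mu := mu2s) (dot := dot)
  measurable_dot).
have C0 : 0 <= C by apply: le_trans (hC (0, 0)); exact: normc_ge0.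
apply: (@bounded_cintegrable _ _ _ mu2 _ (`[(- M), M]%classic `*` `[(- M), M]%classic) (K * C)).
- by apply: cmeasurableM => //; exact: (cmeasurable_fourier mu2s (dot := dot) measurable_dot).
- by apply: measurableX; exact: measurable_itv.
- exact: finite_box2.
- exact: mulr_ge0.
- by move=> x; rewrite normcM ler_pM ?normc_ge0.
- move=> x h; have /mM[h1 h2] : m x != 0 by apply: contraNN h => /eqP ->; rewrite mul0r.
  by split => /=; rewrite in_itv/= -ler_norml.
Qed.

Lemma multiplier2E (m f : R * R -> R[i]) x :
  T2 m f x = cintegral mu2 (fun y => cis (2 * pi * dot x y) * (m y * F2 f y)).
Proof. by apply: eq_cintegral => y; rewrite mulrA. Qed.

Section affine.
Variables (a1 b1 a2 b2 : R).
Hypotheses (a10 : a1 != 0) (a20 : a2 != 0).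
Let phi (y : R * R) : R * R := (a1 * y.1 + b1, a2 * y.2 + b2).
Let c : R := `|a1|^-1 * `|a2|^-1.
Let scphi : scales mu2 phi c.
Proof. exact: scales_affine2. Qed.

(** Chosen so that its transform at the image of [y] under the affine map is a constant multiple of
    the transform of [f] at [y]. *)
Definition modulate (f : R * R -> R[i]) (v : R * R) : R[i] :=
  cis (2 * pi * (b1 * v.1 + b2 * v.2)) * f (a1 * v.1, a2 * v.2).

Lemma test_modulate f : test2 f -> test2 (modulate f).
Proof.
move=> tf; have := test2_cis (2 * pi * b1) (2 * pi * b2) (test2_affine 0 0 a10 a20 tf).
by congr test_function; apply/funext => v; rewrite /modulate !addr0; congr (cis _ * _); ring.
Qed.

Lemma fourier_modulate f y : test2 f -> F2 (modulate f) (phi y) = c%:C * F2 f y.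
Proof.
move=> tf; have fi := test2_integrable tf.
pose G s := cis (- (2 * pi * dot s y)) * f s.
have Gi : cintegrable mu2 G by exact: (cintegrable_fourier_kernel (mu := mu2s) (dot := dot)
  measurable_dot).
have [_ <-] := scales_cintegral (scales_affine2 0 0 a10 a20) Gi.
apply: eq_cintegral => v; rewrite /modulate /G /= !addr0 mulrA -cisD.
by congr (cis _ * _); ring.
Qed.

Lemma multiplier_affine m f x : test2 f -> admissible mu2s dot m (modulate f) ->
  T2 (fun y => m (phi y)) f x =
  cis (- (2 * pi * (x.1 / a1 * b1 + x.2 / a2 * b2))) * T2 m (modulate f) (x.1 / a1, x.2 / a2).
Proof.
move=> tf adm; pose H u := cis (2 * pi * dot (x.1 / a1, x.2 / a2) u) * (m u * F2 (modulate f) u).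
have Hi : cintegrable mu2 H by exact: (cintegrable_multiplier_kernel (mu := mu2s) (dot := dot)
  measurable_dot).
have [Hi' E] := scales_cintegral scphi Hi.
have c0 : c != 0 by rewrite /c mulf_neq0 ?invr_eq0 ?normr_eq0.
have cC : c%:C * (c^-1)%:C = 1 :> R[i] by rewrite -rmorphM mulfV.
rewrite multiplier2E [in RHS]multiplier2E -/H.
have -> : cintegral mu2 H = (c^-1)%:C * cintegral mu2 (fun y => H (phi y)).
  by rewrite E mulrA [X in X * _]mulrC cC mul1r.
rewrite mulrA -cintegralZ//; apply: eq_cintegral => y.
rewrite /H fourier_modulate// /=.
set w := (_ / _ * _ + _).
have -> : 2 * pi * (x.1 / a1 * (a1 * y.1 + b1) + x.2 / a2 * (a2 * y.2 + b2)) =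
    2 * pi * w + 2 * pi * dot x y.
  by rewrite /w /=; move: (pi : R) => q; field; rewrite a10 a20.
rewrite cisD; set e := cis (2 * pi * dot x y); set h := m _; set F := F2 _ _.
transitivity ((cis (- (2 * pi * w)) * cis (2 * pi * w)) * (c%:C * (c^-1)%:C) * (e * (h * F)));
  last by ring.
by rewrite cC -cisD addNr cis0 !mul1r.
Qed.

(** Modulations preserve the modulus, and the factors coming from the two inverse dilations cancel,
    so the constant [B] is unchanged. *)
Lemma multiplier_affine_bound (k : nat) m (B : R) : (0 < k)%N -> 0 <= B -> cmeasurable m ->
  (forall f, test2 f -> admissible mu2s dot m f) ->
  (forall f, test2 f -> (cLnorm mu2 k%:R (T2 m f) <= B%:E * cLnorm mu2 k%:R f)%E) ->
  forall f, test2 f ->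
  (cLnorm mu2 k%:R (T2 (fun y => m (phi y)) f) <= B%:E * cLnorm mu2 k%:R f)%E.
Proof.
move=> k0 B0 mm adm bd f tf; have tg := test_modulate tf.
have mf := test2_cmeasurable tf; have mg := test2_cmeasurable tg.
have mT g : test2 g -> cmeasurable (T2 m g).
  by move=> tg'; apply: (cmeasurable_multiplier_op mu2s (dot := dot) measurable_dot) => //; exact:
    test2_cmeasurable.
have i10 : a1^-1 != 0 by rewrite invr_eq0.
have i20 : a2^-1 != 0 by rewrite invr_eq0.
have sc' := scales_affine2 0 0 i10 i20; have sc := scales_affine2 0 0 a10 a20.
have -> : cLnorm mu2 k%:R (T2 (fun y => m (phi y)) f) =
    cLnorm mu2 k%:R (fun x => T2 m (modulate f) (a1^-1 * x.1 + 0, a2^-1 * x.2 + 0)).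
  apply: eq_cLnorm => x.
  rewrite multiplier_affine//; last exact: adm.
  by rewrite normcM normc_cis mul1r !addr0 [a1^-1 * _]mulrC [a2^-1 * _]mulrC.
rewrite (scales_cLnorm k sc'); last exact: mT.
apply: le_trans (lee_wpmul2l _ (bd _ tg)) _; first by rewrite lee_fin powR_ge0.
have -> : cLnorm mu2 k%:R (modulate f) = cLnorm mu2 k%:R (fun v => f (a1 * v.1 + 0, a2 * v.2 + 0)).
  apply: eq_cLnorm => x.
  by rewrite /modulate normcM normc_cis mul1r !addr0.
rewrite (scales_cLnorm k sc)// muleCA (muleA (_ `^ _)%:E) -EFinM -powRM; last 2 first.
- by rewrite mulr_ge0 ?invr_ge0.
- by rewrite mulr_ge0 ?invr_ge0.
rewrite !normfV !invrK (_ : _ * _ = 1) ?powR1 ?mul1e//.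
by field; rewrite !normr_eq0 a10 a20.
Qed.

End affine.

Section norms.
Variable k : nat.
Hypothesis k0 : (0 < k)%N.

Lemma multiplier_norm1_ge0 (m : R -> R[i]) : (0 <= multiplier_norm1 k%:R m)%E.
Proof. exact: (@multiplier_norm_ge0 _ _ R mu mul k test1 k0 m). Qed.

Lemma multiplier_norm2_ge0 (m : R * R -> R[i]) : (0 <= multiplier_norm2 k%:R m)%E.
Proof. exact: (@multiplier_norm_ge0 _ _ R mu2s dot k test2 k0 m). Qed.

Lemma multiplier_norm2_ge (m f : R * R -> R[i]) B : cmeasurable m -> test2 f ->
  (multiplier_norm2 k%:R m < B%:E)%E ->
  (cLnorm mu2 k%:R (T2 m f) <= B%:E * cLnorm mu2 k%:R f)%E.
Proof.
exact: (@multiplier_norm_ge _ _ R mu2s dot measurable_dot k test2 k0 (fun f => @test2_Lp R f k k0)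
  m f B).
Qed.

Lemma multiplier_norm2_le (m : R * R -> R[i]) (B : R) : cmeasurable m ->
  (forall f, test2 f -> admissible mu2s dot m f) -> 0 <= B ->
  (forall f, test2 f -> (cLnorm mu2 k%:R (T2 m f) <= B%:E * cLnorm mu2 k%:R f)%E) ->
  (multiplier_norm2 k%:R m <= B%:E)%E.
Proof.
exact: (@multiplier_norm_le _ _ R mu2s dot measurable_dot k test2 k0 (fun f => @test2_Lp R f k k0)
  m B
  (test_function_add compact_ball2) (test2_dense k0) (@test2_integrable R)).
Qed.

Lemma multiplier_norm1_le (m : R -> R[i]) (B : R) : cmeasurable (m : measurableTypeR R -> _) ->
  (forall f, test1 f -> admissible mu mul m f) -> 0 <= B ->
  (forall f, test1 f -> (cLnorm mu k%:R (T1 m f) <= B%:E * cLnorm mu k%:R f)%E) ->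
  (multiplier_norm1 k%:R m <= B%:E)%E.
Proof.
exact: (@multiplier_norm_le _ _ R mu mul measurable_mul k test1 k0 (fun f => @test1_Lp R f k k0) m B
  (test_function_add compact_ball1) (test1_dense k0) (@test1_integrable R)).
Qed.

End norms.
End euclidean_multipliers.

(** * The upper bound *)

(** Adding the reversed sum pairs x^j y^(n - j) with x^(n - j) y^j, and each pair is at most x^n +
    y^n. The coefficients add up to C(2n, n) by Vandermonde's identity. *)
Lemma sum_binomial_sqr_le (R : realFieldType) (n : nat) (x y : R) : 0 <= x -> 0 <= y ->
  \sum_(j < n.+1) ('C(n, j) ^ 2)%N%:R * (x ^+ j * y ^+ (n - j)) <=
  'C(n.*2, n)%:R / 2 * (x ^+ n + y ^+ n).
Proof.
move=> x0 y0; pose a j : R := ('C(n, j) ^ 2)%N%:R.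
pose S := \sum_(j < n.+1) a j * (x ^+ j * y ^+ (n - j)).
have Srev : S = \sum_(j < n.+1) a j * (x ^+ (n - j) * y ^+ j).
  rewrite /S (reindex_inj rev_ord_inj)/=; apply: eq_bigr => j _.
  have jn : (j <= n)%N by rewrite -ltnS.
  by rewrite /a subSS bin_sub// subKn.
(* The terms [j] and [n - j] have the same coefficient. *)
have pair (j : 'I_n.+1) : x ^+ j * y ^+ (n - j) + x ^+ (n - j) * y ^+ j <= x ^+ n + y ^+ n.
  have jn : (j <= n)%N by rewrite -ltnS.
  have E (z : R) : z ^+ n = z ^+ j * z ^+ (n - j) by rewrite -exprD subnKC.
  rewrite !E -subr_ge0.
  have -> : x ^+ j * x ^+ (n - j) + y ^+ j * y ^+ (n - j) - (x ^+ j * y ^+ (n - j) + x ^+ (n - j)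
    * y ^+ j) =
    (x ^+ j - y ^+ j) * (x ^+ (n - j) - y ^+ (n - j)) by ring.
  have [xy|/ltW yx] := leP x y.
    by apply: mulr_le0; rewrite subr_le0 lerXn2r ?nnegrE.
  by apply: mulr_ge0; rewrite subr_ge0 lerXn2r ?nnegrE.
have sumC : \sum_(j < n.+1) a j = 'C(n.*2, n)%:R.
  rewrite -addnn -binomial.Vandermonde natr_sum; apply: eq_bigr => j _.
  have jn : (j <= n)%N by rewrite -ltnS.
  by rewrite /a (bin_sub jn) -mulnn.
have two : 2 * S <= 'C(n.*2, n)%:R * (x ^+ n + y ^+ n).
  rewrite mulr_natl mulr2n {2}Srev -big_split/= -sumC mulr_suml; apply: ler_sum => j _.
  by rewrite -mulrDr ler_wpM2l// ler0n.
rewrite -/S; lra.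
Qed.

Section conj_sums.
Variable R : realType.

Lemma conjc_sum (I : Type) (r : seq I) (F : I -> R[i]) :
  conjc (\sum_(i <- r) F i) = \sum_(i <- r) conjc (F i).
Proof. by elim/big_rec2: _ => [|i x y _ <-]; [exact: conjc0'|rewrite conjcD]. Qed.

Lemma conjc_nat n : conjc (n%:R : R[i]) = n%:R.
Proof. by elim: n => [|n IH]; [exact: conjc0'|rewrite -natr1 conjcD IH; congr (_ + _); apply:
  complexP => //=; rewrite oppr0]. Qed.

End conj_sums.

Section cintegral_sums.
Context d (T : measurableType d) (R : realType).
Variable mu : {measure set T -> \bar R}.

Lemma cintegrable_sum (I : Type) (r : seq I) (F : I -> T -> R[i]) :
  (forall i, cintegrable mu (F i)) -> cintegrable mu (fun x => \sum_(i <- r) F i x).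
Proof.
move=> Fi; elim: r => [|i r IH].
  by under eq_fun do rewrite big_nil; exact: cintegrable0.
by under eq_fun do rewrite big_cons; exact: cintegrableD.
Qed.

Lemma cintegral_sum0 (I : Type) (r : seq I) (F : I -> T -> R[i]) :
  (forall i, cintegrable mu (F i)) -> (forall i, cintegral mu (F i) = 0) ->
  cintegral mu (fun x => \sum_(i <- r) F i x) = 0.
Proof.
move=> Fi F0; elim: r => [|i r IH].
  by under eq_cintegral do rewrite big_nil; exact: cintegral0.
under eq_cintegral do rewrite big_cons.
by rewrite cintegralD// ?F0 ?IH ?addr0//; exact: cintegrable_sum.
Qed.

End cintegral_sums.

Section separated_spectra.
Context {R : realType}.
Local Notation mu := (@lebesgue_measure R).
Local Notation mu2 := (@lebesgue_measure R \x @lebesgue_measure R)%E.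
Variables (n : nat) (t A : R) (g h : R * R -> R[i]).
Hypothesis (n0 : (0 < n)%N).
Hypotheses (A0 : 0 <= A) (tA : (n.-1)%:R * A <= 2 * t).
Hypotheses (mg : cmeasurable g) (mh : cmeasurable h).
Hypotheses (gfin : (pmass mu2 n.*2 g < +oo)%E) (hfin : (pmass mu2 n.*2 h < +oo)%E).
Hypothesis gs : forall x, spectrum_ge t (fun s => g (x, s)).
Hypothesis gcs : forall x, spectrum_ge (- (t + A)) (fun s => conjc (g (x, s))).
Hypothesis hs : forall x, spectrum_ge (- (t + A)) (fun s => h (x, s)).
Hypothesis hcs : forall x, spectrum_ge t (fun s => conjc (h (x, s))).

Let pw (f : R * R -> R[i]) z := normc (f z) ^+ n.*2.

Let integrable_pw f : cmeasurable f -> (pmass mu2 n.*2 f < +oo)%E ->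
  mu2.-integrable setT (fun z => (pw f z)%:E).
Proof.
move=> mf fo; apply/integrableP; split.
  by apply/measurable_EFinP; exact: measurable_pmass.
apply: le_lt_trans fo; rewrite /pmass le_eqVlt; apply/orP; left; apply/eqP.
by apply: eq_integral => z _; rewrite /= ger0_norm ?exprn_ge0 ?normc_ge0.
Qed.

Let term (j l : nat) z := g z ^+ j * h z ^+ (n - j) * (conjc (g z) ^+ l * conjc (h z) ^+ (n - l)).

(** The modulus is a monomial of total degree 2n in |g| and |h|, at most the larger of the two pure
    powers; this makes all terms integrable. *)
Let normc_term j l z : (j <= n)%N -> (l <= n)%N -> normc (term j l z) <= pw g z + pw h z.
Proof.
move=> jn ln; rewrite /term !normcM !normcX !normc_conj mulrACA -!exprD.
have -> : pw g z = normc (g z) ^+ (j + l) * normc (g z) ^+ (n - j + (n - l)).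
  rewrite -exprD addnACA !subnKC// addnn//.
have -> : pw h z = normc (h z) ^+ (j + l) * normc (h z) ^+ (n - j + (n - l)).
  rewrite -exprD addnACA !subnKC// addnn//.
have gz := normc_ge0 (g z); have hz := normc_ge0 (h z).
have [gh|/ltW hg] := leP (normc (g z)) (normc (h z)).
  rewrite -[leLHS]add0r lerD ?mulr_ge0 ?exprn_ge0// ler_wpM2r ?exprn_ge0//.
  by rewrite lerXn2r ?nnegrE.
rewrite -[leLHS]addr0 lerD ?mulr_ge0 ?exprn_ge0// ler_wpM2l ?exprn_ge0//.
by rewrite lerXn2r ?nnegrE.
Qed.

Let cintegrable_term j l : (j <= n)%N -> (l <= n)%N -> cintegrable mu2 (term j l).
Proof.
move=> jn ln; have mt : cmeasurable (term j l).
  by apply: cmeasurableM; apply: cmeasurableM; apply: cmeasurableX => //; exact: cmeasurable_conj.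
apply: (@le_cintegrable _ _ R mu2 (term j l) (fun z => pw g z + pw h z) mt (fun z => normc_term z
  jn ln)).
by under eq_fun do rewrite EFinD; apply: integrableD => //; exact: integrable_pw.
Qed.

Let cintegral_term_gt j l : (l < j)%N -> (j <= n)%N -> cintegral mu2 (term j l) = 0.
Proof.
move=> lj jn; have ln : (l <= n)%N by rewrite ltnW// (leq_trans lj).
have ti := cintegrable_term jn ln.
have [ti1 ->] := cintegral_prod1 ti.
rewrite -(cintegral0 mu); apply: ae_eq_cintegral.
- exact: cintegrable_cmeasurable ti1.
- exact: cmeasurable_cst.
apply: filterS (ae_cintegrable1 ti) => x xi; apply: (spectrum_ge0_cintegral _ xi).
have Hs := spectrum_geM (spectrum_geM (spectrum_geX j (gs x)) (spectrum_geX (n - j) (hs x)))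
  (spectrum_geM (spectrum_geX l (gcs x)) (spectrum_geX (n - l) (hcs x))).
apply: (spectrum_geW _ Hs); rewrite -!(mulr_natl t) -!(mulr_natl (- (t + A))) (natrB _ jn) (natrB
  _ ln).
have jlR : l%:R + 1 <= j%:R :> R by rewrite natr1 ler_nat.
have jnR : j%:R <= n%:R :> R by rewrite ler_nat.
have nE : (n.-1)%:R = n%:R - 1 :> R by rewrite -subn1 natrB.
move: tA; rewrite nE => tA'.
(* The least frequency of the product, which increases with [s]; the case [s = 1] is exactly
   [tA]. *)
have -> : j%:R * t + (n%:R - j%:R) * - (t + A) + (l%:R * - (t + A) + (n%:R - l%:R) * t) =
  (j%:R - l%:R) * (2 * t) - (n%:R - (j%:R - l%:R)) * A :> R by ring.
rewrite subr_ge0; set s : R := j%:R - l%:R.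
have s1 : 1 <= s by rewrite /s; lra.
have t0 : 0 <= 2 * t by apply: le_trans tA'; rewrite mulr_ge0// subr_ge0 ler1n.
apply: (@le_trans _ _ ((n%:R - 1) * A)).
  by rewrite ler_wpM2r// lerD2l lerN2.
by apply: le_trans tA' _; rewrite ler_peMl.
Qed.

Let cintegral_term j l : j != l -> (j <= n)%N -> (l <= n)%N -> cintegral mu2 (term j l) = 0.
Proof.
move=> jl jn ln; have [lj|jl'|jl'] := ltngtP l j; first exact: cintegral_term_gt.
(* Conjugation exchanges the roles of [j] and [l]. *)
- have ti := cintegrable_term ln jn.
  have := cintegral_conj ti; rewrite cintegral_term_gt// conjc0' => <-.
  by apply: eq_cintegral => z; rewrite /term !(conjcM, conjcX) !conjcK' mulrC.
- by rewrite jl' eqxx in jl.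
Qed.

Lemma pmass_separated :
  (pmass mu2 n.*2 (fun z => g z + h z)%R <= ('C(n.*2, n)%:R / 2)%:E * (pmass mu2 n.*2 g + pmass
    mu2 n.*2 h))%E.
Proof.
pose b j : R := 'C(n, j)%:R.
(* [D] collects the diagonal terms j = l, where the phases cancel, and [S] the other terms, whose
   integrals vanish. *)
pose D z : R := \sum_(j < n.+1) ('C(n, j) ^ 2)%N%:R * ((normc (g z) ^+ 2) ^+ j * (normc (h z) ^+
  2) ^+ (n - j)).
pose S z := \sum_(j < n.+1) \sum_(l < n.+1 | l != j) (b j * b l)%:C * term j l z.
have pw2 (u : R[i]) i : ((normc u ^+ 2) ^+ i)%:C = u ^+ i * conjc u ^+ i.
  by rewrite -exprMn mulc_conj -rmorphXn.
have E z : (pw (fun z => g z + h z) z)%:C = (D z)%:C + S z.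
  rewrite /pw -muln2 mulnC exprM rmorphXn/= -mulc_conj exprMn -conjcX.
  rewrite [g z + h z]addrC exprDn.
  have -> : conjc (\sum_(i < n.+1) h z ^+ (n - i) * g z ^+ i *+ 'C(n, i)) =
      \sum_(i < n.+1) (b i)%:C * (conjc (g z) ^+ i * conjc (h z) ^+ (n - i)).
    rewrite conjc_sum; apply: eq_bigr => i _.
    by rewrite -mulr_natl !(conjcM, conjcX) conjc_nat rmorph_nat; ring.
  rewrite mulr_suml /S rmorph_sum/= -big_split/=; apply: eq_bigr => j _.
  rewrite mulr_sumr (bigD1 j)//=; congr (_ + _).
    rewrite [RHS](_ : _ = 'C(n, j)%:R ^+ 2 * (g z ^+ j * conjc (g z) ^+ j *
        (h z ^+ (n - j) * conjc (h z) ^+ (n - j)))).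
      by rewrite -mulr_natl rmorph_nat; ring.
    rewrite -!pw2 -[in RHS](rmorph_nat (real_complex R)) -[in RHS]rmorphXn -natrX.
    by rewrite -!rmorphM.
  apply: eq_bigr => l lj.
  by rewrite -mulr_natl /term rmorphM/= !rmorph_nat; ring.
have jn (j : 'I_n.+1) : (j <= n)%N by rewrite -ltnS.
have tiZ (j l : 'I_n.+1) : cintegrable mu2 (fun z => (b j * b l)%:C * term j l z).
  by apply: cintegrableZ; exact: cintegrable_term.
have Si : cintegrable mu2 S.
  apply: cintegrable_sum => j.
  by under eq_fun do rewrite -big_filter; exact: cintegrable_sum.
have S0 : cintegral mu2 S = 0.
  apply: cintegral_sum0 => j; first by under eq_fun do rewrite -big_filter; exact: cintegrable_sum.
  rewrite (_ : (fun z => _) = fun z => \sum_(l < n.+1) (if l != j then (b j * b l)%:C else 0) *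
    term j l z); last first.
    by apply/funext => z; rewrite big_mkcond; apply: eq_bigr => l _; case: ifP; rewrite ?mul0r.
  apply: cintegral_sum0 => l; first by apply: cintegrableZ; exact: cintegrable_term.
  rewrite cintegralZ; last exact: cintegrable_term.
  by case: ifP => lj; rewrite ?mul0r// cintegral_term ?mulr0// eq_sym.
have mgh := cmeasurableD mg mh.
have ig := integrable_pw mg gfin; have ih := integrable_pw mh hfin.
have isum : mu2.-integrable setT (fun z => (pw g z + pw h z)%:E).
  by under eq_fun do rewrite EFinD; exact: integrableD.
have Dle z : D z <= 'C(n.*2, n)%:R / 2 * (pw g z + pw h z).
  apply: le_trans (sum_binomial_sqr_le n (sqr_ge0 _) (sqr_ge0 _)) _.
  by rewrite -!exprM mul2n.
have D0 z : 0 <= D z.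
  by apply: sumr_ge0 => j _; rewrite mulr_ge0 ?ler0n// mulr_ge0// exprn_ge0// sqr_ge0.
have iD2 := integrable_scale ('C(n.*2, n)%:R / 2) isum.
have iD : mu2.-integrable setT (fun z => (D z)%:E).
  apply: (le_integrable measurableT _ _ iD2).
    apply/measurable_EFinP; apply: measurable_sum => j; apply: measurable_funM => //.
    by apply: measurable_funM; apply: measurable_funX; apply: measurable_funX; exact:
      measurable_normc.
  move=> z _; rewrite /= lee_fin ger0_norm//; apply: le_trans (Dle z) _; exact: ler_norm.
have igh : mu2.-integrable setT (fun z => (pw (fun z => g z + h z) z)%:E).
  have : cintegrable mu2 (fun z => (pw (fun z => g z + h z) z)%:C).
    by under eq_fun do rewrite E; apply: cintegrableD => //; exact: cintegrable_real.
  by case.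
have RE : Rintegral mu2 setT (pw (fun z => g z + h z)) = Rintegral mu2 setT D.
  have : cintegral mu2 (fun z => (pw (fun z => g z + h z) z)%:C) = cintegral mu2 (fun z => (D
    z)%:C).
    under eq_cintegral do rewrite E.
    by rewrite cintegralD ?S0 ?addr0//; exact: cintegrable_real.
  by rewrite !cintegral_real => /(congr1 (@complex.Re R)).
have toR f : mu2.-integrable setT (fun z => (pw f z)%:E) -> pmass mu2 n.*2 f = (Rintegral mu2 setT
  (pw f))%:E.
  by move=> fi; rewrite /Rintegral fineK//; exact: integrable_fin_num.
rewrite !toR// -EFinD -EFinM lee_fin RE.
rewrite -RintegralD// -RintegralZl//.
by apply: le_Rintegral => // z _; exact: Dle.
Qed.

End separated_spectra.

Section upper_bound.
Context {R : realType}.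
Local Notation mu := (@lebesgue_measure R).
Local Notation mu2 := (@lebesgue_measure R \x @lebesgue_measure R)%E.
Local Notation mu2s := (product_sigma_finite (@lebesgue_measure R) (@lebesgue_measure R)).
Local Notation test2 := (@test_function R (R^o * R^o)%type).
Local Notation dot := (fun x y : R * R => x.1 * y.1 + x.2 * y.2).
Local Notation T2 := (multiplier_op mu2 dot).
Local Notation F2 := (fourier mu2 dot).

(** At fixed x_1 the phase in x_1 is absorbed into the amplitude; what remains is a superposition of
    characters in x_2 with frequencies y_2. *)
Let amplitude (m f : R * R -> R[i]) (x : R) y := cis (2 * pi * (x * y.1)) * (m y * F2 f y).

Let cintegrable_amplitude m f x : admissible mu2s dot m f -> cintegrable mu2 (amplitude m f x).
Proof.
by move=> adm; apply: cintegrable_cis => //; apply: measurable_funM => //; exact: measurable_funM.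
Qed.

Let amplitudeE m f x s : T2 m f (x, s) =
  cintegral mu2 (fun y => cis (2 * pi * (s * y.2)) * amplitude m f x y).
Proof.
rewrite multiplier2E; apply: eq_cintegral => y; rewrite /amplitude [RHS]mulrA -cisD.
by congr (cis _ * _) => /=; ring.
Qed.

Lemma spectrum_multiplier m f x c : admissible mu2s dot m f ->
  (forall y, m y != 0 -> c <= y.2) -> spectrum_ge c (fun s => T2 m f (x, s)).
Proof.
move=> adm mc; exists _, _, mu2s, (amplitude m f x), snd; split.
- exact: cintegrable_amplitude.
- exact: measurable_snd.
- move=> y h; apply: mc; apply: contraNN h => /eqP.
  by rewrite /amplitude => ->; rewrite mul0r mulr0.
- by move=> s; exact: amplitudeE.
Qed.

(** Conjugation reverses frequencies, so an upper bound on the support of [m] becomes a lower bound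
    on the spectrum. *)
Lemma spectrum_multiplier_conj m f x c : admissible mu2s dot m f ->
  (forall y, m y != 0 -> y.2 <= c) -> spectrum_ge (- c) (fun s => conjc (T2 m f (x, s))).
Proof.
move=> adm mc; have ai := cintegrable_amplitude x adm.
exists _, _, mu2s, (fun y => conjc (amplitude m f x y)), (fun y => - y.2); split.
- exact: cintegrable_conj.
- exact: measurableT_comp.
- move=> y h; rewrite lerN2; apply: mc; apply: contraNN h => /eqP.
  by rewrite /amplitude => ->; rewrite mul0r mulr0 conjc0'.
- move=> s; rewrite amplitudeE -cintegral_conj.
    by apply: eq_cintegral => y; rewrite conjcM conj_cis; congr (cis _ * _); ring.
  by apply: cintegrable_cis => //; apply: measurable_funM => //; exact: measurable_funM.
Qed.

Lemma multiplier_addl m1 m2 f x : admissible mu2s dot m1 f -> admissible mu2s dot m2 f ->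
  T2 (fun y => m1 y + m2 y) f x = T2 m1 f x + T2 m2 f x.
Proof.
move=> a1 a2; rewrite !multiplier2E -cintegralD; last 2 first.
- exact: (cintegrable_multiplier_kernel (mu := mu2s) (dot := dot) measurable_dot).
- exact: (cintegrable_multiplier_kernel (mu := mu2s) (dot := dot) measurable_dot).
by apply: eq_cintegral => y; ring.
Qed.

Variables (n : nat) (P : set (R * R)) (A t : R).
Hypothesis n0 : (0 < n)%N.
Hypotheses (A0 : 0 <= A) (tA : (n.-1)%:R * A <= 2 * t).
Hypothesis mP : measurable P.
Hypothesis PA : forall x, P x -> `|x.1| <= A /\ `|x.2| <= A.
Hypothesis Peven : forall x1 x2 : R, chi P (x1, - x2) = chi P (x1, x2) :> R[i].
Local Notation N f := (cLnorm mu2 n.*2%:R f).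

Let k0 : (0 < n.*2)%N. Proof. by rewrite double_gt0. Qed.
Let t0 : 0 <= t.
Proof. by rewrite -(pmulr_rge0 t (ltr0n R 2)); apply: le_trans tA; rewrite mulr_ge0. Qed.

Let m0 : R * R -> R[i] := chi (P `&` upper_half).
Let ml (y : R * R) : R[i] := m0 (1 * y.1 + 0, 1 * y.2 + (- t)).
Let mr (y : R * R) : R[i] := m0 (1 * y.1 + 0, (-1) * y.2 + (- t)).

(** Evenness in x_2 makes the lower half of [P] the mirror image of the upper one; both pieces are
    therefore affine images of [m0] and inherit its bounds. *)
Let shift_opE : shift_op t (chi P) = fun y => ml y + mr y.
Proof.
apply/funext => y; rewrite /shift_op /ml /mr /m0.
have chiI z : chi P z * chi upper_half z = chi (P `&` upper_half) z :> R[i].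
  by rewrite /chi -rmorphM !indicE in_setI; case: (_ \in _); case: (_ \in _); rewrite ?mulr0 ?mulr1.
rewrite !mul1r addr0 chiI; congr (_ + _).
rewrite -chiI -Peven; congr (chi P (_, _) * _); first by ring.
rewrite /chi !indicE; congr (_%:R%:C); congr nat_of_bool.
apply/idP/idP; rewrite !inE /lower_half/upper_half/=; lra.
Qed.

Let measurable_upper : measurable (upper_half : set (R * R)).
Proof.
have := @measurable_snd _ _ (measurableTypeR R) (measurableTypeR R) measurableT `]0, +oo[%classic
  (measurable_itv _).
by rewrite setTI; congr measurable; apply/seteqP; split => z /=; rewrite in_itv/= andbT.
Qed.

Let mm0 : cmeasurable m0.
Proof. by apply: cmeasurable_chi; exact: measurableI. Qed.

Let m0_neq0 y : m0 y != 0 -> P y /\ 0 < y.2.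
Proof.
move=> h; have [//|h'] := pselect (P y /\ 0 < y.2).
by move: h; rewrite /m0 chi_notin ?eqxx.
Qed.

Let measurable_affine2 (a1 b1 a2 b2 : R) : a1 != 0 -> a2 != 0 ->
  measurable_fun setT (fun z : R * R => (a1 * z.1 + b1, a2 * z.2 + b2)).
Proof. by move=> h1 h2; have [] := scales_affine2 b1 b2 h1 h2. Qed.

Let N10 : (-1 : R) != 0. Proof. by rewrite oppr_eq0 oner_neq0. Qed.
Let mml : cmeasurable ml.
Proof. exact: (cmeasurable_comp mm0 (measurable_affine2 0 (- t) (oner_neq0 R) (oner_neq0 R))). Qed.
Let mmr : cmeasurable mr.
Proof. exact: (cmeasurable_comp mm0 (measurable_affine2 0 (- t) (oner_neq0 R) N10)). Qed.

Let ml_neq0 y : ml y != 0 -> t <= y.2 <= t + A.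
Proof. by move=> /m0_neq0[/PA[_] /=]; rewrite ler_norml => /andP[h1 h2] h3; apply/andP; split;
  lra. Qed.
Let mr_neq0 y : mr y != 0 -> - (t + A) <= y.2 <= - t.
Proof. by move=> /m0_neq0[/PA[_] /=]; rewrite ler_norml => /andP[h1 h2] h3; apply/andP; split;
  lra. Qed.
Let mlr_neq01 y : ml y != 0 \/ mr y != 0 -> `|y.1| <= A.
Proof. by case=> /m0_neq0[/PA[/= + _] _]; rewrite mul1r addr0. Qed.

Let m_adm (m : R * R -> R[i]) f : cmeasurable m -> (forall y, normc (m y) <= 1) ->
  (forall y, m y != 0 -> `|y.1| <= A /\ `|y.2| <= t + A) -> test2 f -> admissible mu2s dot m f.
Proof.
move=> mm m1 mA tf; apply: (bounded_multiplier_admissible (K := 1) (M := t + A)) => // y /mA[h1 h2].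
by split => //; apply: le_trans h1 _; rewrite lerDr.
Qed.

Let adm0 f : test2 f -> admissible mu2s dot m0 f.
Proof.
apply: m_adm => // y; first exact: normc_le1_chi.
by move=> /m0_neq0[/PA[h1 h2] _]; split => //; apply: le_trans h2 _; rewrite lerDr.
Qed.
Let adml f : test2 f -> admissible mu2s dot ml f.
Proof.
apply: m_adm => // y; first exact: normc_le1_chi.
move=> h; split; first by apply: mlr_neq01; left.
by have := t0; have /andP[h1 h2] := ml_neq0 h => h3; rewrite ler_norml; apply/andP; split; lra.
Qed.
Let admr f : test2 f -> admissible mu2s dot mr f.
Proof.
apply: m_adm => // y; first exact: normc_le1_chi.
move=> h; split; first by apply: mlr_neq01; right.
by have := t0; have /andP[h1 h2] := mr_neq0 h => h3; rewrite ler_norml; apply/andP; split; lra.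
Qed.

Lemma cmeasurable_shift_op : cmeasurable (shift_op t (chi P)).
Proof. by rewrite shift_opE; exact: cmeasurableD. Qed.

Lemma shift_op_support y : shift_op t (chi P) y != 0 -> `|y.1| <= t + A /\ `|y.2| <= t + A.
Proof.
move=> h; have {h} : ml y != 0 \/ mr y != 0.
  move: h; rewrite shift_opE; have [->|_] := eqVneq (ml y) 0; last by left.
  by rewrite add0r; right.
move=> h; split; first by apply: (le_trans (mlr_neq01 h)); rewrite lerDr.
have ht := t0; case: h => [/ml_neq0/andP[h1 h2]|/mr_neq0/andP[h1 h2]];
  by rewrite ler_norml; apply/andP; split; lra.
Qed.

Lemma normc_shift_op y : normc (shift_op t (chi P) y) <= 2.
Proof.
rewrite shift_opE; apply: le_trans (normcD _ _) _.
by have := normc_le1_chi R (P `&` upper_half); move=> h; rewrite (_ : 2 = 1 + 1)// lerD// h.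
Qed.

Let cst : R := 'C(n.*2, n)%:R `^ (n.*2%:R^-1).

Let shift_bound (B : R) : 0 <= B -> (multiplier_norm2 n.*2%:R m0 < B%:E)%E ->
  (multiplier_norm2 n.*2%:R (shift_op t (chi P)) <= (cst * B)%:E)%E.
Proof.
move=> B0 normB.
have bd0 f : test2 f -> (N (T2 m0 f) <= B%:E * N f)%E.
  move=> tf; exact: (multiplier_norm2_ge k0 mm0 tf normB).
have bdl := multiplier_affine_bound 0 (- t) (oner_neq0 R) (oner_neq0 R) k0 B0 mm0 adm0 bd0.
have bdr := multiplier_affine_bound 0 (- t) (oner_neq0 R) N10 k0 B0 mm0 adm0 bd0.
apply: (multiplier_norm2_le k0).
- by rewrite shift_opE; exact: cmeasurableD.
- move=> f tf; rewrite shift_opE /admissible.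
  by under eq_fun do rewrite mulrDl; apply: cintegrableD; [exact: adml|exact: admr].
- by rewrite mulr_ge0// powR_ge0.
move=> f tf; have [mf fo] := test2_Lp k0 tf.
have ffin : N f \is a fin_num by rewrite ge0_fin_numE// cLnorm_ge0.
have f0 : 0 <= fine (N f) by rewrite fine_ge0// cLnorm_ge0.
have mT m : cmeasurable m -> cmeasurable (T2 m f).
  by move=> mm; exact: (cmeasurable_multiplier_op mu2s (dot := dot) measurable_dot).
have pm m : (N (T2 m f) <= B%:E * N f)%E -> (pmass mu2 n.*2 (T2 m f) <= ((B * fine (N f)) ^+
  n.*2)%:E)%E.
  by rewrite -(fineK ffin) -EFinM cLnorm_le// mulr_ge0.
have pl := pm _ (bdl _ tf); have pr := pm _ (bdr _ tf).
rewrite -/ml -/mr in pl pr.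
rewrite -(fineK ffin) -EFinM cLnorm_le//; last by rewrite !mulr_ge0// powR_ge0.
rewrite shift_opE (_ : T2 _ f = fun z => T2 ml f z + T2 mr f z); last first.
  by apply/funext => z; rewrite multiplier_addl//; [exact: adml|exact: admr].
have lty (u : \bar R) (r : R) : (u <= r%:E)%E -> (u < +oo)%E.
  by move=> h; apply: le_lt_trans h (ltry r).
apply: (le_trans (@pmass_separated R n t A (T2 ml f) (T2 mr f) n0 A0 tA (mT _ mml) (mT _ mmr) (lty
  _ _ pl) (lty _ _ pr) _ _ _ _)).
- by move=> x; apply: spectrum_multiplier; [exact: adml|move=> y /ml_neq0/andP[]].
- by move=> x; apply: spectrum_multiplier_conj; [exact: adml|move=> y /ml_neq0/andP[]].
- by move=> x; apply: spectrum_multiplier; [exact: admr|move=> y /mr_neq0/andP[]].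
- by move=> x; rewrite -[t]opprK; apply: spectrum_multiplier_conj; [exact: admr|move=> y
    /mr_neq0/andP[]].
(* Both pieces satisfy the same bound, so their number is absorbed by the factor 1/2 of
   [pmass_separated]. *)
apply: le_trans (lee_wpmul2l _ (leeD pl pr)) _; first by rewrite lee_fin divr_ge0.
rewrite -EFinD -EFinM lee_fin -mulrA !exprMn.
have -> : cst ^+ n.*2 = 'C(n.*2, n)%:R.
  rewrite /cst -powR_mulrn ?powR_ge0// -powRrM mulVf ?powRr1// ?pnatr_eq0 -?lt0n//.
by rewrite le_eqVlt; apply/orP; left; apply/eqP; field.
Qed.

Lemma multiplier_norm_shift_le :
  (multiplier_norm2 n.*2%:R (shift_op t (chi P)) <=
   ('C(n.*2, n)%:R `^ (n.*2%:R^-1))%:E * multiplier_norm2 n.*2%:R (chi (P `&` upper_half)))%E.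
Proof.
rewrite -/m0 -/cst.
have c0 : 0 < cst by rewrite /cst powR_gt0// ltr0n bin_gt0 -addnn leq_addr.
have norm0 : (0 <= multiplier_norm2 n.*2%:R m0)%E.
  exact: multiplier_norm2_ge0.
case E : (multiplier_norm2 n.*2%:R m0) norm0 => [r| |] // r0; last first.
  by rewrite mulry gtr0_sg// mul1e leey.
rewrite -EFinM; apply/lee_addgt0Pr => e e0; rewrite -EFinD.
(* [shift_bound] asks for a number strictly above the norm; this slack costs exactly [e] after
   multiplication by [cst]. *)
have re : r < r + e / cst by rewrite ltrDl divr_gt0.
apply: le_trans (shift_bound (B := r + e / cst) _ _) _.
- by rewrite ltW// (le_lt_trans _ re).
- by rewrite E lte_fin.
- by rewrite lee_fin mulrDr mulrCA mulfV ?mulr1 ?gt_eqF.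
Qed.

End upper_bound.

(** * Winding numbers of polygonal lines *)

Section angles.
Context {R : realType}.
Implicit Types (a b q : R * R).

Definition crossp a b : R := a.1 * b.2 - a.2 * b.1.
Definition dotp a b : R := a.1 * b.1 + a.2 * b.2.
Definition enorm a : R := Num.sqrt (a.1 ^+ 2 + a.2 ^+ 2).
(** This is |a| |b| (1 + cos T), where T is the angle between the vectors: the denominator in the
    half-angle formula tan (T / 2) = sin T / (1 + cos T). *)
Definition opening a b : R := enorm a * enorm b + dotp a b.

(* the signed angle from [a] to [b]; a junk value if they point in opposite directions *)
Definition angle a b : R := 2 * atan (crossp a b / opening a b).

Definition ray q z : R * R := (z.1 - q.1, z.2 - q.2).

Lemma enorm_ge0 a : 0 <= enorm a. Proof. exact: sqrtr_ge0. Qed.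

Lemma sqr_enorm a : enorm a ^+ 2 = a.1 ^+ 2 + a.2 ^+ 2.
Proof. by rewrite sqr_sqrtr// addr_ge0// sqr_ge0. Qed.

Lemma lagrange_identity a b : (enorm a * enorm b) ^+ 2 = dotp a b ^+ 2 + crossp a b ^+ 2.
Proof. by rewrite exprMn !sqr_enorm /dotp /crossp; ring. Qed.

Lemma normr_dotp_le a b : `|dotp a b| <= enorm a * enorm b.
Proof.
rewrite -(@ler_pXn2r _ 2) ?nnegrE ?mulr_ge0 ?enorm_ge0//.
by rewrite lagrange_identity real_normK ?num_real// lerDl sqr_ge0.
Qed.

Lemma normr_crossp_le a b : `|crossp a b| <= enorm a * enorm b.
Proof.
rewrite -(@ler_pXn2r _ 2) ?nnegrE ?mulr_ge0 ?enorm_ge0//.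
by rewrite lagrange_identity real_normK ?num_real// lerDr sqr_ge0.
Qed.

Lemma opening_ge0 a b : 0 <= opening a b.
Proof. by have := normr_dotp_le a b; rewrite ler_norml /opening => /andP[h _]; lra. Qed.

Lemma opening_gt0_norm a b : 0 < opening a b -> 0 < enorm a * enorm b.
Proof.
move=> h; rewrite lt_neqAle mulr_ge0 ?enorm_ge0// andbT eq_sym; apply/eqP => h0.
have := normr_dotp_le a b; rewrite h0 normr_le0 => /eqP d0.
by move: h; rewrite /opening h0 d0 addr0 ltxx.
Qed.

(** A zero opening is the case of equality in the Cauchy-Schwarz inequality with a nonpositive
    scalar product: [u] and [w] are seen from [q] in opposite directions, so [q] lies between
    them. *)
Lemma opening_gt0 (u w q : R * R) : ~ plane_segment u w q -> 0 < opening (ray q u) (ray q w).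
Proof.
move=> nq; rewrite lt_neqAle opening_ge0 andbT eq_sym; apply/eqP => h0; apply: nq.
pose x1 := u.1 - q.1; pose x2 := u.2 - q.2; pose y1 := w.1 - q.1; pose y2 := w.2 - q.2.
have dE : dotp (ray q u) (ray q w) = x1 * y1 + x2 * y2 by [].
have cE : crossp (ray q u) (ray q w) = x1 * y2 - x2 * y1 by [].
have d0 : x1 * y1 + x2 * y2 <= 0.
  by move: h0; rewrite /opening dE => h; have := mulr_ge0 (enorm_ge0 (ray q u)) (enorm_ge0 (ray q
    w)); lra.
have c0 : x1 * y2 - x2 * y1 = 0.
  apply/eqP; rewrite -sqrf_eq0 -cE; have := lagrange_identity (ray q u) (ray q w).
  rewrite (_ : enorm _ * enorm _ = - dotp (ray q u) (ray q w)); last by move: h0; rewrite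
    /opening; lra.
  by rewrite sqrrN => h; apply/eqP; lra.
pose W := (y1 - x1) ^+ 2 + (y2 - x2) ^+ 2.
have W0 : 0 <= W by rewrite addr_ge0// sqr_ge0.
have [W00|Wpos] := eqVneq W 0.
  have [e1 e2] : y1 = x1 /\ y2 = x2.
    move/eqP: W00; rewrite paddr_eq0 ?sqr_ge0// !sqrf_eq0 !subr_eq0 => /andP[/eqP -> /eqP ->].
    by [].
  move: d0; rewrite e1 e2 => d0.
  have /eqP : x1 ^+ 2 + x2 ^+ 2 = 0 by apply/eqP; rewrite eq_le !expr2 d0 -!expr2 addr_ge0//
    sqr_ge0.
  rewrite paddr_eq0 ?sqr_ge0// !sqrf_eq0 !subr_eq0 => /andP[/eqP h1 /eqP h2].
  exists 0; first by rewrite /= in_itv/= lexx ler01.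
  by rewrite !mul0r !addr0 h1 h2 -surjective_pairing.
have {}Wpos : 0 < W by rewrite lt_neqAle eq_sym Wpos.
(* The parameter of the orthogonal projection of [q] on the line through [u] and [w]; by
   collinearity the projection is [q] itself. *)
pose s := (x1 ^+ 2 + x2 ^+ 2 - (x1 * y1 + x2 * y2)) / W.
have sq1 := sqr_ge0 x1; have sq2 := sqr_ge0 x2; have sq3 := sqr_ge0 y1; have sq4 := sqr_ge0 y2.
have e1 : u.1 + s * (w.1 - u.1) = q.1.
  apply/eqP; rewrite -subr_eq0 (_ : _ - _ = (x1 * W + (x1 ^+ 2 + x2 ^+ 2 - (x1 * y1 + x2 * y2)) *
    (y1 - x1)) / W).
    rewrite (_ : _ + _ = (x1 * y2 - x2 * y1) * (y2 - x2)); last by rewrite /W; ring.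
    by rewrite c0 !mul0r.
  by rewrite /s /x1 /y1; field; rewrite gt_eqF.
have e2 : u.2 + s * (w.2 - u.2) = q.2.
  apply/eqP; rewrite -subr_eq0 (_ : _ - _ = (x2 * W + (x1 ^+ 2 + x2 ^+ 2 - (x1 * y1 + x2 * y2)) *
    (y2 - x2)) / W).
    rewrite (_ : _ + _ = - (x1 * y2 - x2 * y1) * (y1 - x1)); last by rewrite /W; ring.
    by rewrite c0 oppr0 !mul0r.
  by rewrite /s /x2 /y2; field; rewrite gt_eqF.
exists s; last by rewrite e1 e2 -surjective_pairing.
rewrite /= in_itv/=; apply/andP; split; first by rewrite /s divr_ge0//; lra.
have key : x1 ^+ 2 + x2 ^+ 2 - (x1 * y1 + x2 * y2) <= W by rewrite /W; lra.
by rewrite /s ler_pdivrMr// mul1r.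
Qed.

(** With u the tangent of the half angle, the cosine is (1 - u^2) / (1 + u^2) and the sine 2u / (1 +
    u^2); Lagrange's identity simplifies both. *)
Lemma cis_angle a b : 0 < opening a b ->
  cis (angle a b) * (enorm a * enorm b)%:C = (dotp a b +i* crossp a b).
Proof.
move=> op0; have N0 := opening_gt0_norm op0; set N := enorm a * enorm b in N0 *.
have NE := lagrange_identity a b; rewrite -/N in NE.
set u := crossp a b / opening a b; set v := atan u.
have u1 : 0 < 1 + u ^+ 2 by rewrite ltr_wpDr// sqr_ge0.
have c2 : cos v ^+ 2 = (1 + u ^+ 2)^-1.
  by rewrite /v cos_atan exprVn sqr_sqrtr// ltW.
have sc : sin v = u * cos v.
  have : tan v = u by rewrite /v atanK.
  rewrite /tan => <-; rewrite mulfVK//.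
  by apply/eqP => h; move: c2; rewrite h expr0n/= => /esym/eqP; rewrite invr_eq0 gt_eqF.
have cE : cos (2 * v) = (1 - u ^+ 2) / (1 + u ^+ 2).
  by rewrite mulr_natl cos_mulr2n -mulr_natr c2; field; rewrite gt_eqF.
have sE : sin (2 * v) = 2 * u / (1 + u ^+ 2).
  by rewrite mulr_natl sin_mulr2n sc -c2; ring.
have opE : opening a b = N + dotp a b by [].
have op0' : N + dotp a b != 0 by rewrite -opE gt_eqF.
have den : (N + dotp a b) ^+ 2 + crossp a b ^+ 2 = 2 * N * (N + dotp a b).
  by rewrite (_ : crossp a b ^+ 2 = N ^+ 2 - dotp a b ^+ 2); [ring|rewrite NE; ring].
have E (x : R) : x / (1 + u ^+ 2) = x * (N + dotp a b) / (2 * N).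
  rewrite /u opE.
  have -> : 1 + (crossp a b / (N + dotp a b)) ^+ 2 = 2 * N / (N + dotp a b).
    rewrite exprMn exprVn -[1](@mulfV _ ((N + dotp a b) ^+ 2)) ?expf_neq0// -mulrDl den.
    by field; rewrite op0'.
  by field; rewrite op0' gt_eqF.
rewrite /cis /angle -/u -/v cE sE !E /u opE; apply: complexP; rewrite !ReImE/= !mulr0 ?subr0 ?add0r.
- transitivity (((N + dotp a b) ^+ 2 - crossp a b ^+ 2) / (2 * (N + dotp a b))).
    by field; rewrite op0' gt_eqF.
  rewrite (_ : crossp a b ^+ 2 = N ^+ 2 - dotp a b ^+ 2); last by rewrite NE; ring.
  by field; rewrite op0'.
- by field; rewrite op0' gt_eqF.
Qed.

Lemma continuous_ray (z : R * R) (q : R^o * R^o) :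
  {for q, continuous (fun q : R^o * R^o => (ray q z).1 : R^o)} /\
  {for q, continuous (fun q : R^o * R^o => (ray q z).2 : R^o)}.
Proof.
split; apply: (@cvgB _ R^o); try exact: cvg_cst; [exact: cvg_fst|exact: cvg_snd].
Qed.

Lemma continuous_angle (u w : R * R) (q : R^o * R^o) : ~ plane_segment u w q ->
  {for q, continuous (fun q : R^o * R^o => angle (ray q u) (ray q w) : R^o)}.
Proof.
move=> nq; have op := opening_gt0 nq.
have [u1 u2] := continuous_ray u q; have [w1 w2] := continuous_ray w q.
have cn (z : R * R) : {for q, continuous (fun q : R^o * R^o => enorm (ray q z) : R^o)}.
  have [z1 z2] := continuous_ray z q.
  apply: (continuous_comp (g := Num.sqrt : R -> R)); last exact: sqrt_continuous.
  by apply: cvgD; apply: cvgM.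
have cr : {for q, continuous (fun q : R^o * R^o => crossp (ray q u) (ray q w) / opening (ray q u)
  (ray q w) : R)}.
  apply: cvgM; first by apply: cvgB; exact: cvgM.
  apply: cvgV; first by rewrite gt_eqF.
  exact: (@cvgD _ R^o _ _ _ _ _ _ _ (cvgM (cn u) (cn w)) (@cvgD _ R^o _ _ _ _ _ _ _ (cvgM u1 w1)
    (cvgM u2 w2))).
apply: cvgM; first exact: cvg_cst.
exact: (cvg_comp _ _ cr (@continuous_atan R _)).
Qed.

Lemma continuous_sum (T : topologicalType) (I : Type) (r : seq I) (Q : pred I) (F : I -> T -> R^o)
  (x0 : T) :
  (forall i, Q i -> {for x0, continuous (F i)}) ->
  {for x0, continuous (fun x => \sum_(i <- r | Q i) F i x : R^o)}.
Proof.
move=> cF; elim: r => [|i r IH].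
  rewrite (_ : (fun x => _) = fun=> 0); first exact: cvg_cst.
  by apply/funext => x; rewrite big_nil.
rewrite (_ : (fun x => _) = fun x => (if Q i then F i x else 0) + \sum_(i <- r | Q i) F i x); last
  first.
  by apply/funext => x; rewrite big_cons; case: ifP; rewrite ?add0r.
apply: (@cvgD _ R^o); last exact: IH.
by case: ifPn => Qi; [exact: cF|exact: cvg_cst].
Qed.

Lemma normr_atan_le (x : R) : `|atan x| <= `|x|.
Proof.
have := @le_dist_derive R atan (fun x => (1 + x ^+ 2)^-1) 1 x 0 (@is_derive1_atan R).
rewrite atan0 !subr0 mul1r; apply => y.
by rewrite ger0_norm ?invr_ge0 ?addr_ge0 ?sqr_ge0// invf_le1 ?lerDl ?sqr_ge0// ltr_wpDr// sqr_ge0.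
Qed.

Lemma cis1_eq0 (x : R) : `|x| <= pi -> cis x = 1 -> x = 0.
Proof.
move=> xp /(congr1 (@complex.Re R))/= cx.
have : cos `|x| = cos 0 by rewrite cos0 -cx; case: (leP 0 x) => x0; rewrite ?(ger0_norm x0)//
  (ltr0_norm x0) cosN.
move=> /cos_inj; rewrite !in_itv/= normr_ge0 xp lexx pi_ge0 => /(_ isT isT)/eqP.
by rewrite normr_eq0 => /eqP.
Qed.

End angles.

Section winding.
Context {R : realType}.
Variables (n : nat) (v : 'I_n -> R * R).
Hypothesis n0 : (0 < n)%N.
Local Notation plane := (R^o * R^o)%type.
Let B : set (R * R) := \bigcup_i edge v i.

(** The winding number around [q], times 2 pi. *)
Definition winding (q : R * R) : R := \sum_(i < n) angle (ray q (v i)) (ray q (v (ordS i))).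

Lemma cis_sum (I : Type) (r : seq I) (F : I -> R) : cis (\sum_(i <- r) F i) = \prod_(i <- r) cis
  (F i).
Proof. by elim/big_rec2: _ => [|i x y _ <-]; [exact: cis0|rewrite cisD]. Qed.

Let not_edge q i : ~ B q -> ~ plane_segment (v i) (v (ordS i)) q.
Proof. by move=> nB e; apply: nB; exists i. Qed.

(* The factors [conj (z i) * z (i + 1)] telescope along the closed line. *)
Lemma cis_winding q : ~ B q -> cis (winding q) = 1.
Proof.
move=> nB; pose N i := enorm (ray q (v i)); pose z i : R[i] := (ray q (v i)).1 +i* (ray q (v i)).2.
have op i := opening_gt0 (@not_edge q i nB).
have ca i : cis (angle (ray q (v i)) (ray q (v (ordS i)))) * (N i * N (ordS i))%:C = conjc (z i) *
  z (ordS i).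
  rewrite cis_angle//; apply: complexP; rewrite !ReImE/= /dotp/crossp/=; ring.
have N0 i : 0 < N i.
  have := opening_gt0_norm (op i); rewrite lt_neqAle eq_sym mulf_eq0 negb_or -andbA => /andP[h _].
  by rewrite lt_neqAle eq_sym h enorm_ge0.
have ordS_inj : injective (@ordS n).
  exact: (can_inj (@ordSK n)).
have prodN : \prod_(i < n) (N i * N (ordS i))%:C = \prod_(i < n) (conjc (z i) * z (ordS i)).
  transitivity (\prod_(i < n) ((N i)%:C * (N i)%:C) : R[i]).
    under eq_bigr do rewrite rmorphM/=.
    by rewrite !big_split/=; congr (_ * _); rewrite [RHS](reindex_inj ordS_inj).
  transitivity (\prod_(i < n) (conjc (z i) * z i)).
    apply: eq_bigr => i _; rewrite -rmorphM/= -expr2 /N sqr_enorm mulrC mulc_conj sqr_normc.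
    by [].
  rewrite !big_split/=; congr (_ * _).
  by rewrite [LHS](reindex_inj ordS_inj).
have P0 : \prod_(i < n) (N i * N (ordS i))%:C != 0 :> R[i].
  apply/prodf_neq0 => i _; apply/eqP => /(congr1 (@complex.Re R))/= /eqP.
  by rewrite gt_eqF// mulr_gt0.
apply: (mulIf P0); rewrite mul1r {2}prodN cis_sum -big_split/=.
by apply: eq_bigr => i _; exact: ca.
Qed.

Lemma continuous_winding (q : plane) : ~ B q -> {for q, continuous (winding : plane -> R^o)}.
Proof.
by move=> nB; apply: continuous_sum => i _; apply: continuous_angle; exact: not_edge.
Qed.

(** From far away each edge is seen under an angle of at most 2 / n, so the sum is at most 2 <= pi
    in absolute value; as its [cis] is 1, it vanishes. *)
Lemma winding_far : exists M : R, forall q : plane, M < `|q| -> ~ B q -> winding q = 0.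
Proof.
pose V := \sum_(i < n) `|v i : plane|; pose L := 1 + \sum_(i < n) enorm (ray (v i) (v (ordS i))).
have L1 : 1 <= L by rewrite lerDl sumr_ge0// => i _; exact: enorm_ge0.
have n1 : 1 <= n%:R :> R by rewrite ler1n.
exists (V + (n%:R + 1) * L) => q qM nB; apply: cis1_eq0; last exact: cis_winding.
have iV i : `|v i : plane| <= V by rewrite /V (bigD1 i)//= lerDl sumr_ge0.
have iL i : enorm (ray (v i) (v (ordS i))) <= L.
  rewrite /L (bigD1 i)//= addrCA lerDl addr_ge0// sumr_ge0// => j _; exact: enorm_ge0.
have far i : (n%:R + 1) * L < enorm (ray q (v i)).
  have h : `|v i - q : plane| <= enorm (ray q (v i)).
    rewrite norm2_le/=; apply/andP; split; rewrite -sqrtr_sqr ler_wsqrtr//.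
      by rewrite lerDl sqr_ge0.
    by rewrite lerDr sqr_ge0.
  apply: lt_le_trans h; rewrite -(ltrD2l V); apply: lt_le_trans qM _.
  have h2 : `|q| <= `|v i : plane| + `|v i - q : plane|.
    by have := ler_normB (v i : plane) (v i - q : plane); rewrite opprB addrCA subrr addr0.
  by apply: le_trans h2 _; rewrite lerD2r.
have small i : `|angle (ray q (v i)) (ray q (v (ordS i)))| <= 2 * n%:R^-1.
  rewrite normrM ger0_norm// ler_pM2l//; apply: le_trans (normr_atan_le _) _.
  set a := ray q (v i); set b := ray q (v (ordS i)); set w := ray (v i) (v (ordS i)).
  have bE : b = (a.1 + w.1, a.2 + w.2) by rewrite /a /b /w /ray/=; congr (_, _); ring.
  have cE : crossp a b = crossp a w by rewrite bE /crossp/=; ring.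
  have dE : dotp a b = enorm a ^+ 2 + dotp a w by rewrite bE sqr_enorm /dotp/=; ring.
  have op : 0 < opening a b by apply: opening_gt0; exact: not_edge.
  have c1 := normr_crossp_le a w; have d1 := normr_dotp_le a w.
  have a0 := enorm_ge0 a; have b0 := enorm_ge0 b; have wL := iL i; have w0 := enorm_ge0 w.
  have aL := far i; rewrite -/a in aL; rewrite -/w in wL.
  have aw : enorm a * enorm w <= enorm a * L by rewrite ler_wpM2l.
  have ope : enorm a * (n%:R * L) <= opening a b.
    rewrite /opening dE; move: d1; rewrite ler_norml => /andP[d1 _].
    have h1 : 0 <= enorm a * enorm b by rewrite mulr_ge0.
    have h2 : enorm a * ((n%:R + 1) * L) <= enorm a * enorm a by rewrite ler_wpM2l// ltW.
    move: h2; rewrite expr2; lra.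
  rewrite normrM normfV (gtr0_norm op) ler_pdivrMr// cE.
  apply: le_trans c1 (le_trans aw _).
  rewrite -ler_pdivrMl ?invr_gt0 ?ltr0n// invrK.
  by apply: le_trans ope; rewrite mulrCA.
apply: le_trans (ler_norm_sum _ _ _) _.
apply: le_trans (ler_sum _ (fun i _ => small i)) _.
rewrite sumr_const card_ord -[_ *+ n]mulr_natr mulfVK; first exact: pi_ge2.
by rewrite pnatr_eq0 -lt0n.
Qed.

End winding.

(** * Points of a polygon near an axis of symmetry *)

Section plane_topology.
Context {R : realType}.
Local Notation plane := (R^o * R^o)%type.
Implicit Types (x y : R * R).

Let segment_map x y (s : R) : plane := (x.1 + s * (y.1 - x.1), x.2 + s * (y.2 - x.2)).

Let continuous_segment_map x y : continuous (segment_map x y : R -> plane).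
Proof.
have c1 (a b s : R) : (fun s => a + s * b : R^o) @ s --> (a + s * b : R^o).
  by apply: (@cvgD _ R^o); [exact: cvg_cst|apply: cvgM; [exact: cvg_id|exact: cvg_cst]].
by move=> s; exact: (cvg_pair (c1 _ _ s) (c1 _ _ s)).
Qed.

Lemma connected_plane_segment x y : connected (plane_segment x y : set plane).
Proof.
apply: (@connected_continuous_connected R plane `[0, 1]%classic (segment_map x y)).
  exact: segment_connected.
by apply: continuous_subspaceT; exact: continuous_segment_map.
Qed.

Lemma compact_plane_segment x y : compact (plane_segment x y : set plane).
Proof.
apply: (@continuous_compact R plane (segment_map x y) `[0, 1]%classic).
  by apply: continuous_subspaceT; exact: continuous_segment_map.
exact: segment_compact.
Qed.

Lemma closed_plane_segment x y : closed (plane_segment x y : set plane).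
Proof. exact: (compact_closed (@norm_hausdorff _ plane) (@compact_plane_segment x y)). Qed.

Lemma plane_segment_l x y : plane_segment x y x.
Proof.
exists 0; first by rewrite /= in_itv/= lexx ler01.
by rewrite !mul0r !addr0 -surjective_pairing.
Qed.

Lemma plane_segment_r x y : plane_segment x y y.
Proof.
exists 1; first by rewrite /= in_itv/= lexx ler01.
by rewrite [RHS]surjective_pairing; congr (_, _); ring.
Qed.

Lemma ball_plane_segment (x z : plane) e : ball x e z -> plane_segment x z `<=` ball x e.
Proof.
case: x z => [x1 x2] [z1 z2] [/= b1 b2] _ [s s01 <-]; move: s01; rewrite /= in_itv/= => /andP[s0
  s1].
have sc (a b : R) : `|a - b| < e -> `|a - (a + s * (b - a))| < e.
  move=> h; apply: le_lt_trans h.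
  rewrite opprD addrA subrr add0r normrN normrM ger0_norm// distrC.
  by rewrite ler_piMl.
by split; exact: sc.
Qed.

(** A ball contains the segments from its centre to its points, which gives local connectedness. *)
Lemma near_connected_component (U : set plane) (x : plane) : open U -> U x ->
  \forall z \near x, connected_component U x z.
Proof.
move=> oU Ux; have [e /= e0 he] := (iffLR (nbhs_ballP _ _) (open_nbhs_nbhs (conj oU Ux))).
apply/nbhs_ballP; exists e => // z xz.
apply: (connected_component_max (plane_segment_l x z) _ (@connected_plane_segment x z)
  (plane_segment_r x z)).
by apply: subset_trans he; exact: ball_plane_segment.
Qed.

End plane_topology.

Section polygon_topology.
Context {R : realType}.
Variables (n : nat) (v : 'I_n -> R * R).
Hypothesis simple_v : simple_polygonal_line v.
Local Notation plane := (R^o * R^o)%type.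
Let B : set plane := \bigcup_i edge v i.
Let P : set plane := enclosed_region B.

Let n0 : (0 < n)%N. Proof. by case: simple_v => n3 _ _ _; exact: leq_trans n3. Qed.

Lemma closed_polygonal_line : closed B.
Proof.
apply: closed_bigcup; first exact: finite_finset.
by move=> i _; exact: closed_plane_segment.
Qed.

Let openCB : open (~` B). Proof. by rewrite openC; exact: closed_polygonal_line. Qed.

(** Off the line, membership in [P] depends only on the connected component, which nearby points
    share. *)
Let near_enclosed (x : plane) : ~ B x -> \forall z \near x, P z <-> P x.
Proof.
move=> nB; apply: filterS (near_connected_component openCB nB) => z xz.
have nBz : ~ B z by exact: (connected_component_sub xz).
have E := same_connected_component xz.
split=> [] [//|[_ h]]; right; split => //; first by rewrite E.
by rewrite -E.
Qed.

Lemma closed_enclosed_region : closed P.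
Proof.
rewrite -openC openE => x nPx; have nBx : ~ B x by move=> Bx; apply: nPx; left.
by apply: filterS (near_enclosed nBx) => z [h _] /h.
Qed.

(** The winding is continuous with values in 2 pi Z. If two values differed, an intermediate value
    at positive distance at most pi from the first would have the same [cis], against [cis1_eq0]. *)
Let connected_winding (C : set plane) (x y : plane) : connected C -> C `<=` ~` B -> C x -> C y ->
  winding v x = winding v y.
Proof.
move=> cC CB; wlog xy : x y / winding v x <= winding v y.
  move=> H Cx Cy; have [|/ltW] := leP (winding v x) (winding v y); first by move=> h; exact: H.
  by move=> h; rewrite (H y x).
move=> Cx Cy; apply/eqP; rewrite eq_le xy leNgt; apply/negP => lt_xy.
have /connected_intervalP itv : connected ((winding v : plane -> R) @` C).
  apply: connected_continuous_connected => //.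
  apply: continuous_in_subspaceT => z; rewrite inE => Cz; exact: (continuous_winding (CB _ Cz)).
have p0 := pi_gt0 R.
pose e := Num.min pi (winding v y - winding v x).
have e0 : 0 < e by rewrite lt_min p0 subr_gt0.
have [z Cz zE] : ((winding v : plane -> R) @` C) (winding v x + e).
  apply: (itv (winding v x) (winding v y)); [by exists x|by exists y|].
  by rewrite lerDl ltW//= -lerBrDl /e ge_min lexx orbT.
have := cis_winding (CB _ Cz); rewrite zE cisD (cis_winding (CB _ Cx)) mul1r => /cis1_eq0.
rewrite gtr0_norm// {1}/e ge_min lexx => /(_ isT) e00.
by move: e0; rewrite e00 ltxx.
Qed.

(** A point outside [P] lies in an unbounded component, which contains points to which [winding_far]
    applies. *)
Lemma winding_outside (x : plane) : ~ P x -> winding v x = 0.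
Proof.
move=> nPx; have nBx : ~ B x by move=> Bx; apply: nPx; left.
have [M hM] := winding_far v n0.
have [y Cy yM] : exists2 y : plane, connected_component (~` B) x y & M < `|y|.
  apply: contrapT => h; apply: nPx; right; split => //.
  exists M; split; first exact: num_real.
  move=> K MK y Cy; rewrite /= leNgt; apply/negP => Ky; apply: h; exists y => //.
  exact: lt_trans MK Ky.
rewrite (@connected_winding (connected_component (~` B) x) x y) //.
- by apply: hM => //; exact: connected_component_sub Cy.
- exact: component_connected.
- exact: connected_component_sub.
- exact: connected_component_refl.
Qed.

(** The abscissa where the line carrying edge [i] meets the axis. For a horizontal edge the division
    by 0 returns 0, and the value is the abscissa of a vertex. *)
Let crossing i : R := (v i).1 + - (v i).2 / ((v (ordS i)).2 - (v i).2) * ((v (ordS i)).1 - (v i).1).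

Definition exceptional : set R := range (fun i => (v i).1) `|` range crossing.

Lemma countable_exceptional : countable exceptional.
Proof.
apply: finite_set_countable.
by rewrite finite_setU; split; apply: finite_image; exact: finite_finset.
Qed.

(* Apart from the exceptional abscissas, the line only meets horizontal edges
   contained in it, and only in their relative interior. *)
Let edge_on_axis (x : R) i : ~ exceptional x -> edge v i (x, 0) ->
  [/\ (v i).2 = 0, (v (ordS i)).2 = 0 & ((v i).1 - x) * ((v (ordS i)).1 - x) < 0].
Proof.
move=> nx [s]; rewrite /= in_itv/= => /andP[s0 s1] [e1 e2].
set D1 := (v (ordS i)).1 - (v i).1 in e1 *; set D2 := (v (ordS i)).2 - (v i).2 in e2 *.
have D20 : D2 = 0.
  apply/eqP; apply: contrapT => /negP D2n; apply: nx; right; exists i => //.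
  rewrite -e1; congr (_ + _ * _); apply: (mulIf D2n).
  by rewrite -/D2 mulfVK//; lra.
have v2 : (v i).2 = 0 by move: e2; rewrite D20 mulr0 addr0.
have v2' : (v (ordS i)).2 = 0 by move: D20; rewrite /D2 v2 subr0.
have x1 : x != (v i).1 by apply/eqP => h; apply: nx; left; exists i.
have x2 : x != (v (ordS i)).1 by apply/eqP => h; apply: nx; left; exists (ordS i).
split => //; rewrite (_ : _ * _ = - (s * (1 - s) * D1 ^+ 2)); last by rewrite /D1 -e1 /D1; ring.
have D1n : D1 != 0 by apply: contraNN x1 => /eqP h; rewrite -e1 h mulr0 addr0.
have sn0 : s != 0 by apply: contraNN x1 => /eqP h; rewrite -e1 h mul0r addr0.
have sn1 : s != 1 by apply: contraNN x2 => /eqP h; rewrite -e1 h mul1r /D1 addrC subrK.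
have s0' : 0 < s by rewrite lt_neqAle eq_sym sn0.
have s1' : 0 < 1 - s by rewrite subr_gt0 lt_neqAle sn1.
have D1p : 0 < D1 ^+ 2 by rewrite lt_neqAle sqr_ge0 eq_sym sqrf_eq0 D1n.
by rewrite oppr_lt0; apply: mulr_gt0 => //; exact: mulr_gt0.
Qed.

(** Two edges of a simple line can only meet at a vertex, and vertices have exceptional
    abscissas. *)
Let edge_unique (x : R) i j : ~ exceptional x -> edge v i (x, 0) -> j != i -> ~ edge v j (x, 0).
Proof.
move=> nx ei ji ej; case: simple_v => _ _ adj nadj.
have nv k : (x, 0) <> v k by move=> h; apply: nx; left; exists k => //; rewrite -h.
have [jS|jS] := eqVneq j (ordS i).
  have : (edge v i `&` edge v (ordS i)) (x, 0) by split => //; rewrite -jS.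
  by rewrite adj => /nv.
have [iS|iS] := eqVneq i (ordS j).
  have : (edge v j `&` edge v (ordS j)) (x, 0) by split => //; rewrite -iS.
  by rewrite adj => /nv.
have : (edge v i `&` edge v j) (x, 0) by [].
by rewrite nadj.
Qed.

Let angle_term i (x s : R) := angle (ray (x, s) (v i)) (ray (x, s) (v (ordS i))).

(** The reflection in the axis fixes both endpoints of the edge and reverses orientation. *)
Let angle_termN i x s : (v i).2 = 0 -> (v (ordS i)).2 = 0 -> angle_term i x (- s) = - angle_term i
  x s.
Proof.
move=> h1 h2; rewrite /angle_term /angle -mulrN -atanN -mulNr; congr (2 * atan (_ / _)).
  by rewrite /crossp /ray/= h1 h2; ring.
rewrite /opening /enorm /dotp /ray/= h1 h2 !sub0r !sqrrN; congr (_ + _); ring.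
Qed.

(* As [s] tends to 0 the edge is seen from [(x, s)] under an angle tending to [pi]. *)
Let angle_term_ge i x : (v i).2 = 0 -> (v (ordS i)).2 = 0 ->
  ((v i).1 - x) * ((v (ordS i)).1 - x) < 0 ->
  exists2 e : R, 0 < e & forall s, 0 < s < e -> pi / 2 <= `|angle_term i x s|.
Proof.
move=> h1 h2; set a1 := _ - x; set b1 := _ - x => ab.
pose w := `|b1 - a1|; pose c := - (a1 * b1).
have c0 : 0 < c by rewrite oppr_gt0.
have w0 : 0 < w.
  rewrite normr_gt0 subr_eq0; apply/eqP => h; move: ab; rewrite h -expr2.
  by rewrite ltNge sqr_ge0.
have w2 : 0 < w + 2 by rewrite ltr_wpDl// ltW.
(* With s^2 <= s, the second bound gives s w <= 2 (c - s^2), so the absolute value of [crossp] is at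
   most - 2 times [dotp]. This forces the tangent of the half angle to be at least 1 in absolute
   value. *)
exists (Num.min 1 (2 * c / (w + 2))); first by rewrite lt_min ltr01 divr_gt0// mulr_gt0.
move=> s /andP[s0]; rewrite lt_min => /andP[s1]; rewrite ltr_pdivlMr// => sw.
set a := ray (x, s) (v i); set b := ray (x, s) (v (ordS i)).
have cE : crossp a b = s * (b1 - a1) by rewrite /crossp /a /b /ray/= h1 h2 /a1 /b1; ring.
have dE : dotp a b = - c + s ^+ 2 by rewrite /dotp /a /b /ray/= h1 h2 /c /a1 /b1; ring.
have cN : `|crossp a b| = s * w by rewrite cE normrM gtr0_norm.
have cpos : 0 < `|crossp a b| by rewrite cN mulr_gt0.
have s2 : s ^+ 2 <= s by rewrite expr2 ler_piMl// ltW.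
have Nd : `|crossp a b| <= enorm a * enorm b - dotp a b.
  have := normr_dotp_le a b; rewrite ler_norml => /andP[hd _].
  by rewrite cN; move: hd; rewrite dE; lra.
have lag : opening a b * (enorm a * enorm b - dotp a b) = `|crossp a b| ^+ 2.
  rewrite real_normK ?num_real//; have := lagrange_identity a b.
  by rewrite /opening => h; rewrite (_ : crossp a b ^+ 2 = (enorm a * enorm b) ^+ 2 - dotp a b ^+
    2); [ring|rewrite h; ring].
have op : opening a b <= `|crossp a b|.
  by rewrite -(ler_pM2r cpos) -expr2 -lag ler_wpM2l// opening_ge0.
have op0 : 0 < opening a b.
  rewrite lt_neqAle opening_ge0 andbT eq_sym; apply/eqP => h.
  by move: lag; rewrite h mul0r => /esym/eqP; rewrite sqrf_eq0 gt_eqF.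
have u1 : 1 <= `|crossp a b / opening a b|.
  by rewrite normrM normfV (gtr0_norm op0) ler_pdivlMr// mul1r.
rewrite /angle_term /angle -/a -/b normrM gtr0_norm//.
have : pi / 4 <= `|atan (crossp a b / opening a b)|.
  rewrite -atan1; move: u1; rewrite ler_normr => /orP[/le_atan h|/le_atan h].
    exact: le_trans h (ler_norm _).
  by rewrite -normrN -atanN; exact: le_trans h (ler_norm _).
lra.
Qed.

Lemma enclosed_above (x : R) : ~ exceptional x -> (forall x1 x2, P (x1, - x2) <-> P (x1, x2)) ->
  P (x, 0) -> exists2 e : R, 0 < e & forall s, 0 < s < e -> P (x, s).
Proof.
move=> nx Peven Px; have [[i _ ei]|nB] := pselect (B (x, 0)); last first.
  have [e /= e0 he] := (iffLR (nbhs_ballP _ _) (near_enclosed nB)).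
  exists e => // s /andP[s0 se]; apply/(he (x, s)) => //.
  by split; rewrite /ball/= ?subrr ?normr0// sub0r normrN gtr0_norm.
have [v1 v2 v12] := edge_on_axis nx ei.
have [e1 e10 he1] := angle_term_ge v1 v2 v12.
(* The contribution of the other edges, continuous at the axis. If (x, s) and (x, - s) were both
   outside, the two vanishing windings would give 2 |angle_term| = |O(x, s) - O(x, - s)| < pi / 2,
   whereas the left side is at least pi. *)
pose O (q : plane) : R^o := \sum_(j < n | j != i) angle (ray q (v j)) (ray q (v (ordS j))).
have cO : {for ((x, 0) : plane), continuous O}.
  apply: continuous_sum => j ji; apply: continuous_angle; exact: edge_unique nx ei ji.
have p0 := pi_gt0 R.
have p4 : 0 < pi / 4 :> R by rewrite divr_gt0.
have [e2 /= e20 he2] := (iffLR (nbhs_ballP _ _) ((iffLR (cvgrPdist_lt _ _) cO) _ p4)).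
exists (Num.min e1 e2); first by rewrite lt_min e10.
move=> s /andP[s0]; rewrite lt_min => /andP[s1 s2]; apply: contrapT => nP.
have nP' : ~ P (x, - s) by move/Peven.
have wE r : winding v (x, r) = angle_term i x r + O (x, r).
  by rewrite /winding (bigD1 i).
have := winding_outside nP; have := winding_outside nP'; rewrite !wE angle_termN//.
have O1 : `|O (x, 0) - O (x, s)| < pi / 4.
  by apply: (he2 (x, s)); split; rewrite /ball/= ?subrr ?normr0// sub0r normrN gtr0_norm.
have O2 : `|O (x, 0) - O (x, - s)| < pi / 4.
  by apply: (he2 (x, - s)); split; rewrite /ball/= ?subrr ?normr0// opprK add0r gtr0_norm.
have := he1 s; rewrite s0 s1 => /(_ isT).
move: O1 O2; rewrite !ltr_norml ler_normr => /andP[h1 h2] /andP[h3 h4] /orP[h5|h5]; lra.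
Qed.

End polygon_topology.

(** * The lower bound *)

Lemma ae_imply d (T : measurableType d) (R : realType) (mu : {measure set T -> \bar R}) (P Q : T
  -> Prop) :
  (forall x, P x -> Q x) -> {ae mu, forall x, P x} -> {ae mu, forall x, Q x}.
Proof. exact: filterS. Qed.

Lemma ae_imply2 d (T : measurableType d) (R : realType) (mu : {measure set T -> \bar R}) (P P' Q :
  T -> Prop) :
  (forall x, P x -> P' x -> Q x) -> {ae mu, forall x, P x} -> {ae mu, forall x, P' x} ->
  {ae mu, forall x, Q x}.
Proof. exact: filterS2. Qed.

Section lower_bound.
Context {R : realType}.
Local Notation mu := (@lebesgue_measure R).
Local Notation mu2 := (@lebesgue_measure R \x @lebesgue_measure R)%E.
Local Notation mu2s := (product_sigma_finite (@lebesgue_measure R) (@lebesgue_measure R)).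
Local Notation test1 := (@test_function R R^o).
Local Notation test2 := (@test_function R (R^o * R^o)%type).
Local Notation mul := (fun x y : R => x * y).
Local Notation dot := (fun x y : R * R => x.1 * y.1 + x.2 * y.2).
Local Notation T1 := (multiplier_op mu mul).
Local Notation T2 := (multiplier_op mu2 dot).
Local Notation F1 := (fourier mu mul).
Local Notation F2 := (fourier mu2 dot).
Implicit Types (f : R -> R[i]).

(** On the line the support of [m] may be unbounded, as for the half-line: integrability comes from
    the decay of the transform. *)
Lemma test1_admissible (m f : R -> R[i]) (K : R) : cmeasurable (m : measurableTypeR R -> _) ->
  (forall y, normc (m y) <= K) -> test1 f -> admissible mu mul m f.
Proof. by move=> mm mK tf; apply: (cintegrable_bounded (fourier1_integrable tf) mm mK). Qed.

Lemma pmass2_transform_le (g : R -> R[i]) : cintegrable mu g ->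
  (pmass mu 2 (fun x => cintegral mu (fun y => cis (2 * pi * (x * y)) * g y)%R) <= pmass mu 2 g)%E.
Proof. exact: plancherel_le. Qed.

(** [pmass2_transform_le] has the opposite phase; a reflection of the variable turns one transform
    into the other and preserves the integral. *)
Lemma pmass2_fourier_le f : cintegrable mu f -> (pmass mu 2 (F1 f) <= pmass mu 2 f)%E.
Proof.
move=> fi; have mf := cintegrable_cmeasurable fi.
have mF : cmeasurable (F1 f) by exact: (cmeasurable_fourier mu measurable_mul mf).
have N10 : (-1 : R) != 0 by rewrite oppr_eq0 oner_neq0.
apply: le_trans (pmass2_transform_le fi).
have := scales_pmass 2 (scales_affine 0 N10) mF; rewrite normrN normr1 invr1 mul1e => <-.
rewrite le_eqVlt; apply/orP; left; apply/eqP; apply: eq_integral => x _.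
by congr (normc _ ^+ 2)%:E; apply: eq_cintegral => y; congr (cis _ * _); ring.
Qed.

(** Plancherel's inequality is used on both sides of the multiplication by [m], which does not
    increase the modulus. *)
Lemma multiplier_L2_le (m f : R -> R[i]) : cmeasurable (m : measurableTypeR R -> _) ->
  (forall y, normc (m y) <= 1) -> test1 f ->
  (cLnorm mu 2%:R (T1 m f) <= cLnorm mu 2%:R f)%E.
Proof.
move=> mm m1 tf; have fi := test1_integrable tf.
have adm := test1_admissible mm m1 tf.
have [mf] := @test1_Lp R f 2 isT tf; rewrite cLnorm_lty// => fo.
rewrite !cLnormE; apply: gt0_ler_poweR; [by rewrite invr_ge0|by rewrite in_itv/= pmass_ge0 leey|by
  rewrite in_itv/= pmass_ge0 leey|].
have -> : pmass mu 2 (T1 m f) = pmass mu 2 (fun x => cintegral mu (fun y => cis (2 * pi * (x * y))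
  * (m y * F1 f y))).
  by apply: eq_integral => x _; rewrite (multiplier_opE mu).
apply: le_trans (pmass2_transform_le adm) _.
apply: le_trans (pmass2_fourier_le fi).
have mF : cmeasurable (F1 f) by exact: (cmeasurable_fourier mu measurable_mul
  (cintegrable_cmeasurable fi)).
apply: le_pmass => //; first exact: cmeasurableM.
by apply: nearW => y; rewrite normcM ler_piMl ?normc_ge0.
Qed.

Lemma multiplier1_id f x : test1 f -> T1 (fun=> 1) f x = f x.
Proof.
move=> tf; have [K _ fK] := test_function_bounded compact_ball1 tf.
rewrite -[RHS](fourier_inversion (test1_integrable tf) fK _ (fourier1_integrable tf)).
  by apply: eq_cintegral => y; rewrite mulr1.
move=> y h h0; have [c1 c2] := test_continuous tf.
have hy : (fun n => y + h n) @ \oo --> y.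
  by rewrite -[X in _ --> X]addr0; apply: cvgD => //; exact: cvg_cst.
by apply: ccvg_ReIm; [exact: (cvg_comp _ _ hy (c1 y))|exact: (cvg_comp _ _ hy (c2 y))].
Qed.

Section product_of_norms.
Variable k : nat.
Hypothesis k0 : (0 < k)%N.
Local Notation N f := (cLnorm mu k%:R f).

(** The factor [x] may be infinite. The hypothesis then forces the operator to vanish on test
    functions, so the norm is 0, and the product is 0 by convention. *)
Lemma mule_multiplier_norm1_le (m : R -> R[i]) (x : \bar R) (C : R) : cmeasurable (m :
  measurableTypeR R -> _) ->
  (forall y, normc (m y) <= 1) -> (0 <= x)%E -> 0 <= C ->
  (forall f, test1 f -> (x * N (T1 m f) <= C%:E * N f)%E) ->
  (x * multiplier_norm1 k%:R m <= C%:E)%E.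
Proof.
move=> mm m1 x0 C0 H.
have adm f : test1 f -> admissible mu mul m f by exact: test1_admissible.
have a0 := multiplier_norm1_ge0 k0 m.
case: x x0 H => [x| |] // x0 H.
- move: x0; rewrite lee_fin le_eqVlt => /predU1P[<-|x0]; first by rewrite mul0e lee_fin.
  rewrite muleC -lee_pdivlMr// -EFinM.
  apply: multiplier_norm1_le => //; first by rewrite divr_ge0// ltW.
  move=> f tf; have := H f tf; have [_ fo] := test1_Lp k0 tf.
  rewrite -(@fineK _ (N f)) ?ge0_fin_numE ?cLnorm_ge0// -!EFinM => h.
  by rewrite mulrAC EFinM lee_pdivlMr// muleC.
- have -> : multiplier_norm1 k%:R m = 0%E; last by rewrite mule0 lee_fin.
  apply/eqP; rewrite eq_le a0 andbT; apply: multiplier_norm1_le => // f tf.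
  rewrite mul0e; have := H f tf; have [_ fo] := test1_Lp k0 tf.
  rewrite -(@fineK _ (N f)) ?ge0_fin_numE ?cLnorm_ge0// -EFinM.
  have := cLnorm_ge0 mu k (T1 m f); rewrite le_eqVlt => /predU1P[<-//|h].
  by rewrite gt0_mulye// leye_eq.
Qed.

(** One factor at a time: the previous lemma is applied with [x] the norm of [m2], then with [x] the
    norm of [T1 m1 f1]. *)
Lemma mule_multiplier_norms_le (m1 m2 : R -> R[i]) (B : R) :
  cmeasurable (m1 : measurableTypeR R -> _) -> cmeasurable (m2 : measurableTypeR R -> _) ->
  (forall y, normc (m1 y) <= 1) -> (forall y, normc (m2 y) <= 1) -> 0 <= B ->
  (forall f1 f2, test1 f1 -> test1 f2 ->
     (N (T1 m1 f1) * N (T1 m2 f2) <= B%:E * (N f1 * N f2))%E) ->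
  (multiplier_norm1 k%:R m1 * multiplier_norm1 k%:R m2 <= B%:E)%E.
Proof.
move=> mm1 mm2 m11 m21 B0 H; rewrite muleC.
apply: mule_multiplier_norm1_le => //; first exact: multiplier_norm1_ge0.
move=> f1 tf1; have [_ fo] := test1_Lp k0 tf1.
rewrite -(@fineK _ (N f1)) ?ge0_fin_numE ?cLnorm_ge0// -EFinM muleC.
apply: mule_multiplier_norm1_le => //; first exact: cLnorm_ge0.
  by rewrite mulr_ge0// fine_ge0// cLnorm_ge0.
move=> f2 tf2; rewrite EFinM -muleA fineK ?ge0_fin_numE ?cLnorm_ge0//.
exact: H.
Qed.

Section zoom.
Variables (M : R * R -> R[i]) (A K : R) (a b tau : R) (m1 m2 : R -> R[i]) (B : R).
Hypotheses (mM : cmeasurable M) (M2 : forall y, normc (M y) <= K) (K0 : 1 <= K).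
Hypothesis MA : forall y, M y != 0 -> `|y.1| <= A /\ `|y.2| <= A.
Hypotheses (a0 : a != 0) (B0 : 0 <= B).
Hypotheses (mm1 : cmeasurable (m1 : measurableTypeR R -> _)) (mm2 : cmeasurable (m2 :
  measurableTypeR R -> _)).
Hypotheses (m11 : forall y, normc (m1 y) <= 1) (m21 : forall y, normc (m2 y) <= 1).
Hypothesis normM : (multiplier_norm2 k%:R M < B%:E)%E.
Hypothesis Mlim : {ae mu2, forall y : R * R,
  ccvg (fun n => M (a * y.1 + b, n.+1%:R^-1 * y.2 + tau)) (m1 y.1 * m2 y.2)}.

(* All the zooms of [M] have the norm of [M]: apply Fatou's lemma. *)
Lemma zoom_le f1 f2 : test1 f1 -> test1 f2 ->
  (N (T1 m1 f1) * N (T1 m2 f2) <= B%:E * (N f1 * N f2))%E.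
Proof.
move=> tf1 tf2; have tf := test_tensor tf1 tf2; set f : R * R -> R[i] := (fun z => _) in tf.
have mf1 := test1_cmeasurable tf1; have mf2 := test1_cmeasurable tf2.
have a1 := test1_admissible mm1 m11 tf1; have a2 := test1_admissible mm2 m21 tf2.
have K00 : 0 <= K by exact: le_trans K0.
have mT1 (m g : R -> R[i]) : cmeasurable (m : measurableTypeR R -> _) -> test1 g -> cmeasurable
  (T1 m g : measurableTypeR R -> _).
  by move=> mm tg; apply: (cmeasurable_multiplier_op mu measurable_mul) => //; exact:
    test1_cmeasurable.
rewrite -cLnorm_tensor//; [|exact: mT1|exact: mT1].
rewrite -cLnorm_tensor// -/f.
have fin1 (g : R -> R[i]) : test1 g -> N g \is a fin_num.
  by move=> tg; rewrite ge0_fin_numE ?cLnorm_ge0//; have [] := test1_Lp k0 tg.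
have ffin : cLnorm mu2 k%:R f \is a fin_num.
  by rewrite ge0_fin_numE ?cLnorm_ge0//; have [] := test2_Lp k0 tf.
have n0 n : n.+1%:R^-1 != 0 :> R by rewrite invr_eq0 pnatr_eq0.
pose mn n y := M (a * y.1 + b, n.+1%:R^-1 * y.2 + tau).
have admM g : test2 g -> admissible mu2s dot M g.
  exact: bounded_multiplier_admissible mM K00 M2 MA.
have mmn n : cmeasurable (mn n).
  by have [_ h _] := scales_affine2 b tau a0 (n0 n); exact: (cmeasurable_comp mM h).
have bd g : test2 g -> (cLnorm mu2 k%:R (T2 M g) <= B%:E * cLnorm mu2 k%:R g)%E.
  by move=> tg; exact: multiplier_norm2_ge.
have mF := cmeasurable_fourier mu2s (dot := dot) measurable_dot (test2_cmeasurable tf).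
rewrite -(fineK ffin) -EFinM.
apply: (cLnorm_fatou k0 (u := fun n => T2 (mn n) f)).
- by rewrite mulr_ge0// fine_ge0// cLnorm_ge0.
- move=> n; apply: (cmeasurable_multiplier_op mu2s (dot := dot) measurable_dot); first exact: mmn.
  exact: test2_cmeasurable.
- by apply: cmeasurableM; [exact: (cmeasurable_comp (mT1 _ _ mm1 tf1) measurable_fst)|exact:
    (cmeasurable_comp (mT1 _ _ mm2 tf2) measurable_snd)].
- apply: nearW => x.
  rewrite -(multiplier_tensor x (test1_integrable tf1) (test1_integrable tf2) a1 a2) -/f
    multiplier2E.
  under eq_fun do rewrite multiplier2E.
  have mc : cmeasurable (fun y : R * R => cis (2 * pi * dot x y)).
    apply: cmeasurable_cis; apply: measurable_funM => //.
    by apply: measurable_funD; apply: measurable_funM.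
  have FE y : normc (F2 f y) = normc (F1 f1 y.1) * normc (F1 f2 y.2).
    by rewrite -normcM; congr normc; apply: fourier_tensor; exact: test1_integrable.
  (* The dominating function is integrable because the test function is a tensor product and
     one-dimensional transforms are integrable. *)
  apply: (cintegral_dct (g := fun y => K * (normc (F1 f1 y.1) * normc (F1 f2 y.2)))).
  + by move=> n; apply: cmeasurableM; [exact: mc|apply: cmeasurableM; [exact: mmn|exact: mF]].
  + apply: cmeasurableM; first exact: mc.
    apply: cmeasurableM; last exact: mF.
    apply: cmeasurableM.
      exact: (cmeasurable_comp mm1 measurable_fst).
    exact: (cmeasurable_comp mm2 measurable_snd).
  + apply: (ae_imply _ Mlim) => y h; apply: ccvgM; first exact: ccvg_cst.
    by apply: ccvgM; [exact: h|exact: ccvg_cst].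
  + have i1 := cintegrable_normc (fourier1_integrable tf1).
    have i2 := cintegrable_normc (fourier1_integrable tf2).
    exact: (@integrable_scale _ _ R mu2 K _ (integrable_tensor i1 i2)).
  + move=> n y; rewrite normcM normc_cis mul1r normcM FE.
    by apply: ler_wpM2r; [rewrite mulr_ge0 ?normc_ge0|exact: M2].
  + move=> y; rewrite normcM normc_cis mul1r normcM FE normcM.
    rewrite ler_wpM2r ?mulr_ge0 ?normc_ge0//; apply: le_trans K0.
    by rewrite mulr_ile1 ?normc_ge0.
- move=> n; rewrite EFinM fineK//.
  exact: (multiplier_affine_bound b tau a0 (n0 n) k0 B0 mM admM bd).
Qed.

End zoom.
End product_of_norms.
End lower_bound.

(** * Zooming at the axis of the polygon *)

Lemma chi_eq_iff (R : realType) (T1 T2 : Type) (A : set T1) (B : set T2) x y :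
  chi A x = chi B y :> R[i] -> A x <-> B y.
Proof.
move=> E; split=> hx; apply: contrapT => nx; move: E; rewrite (chi_in _ hx) chi_notin// => /eqP.
  by rewrite oner_eq0.
by rewrite eq_sym oner_eq0.
Qed.

Section null_sets.
Context {R : realType}.
Local Notation mu := (@lebesgue_measure R).
Local Notation mu2 := (@lebesgue_measure R \x @lebesgue_measure R)%E.

Lemma ae_fst (Z : set R) : measurable (Z : set (measurableTypeR R)) -> mu Z = 0%E ->
  {ae mu2, forall y : R * R, ~ Z y.1}.
Proof.
move=> mZ Z0; exists (Z `*` setT); split; first exact: measurableX.
  by transitivity (mu Z * mu setT)%E; [rewrite product_measure1E|rewrite Z0 mul0e].
by move=> y /= /contrapT.
Qed.

Lemma ae_snd (Z : set R) : measurable (Z : set (measurableTypeR R)) -> mu Z = 0%E ->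
  {ae mu2, forall y : R * R, ~ Z y.2}.
Proof.
move=> mZ Z0; exists (setT `*` Z); split; first exact: measurableX.
  by transitivity (mu setT * mu Z)%E; [rewrite product_measure1E|rewrite Z0 mule0].
by move=> y /= /contrapT.
Qed.

End null_sets.

Section symmetric_polygon.
Context {R : realType}.
Local Notation mu := (@lebesgue_measure R).
Local Notation mu2 := (@lebesgue_measure R \x @lebesgue_measure R)%E.
Local Notation plane := (R^o * R^o)%type.
Variables (P : set (R * R)) (A c d : R).
Hypotheses (hP : polygon P) (hdiam : diameter P = (2 * A)%:E).
Hypothesis heven1 : forall x1 x2 : R, chi P (- x1, x2) = chi P (x1, x2) :> R[i].
Hypothesis heven2 : forall x1 x2 : R, chi P (x1, - x2) = chi P (x1, x2) :> R[i].
Hypotheses (cd : c < d) (hseg : P `&` [set x | x.2 = 0] = plane_segment (c, 0) (d, 0)).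

Lemma closed_polygon : closed (P : set plane).
Proof. by have [n [v [sv ->]]] := hP; exact: closed_enclosed_region. Qed.

Lemma measurable_polygon : measurable P.
Proof.
rewrite -(setCK P); apply: measurableC; apply: open_measurable2.
by rewrite openC; exact: closed_polygon.
Qed.

Let dist_le x y : P x -> P y -> eucl_dist x y <= 2 * A.
Proof.
move=> Px Py; rewrite -lee_fin -hdiam; apply: ereal_sup_ubound.
by exists (x, y).
Qed.

(** A point and its mirror image in an axis are at a distance of twice the absolute value of a
    coordinate, which is at most the diameter [2 * A]. *)
Lemma polygon_bounded x : P x -> `|x.1| <= A /\ `|x.2| <= A.
Proof.
move: x => [x1 x2] Px.
have P1 : P (- x1, x2) by apply/(chi_eq_iff (heven1 x1 x2)).
have P2 : P (x1, - x2) by apply/(chi_eq_iff (heven2 x1 x2)).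
have := dist_le Px P1; have := dist_le Px P2; rewrite /eucl_dist/= !subrr !opprK expr0n/= addr0
  add0r.
have sq (x : R) : Num.sqrt ((x + x) ^+ 2) = 2 * `|x| by rewrite sqrtr_sqr -mulr2n normrMn mulr_natl.
rewrite !sq.
by move=> h1 h2; split; rewrite -(ler_pM2l (ltr0n R 2)).
Qed.

Let axis x : P (x, 0) <-> c <= x <= d.
Proof.
have dc : 0 < d - c by rewrite subr_gt0.
split=> [Px|/andP[cx xd]].
  have : (P `&` [set x | x.2 = 0]) (x, 0) by [].
  rewrite hseg => -[s /=]; rewrite in_itv/= => /andP[s0 s1] [<- _].
  rewrite lerDl mulr_ge0 ?(ltW dc)//=.
  by rewrite -lerBrDl ler_piMl// ltW.
suff : (P `&` [set x | x.2 = 0]) (x, 0) by case.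
rewrite hseg; exists ((x - c) / (d - c)) => /=.
  by rewrite in_itv/= divr_ge0 ?subr_ge0 ?(ltW cd)//= ler_pdivrMr// mul1r lerD2r.
by rewrite subrr mulr0 addr0 divfK ?gt_eqF// addrC subrK.
Qed.

(** The axis segment has positive length [d - c], which the diameter dominates. *)
Lemma polygon_radius_gt0 : 0 < A.
Proof.
have Pc : P (c, 0) by apply/axis; rewrite lexx ltW.
have Pd : P (d, 0) by apply/axis; rewrite lexx ltW.
have := dist_le Pc Pd; rewrite /eucl_dist/= subrr expr0n/= addr0 sqrtr_sqr distrC.
have dc : 0 < d - c by rewrite subr_gt0.
by rewrite gtr0_norm//; lra.
Qed.

(** Over the segment this is [enclosed_above]; elsewhere the complement of the closed set [P] is
    open. *)
Lemma polygon_near_axis : exists2 E : set R, countable E &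
  forall x, ~ E x -> exists2 e : R, 0 < e & forall s, 0 < s < e ->
    chi P (x, s) = chi `[c, d]%classic x :> R[i].
Proof.
have [n [v [sv PE]]] := hP.
exists (exceptional v); first exact: countable_exceptional.
move=> x nx; have [/axis Px|nPx] := pselect (c <= x <= d).
  have Peven x1 x2 : enclosed_region (\bigcup_i edge v i) (x1, - x2) <-> enclosed_region
    (\bigcup_i edge v i) (x1, x2).
    by rewrite -PE; exact: chi_eq_iff (heven2 x1 x2).
  have [|e e0 he] := enclosed_above sv nx Peven; first by rewrite -PE.
  exists e => // s /he; rewrite -PE => Ps; rewrite !chi_in//.
  by rewrite /= in_itv/=; apply/axis.
have nP : (~` P) (x, 0) by move/axis.
have oC : open (~` P : set plane) by rewrite openC; exact: closed_polygon.
have [e /= e0 he] := (iffLR (nbhs_ballP _ _) (open_nbhs_nbhs (conj oC nP))).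
exists e => // s /andP[s0 se]; rewrite [RHS]chi_notin; last by rewrite /= in_itv.
by apply: chi_notin; apply: (he (x, s)); split; rewrite /ball/= ?subrr ?normr0// sub0r normrN
  gtr0_norm.
Qed.

Section zoom_limit.
Variables (a b t : R).
Hypotheses (ab : a < b) (t0 : 0 <= t).
(** Slope and intercept of the increasing affine map that sends [a, b] onto [c, d]. *)
Let al : R := (d - c) / (b - a).
Let be : R := c - al * a.

Lemma zoom_slope_neq0 : al != 0.
Proof. by rewrite /al mulf_neq0 ?invr_eq0 ?subr_eq0 ?gt_eqF. Qed.

Let zoom_itv y : chi `[c, d]%classic (al * y + be) = chi `[a, b]%classic y :> R[i].
Proof.
have ba : 0 < b - a by rewrite subr_gt0.
have dc : 0 < d - c by rewrite subr_gt0.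
have al0 : 0 < al by rewrite divr_gt0.
have dE : d = al * b + be by rewrite /be /al; field; rewrite gt_eqF.
have cE : c = al * a + be by rewrite /be; ring.
rewrite /chi !indicE; congr (_%:R%:C); congr nat_of_bool; apply/idP/idP; rewrite !inE/= !in_itv/=.
  by rewrite {1}cE {1}dE !lerD2r !ler_pM2l.
by rewrite {1}cE {1}dE !lerD2r !ler_pM2l.
Qed.

Let zoom_cvg (y : R) : (fun n => n.+1%:R^-1 * y : R) @ \oo --> (0 : R).
Proof. by rewrite -[X in _ --> X](mul0r y); apply: cvgM; [exact: cvg_harmonic|exact: cvg_cst]. Qed.

Let ccvg_near (u : nat -> R[i]) l : (\forall n \near \oo, u n = l) -> ccvg u l.
Proof.
move=> h; rewrite /ccvg; apply: cvg_near_cst; apply: filterS h => n ->.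
by rewrite subrr normc0.
Qed.

Let zoom_pos (y1 y2 e : R) : 0 < y2 -> 0 < e ->
  (forall s, 0 < s < e -> chi P (al * y1 + be, s) = chi `[c, d]%classic (al * y1 + be) :> R[i]) ->
  \forall n \near \oo, chi P (al * y1 + be, n.+1%:R^-1 * y2) = chi `[a, b]%classic y1 :> R[i].
Proof.
move=> y20 e0 he; near=> n; rewrite -zoom_itv; apply: he.
rewrite mulr_gt0 ?invr_gt0//=.
near: n; exact: (cvgr_lt 0 (zoom_cvg y2) e e0).
Unshelve. all: by end_near.
Qed.

(** The preimage of the exceptional abscissas under the zoom is countable, hence null. *)
Let ae_good : {ae mu2, forall y : R * R, exists2 e : R, 0 < e & forall s, 0 < s < e ->
    chi P (al * y.1 + be, s) = chi `[c, d]%classic (al * y.1 + be) :> R[i]}.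
Proof.
have [E cE hE] := polygon_near_axis.
pose Z : set R := [set (x - be) / al | x in E].
have cZ : countable Z by apply: card_le_trans cE; exact: card_image_le.
have mZ : measurable (Z : set (measurableTypeR R)) by exact: countable_measurable.
apply: (ae_imply _ (ae_fst mZ (countable_lebesgue_measure0 cZ))) => y nZ.
apply: hE => Ey; apply: nZ; exists (al * y.1 + be) => //.
by rewrite addrK mulrC mulKf// zoom_slope_neq0.
Qed.

Lemma zoom_limit_gt0 : 0 < t -> {ae mu2, forall y : R * R,
  ccvg (fun n => shift_op t (chi P) (al * y.1 + be, n.+1%:R^-1 * y.2 + t))
    (chi `[a, b]%classic y.1 * chi [set x : R | 0 < x] y.2)}.
Proof.
move=> t_gt0; apply: (ae_imply _ ae_good) => y [e e0 he]; apply: ccvg_near.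
(* The height seen by the lower piece tends to 2t > 0, so this piece is eventually cut off. *)
have lower : \forall n \near \oo, chi lower_half (al * y.1 + be, n.+1%:R^-1 * y.2 + t + t) = 0 :>
  R[i].
  near=> n; apply: chi_notin; rewrite /lower_half/=; apply/negP; rewrite -leNgt.
  have : - t < n.+1%:R^-1 * y.2.
    by near: n; apply: (cvgr_gt (0 : R) (zoom_cvg y.2)); rewrite oppr_lt0.
  by move: (n.+1%:R^-1 * y.2) => u; lra.
have [y20|y20] := ltP 0 y.2.
- near=> n; rewrite /shift_op/= addrK.
  rewrite (near lower n)// mulr0 addr0 (near (zoom_pos y20 e0 he) n)//.
  have s0 : 0 < n.+1%:R^-1 * y.2 by rewrite mulr_gt0// invr_gt0.
  by rewrite [chi upper_half _]chi_in// [X in _ = _ * X]chi_in.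
- near=> n; rewrite /shift_op/= addrK.
  rewrite (near lower n)// mulr0 addr0 [chi upper_half _]chi_notin ?mulr0; last first.
    by rewrite /upper_half/=; apply/negP; rewrite -leNgt pmulr_rle0// invr_gt0.
  by rewrite [X in _ * X]chi_notin ?mulr0//=; apply/negP; rewrite -leNgt.
Unshelve. all: by end_near.
Qed.

(** At t = 0 both halves reach the axis, so the limit no longer depends on y_2. The line y_2 = 0,
    where both cut-offs vanish, is discarded as a null set. *)
Lemma zoom_limit_eq0 : {ae mu2, forall y : R * R,
  ccvg (fun n => shift_op 0 (chi P) (al * y.1 + be, n.+1%:R^-1 * y.2 + 0))
    (chi `[a, b]%classic y.1 * 1)}.
Proof.
have m0 : measurable ([set 0] : set (measurableTypeR R)) by exact: measurable_set1.
apply: (ae_imply2 _ ae_good (ae_snd m0 (lebesgue_measure_set1 0))) => y [e e0 he] /eqP y0.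
apply: ccvg_near; rewrite mulr1; have [y20|y20|y20] := ltgtP 0 y.2; last by rewrite -y20 eqxx in y0.
- near=> n; have s0 : 0 < n.+1%:R^-1 * y.2 by rewrite mulr_gt0// invr_gt0.
  rewrite /shift_op/= subr0 !addr0 (near (zoom_pos y20 e0 he) n)//.
  rewrite [chi upper_half _]chi_in// [chi lower_half _]chi_notin ?mulr0 ?mulr1 ?addr0//.
  by rewrite /lower_half/=; apply/negP; rewrite -leNgt ltW.
- have Ny2 : 0 < - y.2 by rewrite oppr_gt0.
  apply: filterS (zoom_pos Ny2 e0 he) => n hn.
  have s0 : n.+1%:R^-1 * y.2 < 0 by rewrite pmulr_rlt0// invr_gt0.
  rewrite /shift_op/= subr0 !addr0.
  rewrite [chi upper_half _]chi_notin ?mulr0 ?add0r; last first.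
    by rewrite /upper_half/=; apply/negP; rewrite -leNgt ltW.
  rewrite [chi lower_half _]chi_in// mulr1 -heven2 -mulrN.
  exact: hn.
Unshelve. all: by end_near.
Qed.

End zoom_limit.
End symmetric_polygon.

(** * Assembly of the two bounds *)

Theorem proposition4p5 (R : realType) (p : nat) (hp2 : (2 <= p)%N)
    (hp : ~~ odd p) (P : set (R * R)) (A : R) (hP : polygon P)
    (hdiam : diameter P = (2 * A)%:E)
    (heven1 : forall x1 x2 : R, chi P (- x1, x2) = chi P (x1, x2) :> R[i])
    (heven2 : forall x1 x2 : R, chi P (x1, - x2) = chi P (x1, x2) :> R[i])
    (hseg : exists c d : R, c < d /\
      P `&` [set x | x.2 = 0] = plane_segment (c, 0) (d, 0))
    (t : R) (ht : (p%:R - 2) * A / 4 <= t)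
    (a b : R) (hab : a < b) :
  (multiplier_norm1 p%:R (chi `[a, b]%classic) *
     multiplier_norm1 p%:R (chi [set x : R | (0 < x)%R])
     <= multiplier_norm2 p%:R (shift_op t (chi P)))%E /\
  (multiplier_norm2 p%:R (shift_op t (chi P))
     <= ((('C(p, p %/ 2)%N)%:R `^ (p%:R^-1) : R)%R)%:E *
        multiplier_norm2 p%:R (chi (P `&` upper_half)))%E.
Proof.
have [c [d [cd hcd]]] := hseg.
have A0 := polygon_radius_gt0 hdiam cd hcd.
have mP := measurable_polygon hP.
have PA := polygon_bounded hdiam heven1 heven2.
pose n := p./2.
have pE : p = n.*2 by rewrite /n even_halfK.
have n0 : (0 < n)%N by rewrite -double_gt0 -pE (leq_trans _ hp2).
(* The hypothesis t >= t_0, rewritten with p = 2n. *)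
have tA : (n.-1)%:R * A <= 2 * t.
  have -> : (n.-1)%:R = (p%:R - 2) / 2 :> R.
    by rewrite pE -subn1 natrB// -muln2 natrM; field.
  by move: ht; lra.
have t0 : 0 <= t.
  by rewrite -(pmulr_rge0 t (ltr0n R 2)); apply: le_trans tA; rewrite mulr_ge0// ltW.
have p0 : (0 < p)%N by rewrite (leq_trans _ hp2).
split; last first.
  have -> : (p %/ 2 = n)%N by rewrite divn2.
  have := multiplier_norm_shift_le n0 (ltW A0) tA mP PA heven2.
  by rewrite -pE.
have norm0 := multiplier_norm2_ge0 p0 (shift_op t (chi P)).
(* An infinite norm makes the bound trivial; a finite one is increased by [e] to get the strict
   inequality that [zoom_le] asks for. *)
case E : (multiplier_norm2 p%:R (shift_op t (chi P))) norm0 => [r| |] // r0; last by rewrite leey.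
apply/lee_addgt0Pr => e e0; rewrite -EFinD.
have re : (multiplier_norm2 p%:R (shift_op t (chi P)) < (r + e)%:E)%E.
  by rewrite E lte_fin ltrDl.
have re0 : 0 <= r + e by rewrite addr_ge0// ltW.
have mab : cmeasurable (chi `[a, b]%classic : measurableTypeR R -> R[i]).
  by apply: cmeasurable_chi; exact: measurable_itv.
have mpos : cmeasurable (chi [set x : R | 0 < x] : measurableTypeR R -> R[i]).
  apply: cmeasurable_chi; rewrite (_ : [set x | _] = `]0, +oo[%classic); first exact:
    measurable_itv.
  by apply/seteqP; split => x /=; rewrite in_itv/= andbT.
have slope := zoom_slope_neq0 cd hab.
(* The height [tau] and the second limit multiplier stay open, to cover t > 0 with the half-line and
   t = 0 with the constant 1. *)
have zoom tau (m2 : R -> R[i]) (mm2 : cmeasurable (m2 : measurableTypeR R -> R[i]))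
    (m21 : forall y, normc (m2 y) <= 1) :=
  @zoom_le R p p0 (shift_op t (chi P)) (t + A) 2 _ (c - (d - c) / (b - a) * a) tau
    (chi `[a, b]%classic) m2 (r + e) (cmeasurable_shift_op t mP heven2)
    (normc_shift_op t heven2) (ltW (ltr1n R 2))
    (shift_op_support (ltW A0) tA PA heven2) slope re0 mab mm2 (normc_le1_chi _ _) m21 re.
apply: mule_multiplier_norms_le => //; try exact: normc_le1_chi.
move: t0; rewrite le_eqVlt => /predU1P[t0|t0] f1 f2 tf1 tf2; last first.
  apply: (zoom t _ mpos (normc_le1_chi _ _)) => //.
  exact: (zoom_limit_gt0 hP heven2 cd hcd hab t0).
have p2 : p = 2.
  apply/eqP; rewrite eqn_leq hp2 andbT -(ler_nat R) -subr_le0.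
  by rewrite -(pmulr_lle0 _ A0); move: ht; rewrite -t0; lra.
have one1 (y : R) : normc (1 : R[i]) <= 1 by rewrite normc1.
have lim0 := zoom_limit_eq0 hP heven2 cd hcd hab.
rewrite [X in shift_op X]t0 in lim0.
have mc1 : cmeasurable ((fun=> 1) : measurableTypeR R -> R[i]) by exact: cmeasurable_cst.
(* For p = 2 the half-line multiplier does not increase the norm of [f2], whereas the multiplier 1
   reproduces [f2]; the estimate for the latter therefore implies the wanted one. *)
have Z2 := zoom 0 (fun=> 1) mc1 one1 lim0.
have L2 : (cLnorm (@lebesgue_measure R) p%:R (multiplier_op (@lebesgue_measure R) (fun x y => x *
  y)%R (chi [set x : R | (0 < x)%R]) f2) <=
   cLnorm (@lebesgue_measure R) p%:R f2)%E.
  by rewrite p2; apply: multiplier_L2_le => //; exact: normc_le1_chi.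
have id2 : (cLnorm (@lebesgue_measure R) p%:R f2 <=
   cLnorm (@lebesgue_measure R) p%:R (multiplier_op (@lebesgue_measure R) (fun x y => x * y)%R
     (fun=> 1%R) f2))%E.
  rewrite le_eqVlt; apply/orP; left; apply/eqP; apply: eq_cLnorm => x.
  by rewrite multiplier1_id.
apply: le_trans (Z2 f1 f2 tf1 tf2).
apply: lee_wpmul2l; first exact: cLnorm_ge0.
exact: le_trans L2 id2.
Qed.
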